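(* Let $\mathbb B$ be the unit ball in $\mathbb R^d$ and let $1\le t\le m$ be integers. All the eigenvalues $\lambda=\lambda^{(m,t)}$ of the problem $$(-\Delta)^m u=\lambda(-\Delta)^{m-t}u\ \text{ in }\mathbb B,\qquad u=\frac{\partial u}{\partial\nu}=\dots=\frac{\partial^{m-1}u}{\partial\nu^{m-1}}=0\ \text{ on }\partial\mathbb B,$$ are solutions to the equation $$\det L(t,\ell+m-t)=0$$ for some $\ell\in\mathbb N_0$.
   Context: $\mathbb N_0$ is the set of nonnegative integers. The problem is understood weakly: $u\in H^m_0(\mathbb B)$ and $\int_{\mathbb B}\nabla^m u\cdot\nabla^m\phi=\lambda\int_{\mathbb B}\nabla^{m-t}u\cdot\nabla^{m-t}\phi$ for all $\phi\in H^m_0(\mathbb B)$, where $\nabla^p u=\Delta^j u$ if $p=2j$ and $\nabla^p u=\nabla\Delta^j u$ if $p=2j+1$. For $\kappa\in\mathbb N_0$ set $\tilde J_\kappa(z)=z^{1-d/2}J_{\kappa+d/2-1}(z)$, $z\in\mathbb C$, where $J$ is the Bessel function of the first kind (so $\tilde J_\kappa$ is an entire function). For $\lambda>0$ set $\gamma_p=\lambda^{1/(2t)}e^{i(p-1)\pi/t}$, $p=1,\dots,t$. For $k\in\mathbb N_0$, $L(t,k)$ is the $t\times t$ matrix (depending on $\lambda$ through the $\gamma_j$) $$L(t,k)=\left((-\gamma_j)^{i-1}\tilde J_{k+i-1}(\gamma_j)\right)_{1\le i,j\le t}.$$ *)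

(* Defs.v *)
From HB Require Import structures.
From mathcomp Require Import all_boot all_order all_algebra.
From mathcomp Require Import all_classical all_reals all_analysis.
From mathcomp.real_closed Require Import complex.
From mathcomp Require Import ring.

Set Implicit Arguments.
Unset Strict Implicit.
Unset Printing Implicit Defensive.

Import Order.TTheory GRing.Theory Num.Theory.
Import numFieldNormedType.Exports.

Local Open Scope classical_set_scope.
Local Open Scope ring_scope.

(* R^n is 'rV[R]_n with the Borel sigma-algebra, presented as the product one,
   and n-dimensional Lebesgue measure is obtained by iterating the product with
   the one-dimensional one; lebesgue_rV_box characterizes it. *)
Section measurable_row.
Variables (R : realType) (n : nat).

Let coors : 'I_n -> 'rV[R]_n -> measurableTypeR R := fun i x => x ord0 i.

Let row_set0 : g_sigma_preimage coors set0.
Proof. exact: sigma_algebra0. Qed.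

Let row_setC A : g_sigma_preimage coors A -> g_sigma_preimage coors (~` A).
Proof. exact: sigma_algebraC. Qed.

Let row_bigcup (F : _^nat) : (forall i, g_sigma_preimage coors (F i)) ->
  g_sigma_preimage coors (\bigcup_i (F i)).
Proof. exact: sigma_algebra_bigcup. Qed.

HB.instance Definition _ :=
  @isMeasurable.Build (measure_tuple_display default_measure_display)
    'rV[R]_n (g_sigma_preimage coors) row_set0 row_setC row_bigcup.

Lemma measurable_coord (i : 'I_n) :
  measurable_fun [set: 'rV[R]_n] (fun x => x ord0 i : measurableTypeR R).
Proof.
move=> _ Y mY; rewrite setTI; apply: sub_sigma_algebra => /=.
rewrite -bigcup_seq/=; exists i => /=; first by rewrite mem_index_enum.
by exists Y => //; rewrite setTI.
Qed.

Lemma measurable_rowP d (T : measurableType d) (f : T -> 'rV[R]_n) :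
  (forall i, measurable_fun setT (fun x => f x ord0 i : measurableTypeR R)) ->
  measurable_fun setT f.
Proof.
move=> mf.
have H : <<s \big[setU/set0]_(i < n)
    preimage_set_system setT (coors i) measurable >> `<=`
    [set A | measurable (f @^-1` A)].
  apply: smallest_sub.
    split => /=.
    - by rewrite preimage_set0.
    - by move=> A mA; rewrite setTD preimage_setC; exact: measurableC.
    - by move=> F mF; rewrite preimage_bigcup; exact: bigcupT_measurable.
  rewrite -bigcup_seq; apply: bigcup_sub => i _ A [B mB <-] /=.
  by have := mf i measurableT B mB; rewrite !setTI.
by move=> _ A mA; rewrite setTI; exact: H.
Qed.

End measurable_row.

Section lebesgue_row.
Variable R : realType.

Definition row_cons n (p : measurableTypeR R * 'rV[R]_n) : 'rV[R]_n.+1 :=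
  row_mx (p.1)%:M p.2.

Definition row_split n (x : 'rV[R]_n.+1) : measurableTypeR R * 'rV[R]_n :=
  (x ord0 ord0, \row_i x ord0 (lift ord0 i)).

Lemma row_cons0 n p : @row_cons n p ord0 ord0 = p.1.
Proof.
rewrite /row_cons mxE; case: splitP => [j _|k //].
by rewrite (ord1 j) mxE eqxx.
Qed.

Lemma row_consS n p i : @row_cons n p ord0 (lift ord0 i) = p.2 ord0 i.
Proof.
rewrite /row_cons mxE; case: splitP => [j|k] /=; rewrite /bump leq0n.
  by rewrite (ord1 j).
by move=> /addnI /val_inj ->.
Qed.

Lemma row_consK n : cancel (@row_cons n) (@row_split n).
Proof.
move=> [a v]; rewrite /row_split row_cons0; congr pair.
by apply/rowP => i; rewrite mxE row_consS.
Qed.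

Lemma measurable_row_cons n : measurable_fun setT (@row_cons n).
Proof.
apply: measurable_rowP => i.
case: (unliftP ord0 i) => [j|] ->.
- under eq_fun do rewrite row_consS.
  exact: (measurableT_comp (@measurable_coord R n j) measurable_snd).
- under eq_fun do rewrite row_cons0.
  exact: measurable_fst.
Qed.

Lemma measurable_row_split n : measurable_fun setT (@row_split n).
Proof.
apply/measurable_fun_pairP; split; first exact: measurable_coord.
apply: measurable_rowP => i.
under eq_fun do rewrite mxE.
exact: measurable_coord.
Qed.

Lemma row_splitK n : cancel (@row_split n) (@row_cons n).
Proof.
move=> x; apply/rowP => i; case: (unliftP ord0 i) => [j|] ->.
  by rewrite row_consS mxE.
by rewrite row_cons0.
Qed.

Section step.
Variables (n : nat) (mu : {sigma_finite_measure set 'rV[R]_n -> \bar R}).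

Definition lebesgue_step : set 'rV[R]_n.+1 -> \bar R :=
  pushforward (@lebesgue_measure R \x mu)%E (@row_cons n).

Let lebesgue_step0 : lebesgue_step set0 = 0%E.
Proof. by rewrite /lebesgue_step /pushforward preimage_set0 measure0. Qed.

Let lebesgue_step_ge0 A : (0 <= lebesgue_step A)%E.
Proof. by rewrite /lebesgue_step /pushforward measure_ge0. Qed.

Let lebesgue_step_sigma_additive : semi_sigma_additive lebesgue_step.
Proof.
have mcons A : measurable A -> measurable (@row_cons n @^-1` A).
  by move=> mA; rewrite -[X in measurable X]setTI; exact: measurable_row_cons.
move=> F mF tF mUF; rewrite /lebesgue_step /pushforward preimage_bigcup.
apply: measure_semi_sigma_additive.
- by move=> k; exact: mcons.
- apply/trivIsetP => /= i j _ _ ij; rewrite -preimage_setI.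
  by move/trivIsetP : tF => /(_ _ _ _ _ ij) ->//; rewrite preimage_set0.
- by rewrite -preimage_bigcup; exact: mcons.
Qed.

HB.instance Definition _ := isMeasure.Build _ _ _ lebesgue_step
  lebesgue_step0 lebesgue_step_ge0 lebesgue_step_sigma_additive.

Let lebesgue_step_sigma_finite : sigma_finite setT lebesgue_step.
Proof.
have /sigma_finiteP[F [TF ndF Foo]] := sigma_finiteT (@lebesgue_measure R).
have /sigma_finiteP[G [TG ndG Goo]] := sigma_finiteT mu.
exists (fun k => @row_split n @^-1` (F k `*` G k)).
  rewrite -preimage_bigcup -(preimage_setT (@row_split n)); congr (_ @^-1` _).
  rewrite -setXTT TF TG predeqE => -[x y]; split.
    move=> [/= [k _ Fkx] [l _ Gly]]; exists (maxn k l) => //; split.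
    - by move: x Fkx; exact/subsetPset/ndF/leq_maxl.
    - by move: y Gly; exact/subsetPset/ndG/leq_maxr.
  by move=> [k _ []/= ? ?]; split; exists k.
move=> k; have [mF Fk] := Foo k; have [mG Gk] := Goo k.
split.
  rewrite -[X in measurable X]setTI; apply: measurable_row_split => //.
  exact: measurableX.
rewrite /lebesgue_step /pushforward -comp_preimage.
rewrite (_ : _ \o _ = id); last by apply/funext => p /=; rewrite row_consK.
by rewrite preimage_id product_measure1E// lte_mul_pinfty// ge0_fin_numE.
Qed.

HB.instance Definition _ := Measure_isSigmaFinite.Build _ _ _ lebesgue_step
  lebesgue_step_sigma_finite.

End step.

Fixpoint lebesgue_rV n : {sigma_finite_measure set 'rV[R]_n -> \bar R} :=
  match n return {sigma_finite_measure set 'rV[R]_n -> \bar R} with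
  | 0 => dirac (0 : 'rV[R]_0)
  | n.+1 => lebesgue_step (lebesgue_rV n)
  end.

Lemma lebesgue_rV_box n (A : 'I_n -> set (measurableTypeR R)) :
  (forall i, measurable (A i)) ->
  lebesgue_rV n [set x | forall i, A i (x ord0 i)] =
  (\prod_(i < n) lebesgue_measure (A i))%E.
Proof.
elim: n A => [|n IHn] A mA.
  rewrite big_ord0 /= diracE mem_set//.
  by case.
have mB : measurable [set x : 'rV[R]_n | forall i, A (lift ord0 i) (x ord0 i)].
  rewrite (_ : mkset _ = \bigcap_(i in [set: 'I_n])
      ((fun x : 'rV[R]_n => x ord0 i) @^-1` A (lift ord0 i))).
    apply: fin_bigcap_measurable => // i _.
    by rewrite -[X in measurable X]setTI; exact: measurable_coord.
  by apply/seteqP; split => x /= H i => [_|]; exact: H.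
rewrite big_ord_recl -IHn// /= -product_measure1E//.
rewrite /lebesgue_step /pushforward; congr (_ _).
apply/seteqP; split => [[a v] /= H|[a v] /= [H0 H] i].
  split; first by have := H ord0; rewrite row_cons0.
  by move=> i; have := H (lift ord0 i); rewrite row_consS.
by case: (unliftP ord0 i) => [j|] ->; rewrite ?row_consS ?row_cons0.
Qed.

End lebesgue_row.

Section sobolev.
Variables (R : realType) (d : nat).
Local Notation V := 'rV[R]_d.
Local Notation mu := (lebesgue_rV R d).

Definition unit_ball : set V := [set x | \sum_(i < d) x ord0 i ^+ 2 < 1].

Definition partial (i : 'I_d) (f : V -> R) : V -> R :=
  'D_(delta_mx ord0 i) f.

(* A sequence s of indices plays the role of the multi-index counting the
   occurrences of each i in s; size s is its length. *)
Definition partials (s : seq 'I_d) (f : V -> R) : V -> R := foldr partial f s.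

Definition smooth (f : V -> R) := forall s x,
  {for x, continuous (partials s f)} /\
  forall i, derivable (partials s f) x (delta_mx ord0 i).

Definition test_function (phi : V -> R) :=
  [/\ smooth phi, compact (closure [set x | phi x != 0]) &
      closure [set x | phi x != 0] `<=` unit_ball].

(* Functions on the ball are total functions, of which only the values on
   unit_ball matter. *)
Definition locally_integrable_ball (u : V -> R) :=
  measurable_fun unit_ball u /\
  forall K, K `<=` unit_ball -> compact K -> mu.-integrable K (EFin \o u).

Definition L2_ball (u : V -> R) := measurable_fun unit_ball u /\
  mu.-integrable unit_ball (fun x => (u x ^+ 2)%:E).

Definition is_weak_derivative (s : seq 'I_d) (u v : V -> R) :=
  locally_integrable_ball v /\
  forall phi, test_function phi ->
    \int[mu]_(x in unit_ball) (u x * partials s phi x) =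
    (-1) ^+ size s * \int[mu]_(x in unit_ball) (v x * phi x).

(* A choice of representative: weak derivatives are unique up to a null set. *)
Definition weak_derivative (s : seq 'I_d) (u : V -> R) : V -> R :=
  get (is_weak_derivative s u).

Definition sobolev (m : nat) (u : V -> R) :=
  L2_ball u /\ forall s, (size s <= m)%N ->
    exists2 v, is_weak_derivative s u v & L2_ball v.

(* H^m_0: the closure of the test functions in the H^m norm. *)
Definition sobolev0 (m : nat) (u : V -> R) :=
  sobolev m u /\ exists phi : nat -> V -> R,
    (forall n, test_function (phi n)) /\
    forall s, (size s <= m)%N ->
      (\int[mu]_(x in unit_ball)
         ((partials s (phi n) x - weak_derivative s u x) ^+ 2)%:E)%E
        @[n --> \oo] --> 0%E.

Definition weak_laplacian (u : V -> R) : V -> R :=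
  fun x => \sum_(i < d) weak_derivative [:: i; i] u x.

(* nabla^p u . nabla^p v, with nabla^p = Delta^(p/2) for p even and
   grad Delta^((p-1)/2) for p odd *)
Definition nabla_dot (p : nat) (u v : V -> R) (x : V) : R :=
  let Lu := iter p./2 weak_laplacian u in
  let Lv := iter p./2 weak_laplacian v in
  if odd p then
    \sum_(i < d) weak_derivative [:: i] Lu x * weak_derivative [:: i] Lv x
  else Lu x * Lv x.

Definition is_eigenvalue (m t : nat) (lambda : R) :=
  exists u : V -> R,
    [/\ sobolev0 m u,
        ~ {ae mu, forall x, unit_ball x -> u x = 0} &
        forall phi, sobolev0 m phi ->
          \int[mu]_(x in unit_ball) nabla_dot m u phi x =
          lambda * \int[mu]_(x in unit_ball) nabla_dot (m - t) u phi x].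

End sobolev.

Section bessel.
Variable R : realType.
Local Open Scope complex_scope.
Implicit Types z w : R[i].

Definition cexp (z : R[i]) : R[i] :=
  (expR (complex.Re z) * cos (complex.Im z)) +i*
  (expR (complex.Re z) * sin (complex.Im z)).

(* principal argument, in ]-pi, pi] *)
Definition carg (z : R[i]) : R :=
  let theta := acos (complex.Re z / Normc.normc z) in
  if 0 <= complex.Im z then theta else - theta.

Definition clog (z : R[i]) : R[i] := ln (Normc.normc z) +i* carg z.

Definition cpow (z : R[i]) (a : R) : R[i] := cexp (a%:C * clog z).

Definition Gamma (s : R) : R :=
  \int[lebesgue_measure]_(x in `]0, +oo[) (x `^ (s - 1) * expR (- x)).

(* R[i]^o carries the topology of the norm of R[i]. *)
Definition csum (u : nat -> R[i]) : R[i] := limn (series (u : nat -> R[i]^o)).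

Definition besselJ (nu : R) (z : R[i]) : R[i] :=
  cpow (z / 2) nu *
  csum (fun j =>
    ((-1) ^+ j / (j`!%:R * Gamma (j%:R + nu + 1)))%:C * (z / 2) ^+ j.*2).

Definition Jtilde_punctured (d kappa : nat) (z : R[i]) : R[i] :=
  cpow z (1 - d%:R / 2) * besselJ (kappa%:R + d%:R / 2 - 1) z.

(* The value at 0 is that of the entire extension; see JtildeE. *)
Definition Jtilde (d kappa : nat) (z : R[i]) : R[i] :=
  if z == 0 then
    lim ((Jtilde_punctured d kappa w : R[i]^o) @[w --> (0 : R[i]^o)^'])
  else Jtilde_punctured d kappa z.

Lemma cexpD z w : cexp (z + w) = cexp z * cexp w.
Proof.
case: z w => [a b] [c e]; rewrite /cexp/= expRD cosD sinD.
by apply/eqP; rewrite eq_complex/=; apply/andP; split; apply/eqP; ring.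
Qed.

Lemma cexpMn z k : cexp (k%:R * z) = cexp z ^+ k.
Proof.
elim: k => [|k IHk].
  rewrite mul0r expr0 /cexp/= expR0 cos0 sin0 mulr1 mulr0.
  by [].
by rewrite -natr1 mulrDl mul1r cexpD IHk exprSr.
Qed.

Lemma normc_gt0 z : z != 0 -> 0 < Normc.normc z.
Proof.
move=> z0; rewrite lt_neqAle; apply/andP; split; last first.
  by case: (z) => a b /=; rewrite sqrtr_ge0.
by rewrite eq_sym; apply: contra_neq z0 => /Normc.eq0_normc.
Qed.

Lemma clogK z : z != 0 -> cexp (clog z) = z.
Proof.
move=> z0; have n0 := normc_gt0 z0.
have nE : Normc.normc z ^+ 2 = complex.Re z ^+ 2 + complex.Im z ^+ 2.
  by case: (z) => a b /=; rewrite sqr_sqrtr// addr_ge0// sqr_ge0.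
have dE : (complex.Re z / Normc.normc z) ^+ 2 +
          (complex.Im z / Normc.normc z) ^+ 2 = 1.
  by rewrite !expr_div_n -mulrDl -nE divff// expf_neq0// gt_eqF.
have xI : -1 <= complex.Re z / Normc.normc z <= 1.
  rewrite -ler_norml -(@ler_pXn2r _ 2) ?nnegrE//.
  by rewrite expr1n real_normK ?num_real// -dE lerDl sqr_ge0.
have sE : sin (carg z) = complex.Im z / Normc.normc z.
  have sq : Num.sqrt (1 - (complex.Re z / Normc.normc z) ^+ 2) =
            `|complex.Im z / Normc.normc z|.
    by rewrite -dE addrAC subrr add0r sqrtr_sqr.
  rewrite /carg; case: leP => Iz; rewrite ?sinN sin_acos// sq.
    by rewrite ger0_norm// divr_ge0// ltW.
  by rewrite ltr0_norm ?opprK// pmulr_llt0// invr_gt0.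
have cE : cos (carg z) = complex.Re z / Normc.normc z.
  by rewrite /carg; case: leP => Iz; rewrite ?cosN acosK.
rewrite /cexp /clog /= lnK ?posrE// cE sE.
rewrite ![Normc.normc z * _]mulrC !divfK ?gt_eqF//.
by case: (z).
Qed.

Lemma cpowD z (a b : R) : cpow z (a + b) = cpow z a * cpow z b.
Proof. by rewrite /cpow -cexpD rmorphD mulrDl. Qed.

Lemma cpow_nat z k : z != 0 -> cpow z k%:R = z ^+ k.
Proof. by move=> z0; rewrite /cpow rmorph_nat cexpMn clogK. Qed.

Lemma clog_half z : z != 0 -> clog (z / 2) = clog z - (ln 2)%:C.
Proof.
move=> z0; have n0 := normc_gt0 z0.
have -> : z / 2 = (complex.Re z / 2) +i* (complex.Im z / 2).
  by case: (z) => a b; apply/eqP; rewrite eq_complex/=; apply/andP; split; apply/eqP; field.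
have nE : Normc.normc ((complex.Re z / 2) +i* (complex.Im z / 2)) = Normc.normc z / 2.
  case: (z) => a b /=.
  by rewrite !expr_div_n -mulrDl sqrtrM ?addr_ge0 ?sqr_ge0// -exprVn sqrtr_sqr ger0_norm.
rewrite /clog /carg nE /= lnM ?posrE// ?lnV ?posrE//.
have -> : complex.Re z / 2 / (Normc.normc z / 2) = complex.Re z / Normc.normc z.
  by field; rewrite gt_eqF.
have -> : (0 <= complex.Im z / 2) = (0 <= complex.Im z) by rewrite pmulr_lge0.
by apply/eqP; rewrite eq_complex/= eqxx oppr0 addr0 eqxx.
Qed.

Lemma cpow_half z (a : R) : z != 0 -> cpow (z / 2) a = (2 `^ (- a))%:C * cpow z a.
Proof.
move=> z0; rewrite /cpow clog_half// mulrBr cexpD mulrC; congr (_ * _).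
rewrite -rmorphM -rmorphN /cexp /= cos0 sin0 mulr1 mulr0.
by rewrite /powR pnatr_eq0/= mulNr.
Qed.

Lemma JtildeE d k z : z != 0 -> Jtilde d k z =
  (2 `^ (1 - k%:R - d%:R / 2))%:C * z ^+ k *
  csum (fun j => ((-1) ^+ j / (j`!%:R * Gamma (j%:R + k%:R + d%:R / 2)))%:C
     * (z / 2) ^+ j.*2).
Proof.
move=> z0; rewrite /Jtilde (negbTE z0) /Jtilde_punctured /besselJ.
have -> : (fun j => ((-1) ^+ j / (j`!%:R *
      Gamma (j%:R + (k%:R + d%:R / 2 - 1) + 1)))%:C * (z / 2) ^+ j.*2) =
    (fun j => ((-1) ^+ j / (j`!%:R * Gamma (j%:R + k%:R + d%:R / 2)))%:C
     * (z / 2) ^+ j.*2).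
  apply/funext => j; rewrite (_ : j%:R + (_ - 1) + 1 = j%:R + k%:R + d%:R / 2)//.
  by rewrite -addrA subrK addrA.
move: (csum _) => S; rewrite mulrA; congr (_ * S).
rewrite cpow_half//.
rewrite mulrCA.
rewrite -cpowD.
rewrite -cpow_nat//.
have -> : 1 - d%:R / 2 + (k%:R + d%:R / 2 - 1) = k%:R :> R by ring.
by have -> : - (k%:R + d%:R / 2 - 1) = 1 - k%:R - d%:R / 2 :> R by ring.
Qed.

(* The indices i, j : 'I_t of gam and Lmatrix start at 0, so that j here is
   p - 1 in gamma_p. *)
Definition gam (t : nat) (lambda : R) (j : 'I_t) : R[i] :=
  (lambda `^ (2 * t)%:R^-1)%:C * cexp (0 +i* (j%:R * pi / t%:R)).

Definition Lmatrix (d t k : nat) (lambda : R) : 'M[R[i]]_t :=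
  \matrix_(i < t, j < t)
    ((- gam lambda j) ^+ i * Jtilde d (k + i) (gam lambda j)).

End bessel.

(* Main.v *)
Require Import Defs.
From HB Require Import structures.
From mathcomp Require Import all_boot all_order all_algebra.
From mathcomp Require Import all_classical all_reals all_analysis.
From mathcomp.real_closed Require Import complex.
From mathcomp Require Import measurable_realfun ring lra zify.

Set Implicit Arguments.
Unset Strict Implicit.
Unset Printing Implicit Defensive.

Import Order.TTheory GRing.Theory Num.Theory.
Import numFieldNormedType.Exports.

Local Open Scope classical_set_scope.
Local Open Scope ring_scope.

(* Suppose that u is an eigenfunction and that no determinant vanishes.  For h
   harmonic and homogeneous of degree l, consider the moments
   F(p) = int u p(|x|^2) h of polynomials p in one variable; the laplacian acts on
   p by a second order operator D.  Testing the equation with cut-off polynomials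
   and integrating by parts gives F(A((1 - X)^m q)) = 0 for every q, where
   A = (-D)^m - lambda (-D)^(m-t).  Hence T = F o A is determined by the numbers
   b_i = T((X - 1)^i), i < m, of which the first m - t vanish, and summing
   T(X^k) against the coefficients of the Bessel series at gamma_j shows that the
   remaining ones, suitably scaled, form a row vector killed by L(t, l + m - t).
   So T = 0, which forces F = 0.  By Almansi's decomposition u is then orthogonal to
   all polynomials, hence zero almost everywhere.  If lambda <= 0, testing the
   equation with u itself shows that nabla^m u = 0, so the same argument applies
   with A = (-D)^m, for which no determinant is needed. *)

(** * A smooth cut-off on the line *)

(** The eigenfunction is given only by the weak equation, so the argument works by duality, on
    moments, instead of solving the equation pointwise. The polynomials (1 - |x|^2)^m q vanish to
    order m on the sphere, as functions in H^m_0 do, but their supports reach the sphere: they are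
    approximated by cut-offs whose derivatives of order at most m stay bounded, and dominated
    convergence applies. The Bessel coefficients a_k arise because f = sum a_k X^k satisfies -D f =
    gamma^2 f, that is, f(|x|^2) h solves the Helmholtz equation; as gamma_j^2 is a t-th root of
    lambda, A formally kills f, and boundedness of the moments makes the sums converge. The numbers
    T((X - 1)^i) are paired with the Taylor coefficients of f at X = 1, that is on the sphere, where
    differentiating a Bessel series raises its order: hence the entries of L. As A contains at least
    m - t powers of D, only t unknowns are left for t roots, and the system is square. Positivity of
    lambda has to come before, since gamma_j involves a real power of lambda. *)

Section smooth_line.
Variable R : realType.
Implicit Types (G : nat -> R -> R) (P : {poly R}).

Lemma is_derive_ext (V : normedModType R) (f g : V -> R) x v df dg : f =1 g -> df = dg ->
  is_derive x v f df -> is_derive x v g dg.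
Proof. by move=> /funext -> ->. Qed.

(** All derivatives are carried along as explicit data, [G k] being the k-th one, so that a function
    of |x|^2 can be differentiated any number of times by shifting an index. *)
Definition derivative_seq G := forall (k : nat) (x : R), is_derive x 1 (G k) (G k.+1 x).

Lemma derivative_seq_reflect G c : derivative_seq G ->
  derivative_seq (fun k s => (-1) ^+ k * G k (c - s)).
Proof.
move=> HG k x.
have H : is_derive x 1 (fun s : R => c - s) (-1).
    have := @is_deriveB R R R (cst c) id x 1 0 1 (is_derive_cst _ _ _) (is_derive_id _ _).
    by rewrite sub0r.
have H2 := @is_derive1_comp _ (G k) (fun s : R => c - s) x _ _ (HG k (c - x)) H.
have := @is_deriveZ R R R _ ((-1) ^+ k) x 1 _ H2.
by apply: is_derive_ext => //; rewrite exprSr /GRing.scale/= mulrA mulrAC.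
Qed.

(** The derivatives of y^m. For k > m the truncated exponent is harmless, because the falling
    factorial vanishes. *)
Definition power_seq (m k : nat) (y : R) : R := (m ^_ k)%:R * y ^+ (m - k).

Lemma derivative_seq_power m : derivative_seq (power_seq m).
Proof.
move=> k x; rewrite /power_seq.
have H := @is_deriveX R R id (m - k) x 1 1 (is_derive_id _ _).
have := @is_deriveZ R R R _ (m ^_ k)%:R x 1 _ H.
apply: is_derive_ext => [y|]; first by rewrite /= exprfctE.
rewrite /GRing.scale/= mulr1 ffactnSr.
case: (ltnP k m) => km; last by move: km => /eqP ->; rewrite muln0 !mulr0n !mul0r mulr0.
rewrite subnS natrM -mulrA.
by rewrite -[_ *+ (m - k)]mulr_natl.
Qed.

(* The functions y^p P(e/y) exp(-e/y), extended by 0 to y <= 0, are stable under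
   differentiation, and they are bounded on y <= 1 uniformly in e. *)
Definition bump (p : nat) P (e y : R) : R :=
  if 0 < y then y ^+ p * P.[e / y] * expR (- (e / y)) else 0.

(** A single term of the exponential series. The bound does not depend on w, which makes the later
    bounds uniform in e. *)
Lemma exprn_expRN_le n (w : R) : 0 <= w -> w ^+ n * expR (- w) <= n`!%:R.
Proof.
move=> w0; rewrite expRN ler_pdivrMr ?expR_gt0//.
case: n => [|n]; first by rewrite expr0 fact0 mul1r -expR0 ler_expR.
rewrite mulrC -ler_pdivrMr ?ltr0n ?fact_gt0//.
by apply: le_trans (expR_ge1Dxn n w0); rewrite lerDr.
Qed.

Lemma horner_expRN_bounded P :
  {C : R | 0 <= C & forall w : R, 0 <= w -> `|P.[w]| * expR (- w) <= C}.
Proof.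
exists (\sum_(i < size P) `|P`_i| * i`!%:R).
  by apply: sumr_ge0 => i _; rewrite mulr_ge0.
move=> w w0; rewrite horner_coef.
apply: (@le_trans _ _ ((\sum_(i < size P) `|P`_i * w ^+ i|) * expR (- w))).
  by rewrite ler_wpM2r ?expR_ge0// ler_norm_sum.
rewrite mulr_suml; apply: ler_sum => i _.
by rewrite normrM normrX (ger0_norm w0) -mulrA ler_wpM2l// exprn_expRN_le.
Qed.

Lemma bump_bounded p P : {C : R | 0 <= C & forall (e y : R), 0 <= e -> y <= 1 ->
  `|bump p P e y| <= C}.
Proof.
have [C C0 HC] := horner_expRN_bounded P; exists C => // e y e0 y1.
rewrite /bump; case: ltP => y0; last by rewrite normr0.
rewrite !normrM (ger0_norm (expR_ge0 _)) -mulrA -[leRHS]mul1r.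
apply: ler_pM => //.
- by rewrite normrX (gtr0_norm y0) exprn_ile1// ltW.
- by apply: HC; rewrite divr_ge0// ltW.
Qed.

(** Differentiation of y^p P(w) exp(-w), where w = e/y and w' = -w/y, on the pair (p, P). As long as
    p > 0, the factor 1/y lowers p by one and e does not appear; once p = 0 it must be rewritten as
    w/e, and uniformity in e is lost. A cut-off of order m therefore has m derivatives under
    control. *)
Definition dbump (e : R) (st : nat * {poly R}) : nat * {poly R} :=
  if st.1 is p.+1 then (p, p.+1%:R *: st.2 + 'X * (st.2 - st.2^`()))
  else (0%N, e^-1 *: ('X ^+ 2 * (st.2 - st.2^`()))).

Definition bump_seq st e k : R -> R :=
  bump (iter k (dbump e) st).1 (iter k (dbump e) st).2 e.

Lemma is_derive_bump_pos p P (e y : R) : e != 0 -> 0 < y ->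
  is_derive y 1 (fun y => y ^+ p * P.[e / y] * expR (- (e / y)))
   (bump (dbump e (p, P)).1 (dbump e (p, P)).2 e y).
Proof.
move=> e0 y0; have yn0 : y != 0 by rewrite gt_eqF.
have Hw : is_derive y 1 (fun y : R => e / y) (- (e / y ^+ 2)).
  have := is_deriveZ e (is_deriveV yn0 (is_derive_id y 1)).
  by move=> /is_derive_eq; apply; rewrite /GRing.scale/= mulr1 mulrN.
have HwN := is_deriveN Hw.
have HE : is_derive y 1 (fun y : R => expR (- (e / y)))
    (expR (- (e / y)) * - - (e / y ^+ 2)).
  exact: (@is_derive1_comp _ expR (fun y : R => - (e / y)) y _ _
    (is_derive_expR (- (e / y))) HwN).
have HP := @is_derive1_comp _ (horner P) (fun y : R => e / y) y _ _
  (is_derive_poly P (e / y)) Hw.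
have HX := is_deriveX p (is_derive_id y (1 : R)).
have := is_deriveM (is_deriveM HX HP) HE.
apply: is_derive_ext => [z|]; first by rewrite !fctE /= ?exprfctE.
rewrite /bump /= y0 /GRing.scale/=.
set E := expR _.
case: p HX => [|p] HX /=;
    rewrite !fctE /= !(hornerD, hornerN, hornerZ, hornerM, hornerX, hornerXn).
  by field; rewrite yn0 e0.
rewrite exprS; move: (p.+1%:R : R) (y ^+ p) P.[_] P^`().[_] => N Y a b.
by field.
Qed.

(** Flatness at y = 0, which makes the extension by 0 differentiable there: replacing P by P X^2
    gives a bounded function again, and the additional factor is (e/y)^2. *)
Lemma bump_le_sqr p P (e : R) : 0 < e ->
  {C : R | 0 <= C & forall y, y <= 1 -> `|bump p P e y| <= C * y ^+ 2}.
Proof.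
move=> e0; have [C C0 HC] := bump_bounded p (P * 'X^2); exists (C / e ^+ 2).
  by rewrite divr_ge0// sqr_ge0.
move=> y y1; have := HC e y (ltW e0) y1; rewrite /bump.
case: ltP => y0; last by rewrite normr0 mulr_ge0 ?sqr_ge0 ?divr_ge0// ?sqr_ge0.
rewrite hornerM hornerXn => H.
rewrite [leRHS]mulrAC ler_pdivlMr ?exprn_gt0//.
have -> : y ^+ p * P.[e / y] * expR (- (e / y)) =
   (y ^+ p * (P.[e / y] * (e / y) ^+ 2) * expR (- (e / y))) * (y / e) ^+ 2.
  by field; rewrite !gt_eqF.
have E : `|(y / e) ^+ 2| * e ^+ 2 = y ^+ 2.
  by rewrite ger0_norm ?sqr_ge0//; field; rewrite gt_eqF.
rewrite normrM -[leLHS]mulrA E.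
by rewrite ler_wpM2r ?sqr_ge0.
Qed.

Lemma is_derive_bump p P (e y : R) : 0 < e ->
  is_derive y 1 (bump p P e) (bump (dbump e (p, P)).1 (dbump e (p, P)).2 e y).
Proof.
move=> e0; have [y0|y0|->] := ltgtP y 0.
- have -> : bump (dbump e (p, P)).1 (dbump e (p, P)).2 e y = 0.
    by rewrite /bump ltNge ltW.
  apply: (near_eq_is_derive _ (is_derive_cst (0 : R) y (1 : R))).
  near=> z; rewrite /bump ltNge ltW//.
  by near: z; exact: lt_nbhsl.
- have H := is_derive_bump_pos p P (lt0r_neq0 e0) y0.
  apply: near_eq_is_derive H.
  near=> z; rewrite /bump ifT//.
  by near: z; exact: lt_nbhsr.
- have -> : bump (dbump e (p, P)).1 (dbump e (p, P)).2 e 0 = 0.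
    by rewrite /bump ltxx.
  have [C C0 HC] := bump_le_sqr p P e0.
  have H : (fun h : R => h^-1 *: (bump p P e (h *: 1 + 0) - bump p P e 0))
      @ 0^' --> (0 : R).
    have -> : bump p P e 0 = 0 by rewrite /bump ltxx.
    apply/cvgr0Pnorm_le => eps eps0; near=> h.
    rewrite subr0 addr0 [_ *: 1]mulr1 normrM normfV.
    have h0 : h != 0 by near: h; exact: nbhs_dnbhs_neq.
    rewrite ler_pdivrMl ?normr_gt0//.
    have h1 : `|h| <= 1.
      by near: h; apply: dnbhs0_le.
    have hC : `|h| <= eps / (C + 1).
      by near: h; apply: dnbhs0_le; rewrite divr_gt0// ltr_wpDl.
    apply: le_trans (HC h (le_trans (ler_norm _) h1)) _.
    rewrite -[h ^+ 2]real_normK ?num_real// expr2 mulrCA ler_wpM2l//.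
    rewrite ler_pdivlMr ?ltr_wpDl// in hC.
    by rewrite mulrC; apply: le_trans hC; rewrite ler_wpM2l// lerDl.
  split; first by apply/cvg_ex; exists 0.
  by apply: cvg_lim H.
Unshelve. all: by end_near. Qed.

Lemma derivative_seq_bump st e : 0 < e -> derivative_seq (bump_seq st e).
Proof.
move=> e0 k x; rewrite /bump_seq iterS.
by case: (iter k _ st) => p P; exact: is_derive_bump.
Qed.

(** For k <= m the polynomial P is the same for all e, whence bounds uniform in e. Its value at 0 is
    what survives as e tends to 0, so that the limit is the k-th derivative of y^m. *)
Lemma bump_seq_le (m k : nat) : (k <= m)%N ->
  exists2 P : {poly R}, P.[0] = (m ^_ k)%:R &
    forall e y, bump_seq (m, 1) e k y = bump (m - k) P e y.
Proof.
move=> km; suff [P HP PE] : exists2 P : {poly R}, P.[0] = (m ^_ k)%:R &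
    forall e, iter k (dbump e) (m, 1) = ((m - k)%N, P).
  by exists P => // e y; rewrite /bump_seq PE.
elim: k km => [_|k IH km].
  by exists 1; rewrite ?hornerE ?ffactn0// => e; rewrite /= subn0.
have [P HP PE] := IH (ltnW km).
exists ((m - k)%:R *: P + 'X * (P - P^`())).
  by rewrite !hornerE HP ffactnSr mulnC natrM.
move=> e; rewrite iterS PE /dbump /= subnS.
by case: (m - k)%N (subn_gt0 k m) => [|j]; rewrite km.
Qed.

(** Both arguments move with n, because the cut-offs of index n shift y by 1/(n+1) in addition to
    taking e = 1/(n+1). *)
Lemma bump_cvg p P (e y : nat -> R) (y0 : R) : 0 < y0 ->
  e @ \oo --> 0 -> y @ \oo --> y0 ->
  (fun n => bump p P (e n) (y n)) @ \oo --> P.[0] * y0 ^+ p.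
Proof.
move=> y0gt ce cy.
have cw : (fun n => e n / y n) @ \oo --> 0.
  rewrite -(mul0r (y0^-1)); apply: cvgM => //; apply: cvgV => //; exact: lt0r_neq0.
have H : (fun n => y n ^+ p * P.[e n / y n] * expR (- (e n / y n))) @ \oo -->
    y0 ^+ p * P.[0] * expR (- 0).
  apply: cvgM; last first.
    by apply: continuous_cvg; [exact: continuous_expR|exact: cvgN].
  apply: cvgM; first exact: (continuous_cvg _ (@exprn_continuous _ p y0) cy).
  by apply: continuous_cvg; [exact: continuous_horner|].
rewrite oppr0 expR0 mulr1 mulrC in H.
apply: cvg_trans H; apply: near_eq_cvg.
near=> n; rewrite /bump ifT//.
by near: n; apply: (cvgr_gt _ cy).
Unshelve. all: by end_near. Qed.

(* Derivatives in s of the cut-offs of (1 - s)^m vanishing for s >= 1 - 1/(n+1). *)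
Definition cutoff (m n k : nat) (s : R) : R :=
  (-1) ^+ k * bump_seq (m, 1) n.+1%:R^-1 k (1 - n.+1%:R^-1 - s).

Definition onem_power (m k : nat) (s : R) : R := (-1) ^+ k * power_seq m k (1 - s).

Lemma derivative_seq_cutoff m n : derivative_seq (cutoff m n).
Proof. by apply: derivative_seq_reflect; exact: derivative_seq_bump. Qed.

Lemma derivative_seq_onem_power m : derivative_seq (onem_power m).
Proof. by apply: derivative_seq_reflect; exact: derivative_seq_power. Qed.

Lemma cutoff0_neq0 m n s : (cutoff m n 0 s != 0) = (s < 1 - n.+1%:R^-1).
Proof.
rewrite /cutoff expr0 mul1r /bump_seq /= /bump subr_gt0.
case: ltP => H; last by rewrite eqxx.
rewrite hornerE mulr1 mulf_neq0 ?expf_neq0// gt_eqF ?expR_gt0 ?subr_gt0//.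
Qed.

Lemma cutoff_bounded m k : (k <= m)%N ->
  exists C : R, forall n s, 0 <= s -> `|cutoff m n k s| <= C.
Proof.
move=> /bump_seq_le[P _ PE]; have [C C0 HC] := bump_bounded (m - k) P.
exists C => n s s0; rewrite /cutoff PE normrM normrX normrN normr1 expr1n mul1r.
by apply: HC => //; rewrite -addrA gerDl -opprD oppr_le0 addr_ge0.
Qed.

Lemma cutoff_cvg m k s : (k <= m)%N -> s < 1 ->
  (fun n => cutoff m n k s) @ \oo --> onem_power m k s.
Proof.
move=> /bump_seq_le[P P0 PE] s1; rewrite /cutoff /onem_power.
apply: cvgMr; under eq_fun do rewrite PE.
rewrite /power_seq -P0; apply: bump_cvg; rewrite ?subr_gt0//.
  exact: cvg_harmonic.
rewrite -[X in _ --> X - s](subr0 1); apply: cvgB; last exact: cvg_cst.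
by apply: cvgB; [exact: cvg_cst|exact: cvg_harmonic].
Qed.

End smooth_line.

(** * Elementary functions, polynomials and the laplacian *)

Section elementary.
Variables (R : realType) (d : nat).
Local Notation V := 'rV[R]_d.
Implicit Types (f g P Q h : V -> R) (i j : 'I_d) (s : seq 'I_d) (x : V).

Lemma partial_cst i (c : R) : partial i (fun _ => c) = (fun _ => 0).
Proof. by apply/funext => x; rewrite /partial; apply: derive_cst. Qed.

Lemma differentiable_coor i x : differentiable (fun y : V => y ord0 i) x.
Proof. exact: differentiable_coord. Qed.

Lemma partial_coor i j : partial i (fun x => x ord0 j) = (fun _ => (i == j)%:R).
Proof.
apply/funext => x; rewrite /partial deriveE; last exact: differentiable_coor.
have l_lin : linear (fun y : V => y ord0 j) by move=> a u v; rewrite !mxE.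
pose L := GRing.isLinear.Build _ _ _ _ (fun y : V => y ord0 j) l_lin.
pose l : {linear V -> R} := HB.pack (fun y : V => y ord0 j) L.
rewrite (@diff_lin _ _ _ l); last exact: coord_continuous.
by rewrite /= mxE eqxx /= eq_sym.
Qed.

Lemma partialD i f g : (forall x, differentiable f x) ->
  (forall x, differentiable g x) ->
  partial i (fun x => f x + g x) = (fun x => partial i f x + partial i g x).
Proof.
by move=> df dg; apply/funext => x; apply: deriveD; exact: diff_derivable.
Qed.

Lemma partialM i f g : (forall x, differentiable f x) ->
  (forall x, differentiable g x) ->
  partial i (fun x => f x * g x) =
  (fun x => partial i f x * g x + f x * partial i g x).
Proof.
move=> df dg; apply/funext => x; rewrite /partial.
rewrite (@deriveM _ _ f g)//; [|exact: diff_derivable..].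
by rewrite addrC /GRing.scale/= [g x * _]mulrC.
Qed.

Lemma differentiable_comp1 (G : nat -> R -> R) k f x : derivative_seq G ->
  differentiable f x -> differentiable (fun x => G k (f x)) x.
Proof.
move=> HG df; apply: (@differentiable_comp _ _ _ _ f (G k)) => //.
by apply/derivable1_diffP; have [] := HG k (f x).
Qed.

Lemma partial_comp i (G : nat -> R -> R) k f : derivative_seq G ->
  (forall x, differentiable f x) ->
  partial i (fun x => G k (f x)) = (fun x => G k.+1 (f x) * partial i f x).
Proof.
move=> HG df; apply/funext => x; rewrite /partial.
have dG : differentiable (G k) (f x).
  by apply/derivable1_diffP; have [] := HG k (f x).
rewrite !deriveE//; last exact: differentiable_comp1.
rewrite (@diff_comp _ _ _ _ f (G k))//=.
have <- : (G k)^`()%classic (f x) = G k.+1 (f x).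
  by rewrite derive1E; have [_ ->] := HG k (f x).
by rewrite deriv1E 1?mulrC//; apply/derivable1_diffP.
Qed.

Opaque partial.

(* A class of smooth functions for which partial derivatives commute, which
   contains the cut-off test functions. *)
Inductive elementary : (V -> R) -> Prop :=
| elementary_cst c : elementary (fun _ => c)
| elementary_coor i : elementary (fun x => x ord0 i)
| elementaryD f g : elementary f -> elementary g ->
    elementary (fun x => f x + g x)
| elementaryM f g : elementary f -> elementary g ->
    elementary (fun x => f x * g x)
| elementary_comp G k f : derivative_seq G -> elementary f ->
    elementary (fun x => G k (f x)).

Inductive polynomial_fun : (V -> R) -> Prop :=
| polynomial_cst c : polynomial_fun (fun _ => c)
| polynomial_coor i : polynomial_fun (fun x => x ord0 i)
| polynomialD f g : polynomial_fun f -> polynomial_fun g ->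
    polynomial_fun (fun x => f x + g x)
| polynomialM f g : polynomial_fun f -> polynomial_fun g ->
    polynomial_fun (fun x => f x * g x).

Lemma polynomial_elementary f : polynomial_fun f -> elementary f.
Proof.
elim=> [c|i|{}f g _ Hf _ Hg|{}f g _ Hf _ Hg].
- exact: elementary_cst.
- exact: elementary_coor.
- exact: elementaryD.
- exact: elementaryM.
Qed.

Lemma elementary_differentiable f x : elementary f -> differentiable f x.
Proof.
move=> Hf; elim: Hf x => [c|i|{}f g _ Hf _ Hg|{}f g _ Hf _ Hg|G k {}f HG _ Hf] x.
- exact: differentiable_cst.
- exact: differentiable_coor.
- exact: differentiableD.
- exact: differentiableM.
- exact: differentiable_comp1.
Qed.
Hint Resolve elementary_differentiable : core.

Lemma elementary_partial i f : elementary f -> elementary (partial i f).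
Proof.
elim=> [c|j|{}f g Hf IHf Hg IHg|{}f g Hf IHf Hg IHg|G k {}f HG Hf IHf].
- by rewrite partial_cst; exact: elementary_cst.
- by rewrite partial_coor; exact: elementary_cst.
- by rewrite partialD; auto; apply: elementaryD.
- by rewrite partialM; auto; apply: elementaryD; apply: elementaryM.
- rewrite partial_comp; auto; apply: elementaryM => //.
  exact: elementary_comp.
Qed.

Lemma polynomial_partial i f : polynomial_fun f -> polynomial_fun (partial i f).
Proof.
elim=> [c|j|{}f g Hf IHf Hg IHg|{}f g Hf IHf Hg IHg].
- by rewrite partial_cst; exact: polynomial_cst.
- by rewrite partial_coor; exact: polynomial_cst.
- rewrite partialD => [|x|x]; [exact: polynomialD| |];
    exact/elementary_differentiable/polynomial_elementary.
- rewrite partialM => [|x|x]; [by apply: polynomialD; apply: polynomialM| |];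
    exact/elementary_differentiable/polynomial_elementary.
Qed.

Lemma elementary_partials s f : elementary f -> elementary (partials s f).
Proof. by move=> Hf; elim: s => //= i s; exact: elementary_partial. Qed.

Lemma elementary_continuous f : elementary f -> continuous f.
Proof.
by move=> Hf x; apply: differentiable_continuous; exact: elementary_differentiable.
Qed.

Lemma elementary_smooth f : elementary f -> smooth f.
Proof.
move=> Hf s x; split=> [|i].
  exact/elementary_continuous/elementary_partials.
by apply/diff_derivable/elementary_differentiable/elementary_partials.
Qed.

Lemma elementary_partialC i j f : elementary f ->
  partial i (partial j f) = partial j (partial i f).
Proof.
elim=> [c|k|{}f g Hf IHf Hg IHg|{}f g Hf IHf Hg IHg|G k {}f HG Hf IHf].
- by rewrite !partial_cst.
- by rewrite !partial_coor !partial_cst.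
- have HE := elementary_partial.
  by rewrite !partialD ?IHf ?IHg; auto.
- have HE := elementary_partial.
  have H1 k : elementary (fun x => partial k f x * g x) by apply: elementaryM; auto.
  have H2 k : elementary (fun x => f x * partial k g x) by apply: elementaryM; auto.
  have E k : partial k (fun x => f x * g x) =
      (fun x => partial k f x * g x + f x * partial k g x) by apply: partialM; auto.
  have E2 k l : partial k (fun x => partial l f x * g x + f x * partial l g x) =
      (fun x => partial k (partial l f) x * g x + partial l f x * partial k g x +
        (partial k f x * partial l g x + f x * partial k (partial l g) x)).
    by rewrite partialD; auto; apply/funext => x; rewrite !partialM; auto.
  by rewrite !E !E2 IHf IHg; apply/funext => x; rewrite addrACA.
- have HE := elementary_partial; have HC := elementary_comp.
  have E l n : partial l (fun x => G n (f x)) = (fun x => G n.+1 (f x) * partial l f x).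
    by apply: partial_comp; auto.
  have E2 l n : partial l (fun x => G k.+1 (f x) * partial n f x) =
      (fun x => G k.+2 (f x) * partial l f x * partial n f x +
                G k.+1 (f x) * partial l (partial n f) x).
    by rewrite partialM ?E; auto.
  by rewrite !E !E2 IHf; apply/funext => x; rewrite [_ * _ * partial j f x]mulrAC.
Qed.

Lemma partials_cat s1 s2 f : partials (s1 ++ s2) f = partials s1 (partials s2 f).
Proof. by rewrite /partials foldr_cat. Qed.

Lemma elementary_partials_partial s i f : elementary f ->
  partials s (partial i f) = partial i (partials s f).
Proof.
move=> Hf; elim: s => //= j s ->; apply: elementary_partialC.
exact: elementary_partials.
Qed.

(** Integration by parts reverses the list of indices; on elementary functions this restores the
    order. *)
Lemma elementary_partials_rev s f : elementary f ->
  partials (rev s) f = partials s f.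
Proof.
move=> Hf; elim: s => //= i s IH.
rewrite rev_cons -cats1 partials_cat /=.
by rewrite elementary_partials_partial// IH.
Qed.

Definition sqnorm x : R := \sum_(i < d) x ord0 i ^+ 2.

Lemma polynomial_sum (I : Type) (r : seq I) (F : I -> V -> R) :
  (forall a, polynomial_fun (F a)) -> polynomial_fun (fun x => \sum_(i <- r) F i x).
Proof.
move=> HF; elim: r => [|a r IH].
  by under eq_fun do rewrite big_nil; exact: polynomial_cst.
by under eq_fun do rewrite big_cons; exact: polynomialD.
Qed.

Lemma polynomialX f n : polynomial_fun f -> polynomial_fun (fun x => f x ^+ n).
Proof.
move=> Hf; elim: n => [|n IH].
  by under eq_fun do rewrite expr0; exact: polynomial_cst.
by under eq_fun do rewrite exprS; exact: polynomialM.
Qed.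

Lemma polynomial_horner (p : {poly R}) f : polynomial_fun f ->
  polynomial_fun (fun x => p.[f x]).
Proof.
move=> Hf; under eq_fun do rewrite horner_coef.
apply: polynomial_sum => i; apply: polynomialM; first exact: polynomial_cst.
exact: polynomialX.
Qed.

Lemma polynomial_sqnorm : polynomial_fun sqnorm.
Proof.
by apply: polynomial_sum => i; apply: polynomialX; exact: polynomial_coor.
Qed.

Lemma elementary_sqnorm : elementary sqnorm.
Proof. exact/polynomial_elementary/polynomial_sqnorm. Qed.
Hint Resolve elementary_sqnorm polynomial_sqnorm : core.

Lemma partial_sum i (I : Type) (r : seq I) (F : I -> V -> R) :
  (forall k, elementary (F k)) ->
  elementary (fun x => \sum_(k <- r) F k x) /\
  partial i (fun x => \sum_(k <- r) F k x) = (fun x => \sum_(k <- r) partial i (F k) x).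
Proof.
move=> HF; elim: r => [|a r [IH1 IH2]].
  under eq_fun do rewrite big_nil.
  under [in RHS]eq_fun do rewrite big_nil.
  by rewrite partial_cst; split => //; exact: elementary_cst.
under eq_fun do rewrite big_cons.
under [in RHS]eq_fun do rewrite big_cons.
by split; [exact: elementaryD|rewrite partialD ?IH2; auto].
Qed.

Lemma partial_sqnorm i : partial i sqnorm = (fun x => 2 * x ord0 i).
Proof.
rewrite /sqnorm; have [_ ->] := @partial_sum i _ (index_enum 'I_d)
  (fun k x => x ord0 k ^+ 2) (fun k => elementaryM (elementary_coor k) (elementary_coor k)).
apply/funext => x; rewrite (bigD1 i)//= big1 => [|k ki].
  rewrite (_ : (fun x : V => x ord0 i ^+ 2) = (fun x => x ord0 i * x ord0 i))//.
  rewrite partialM; [|by move=> y; exact: differentiable_coor..].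
  by rewrite partial_coor eqxx /=; ring.
rewrite (_ : (fun x : V => x ord0 k ^+ 2) = (fun x => x ord0 k * x ord0 k))//.
rewrite partialM; [|by move=> y; exact: differentiable_coor..].
by rewrite partial_coor eq_sym (negPf ki) mul0r mulr0 addr0.
Qed.

Definition laplacian f x : R := \sum_(i < d) partial i (partial i f) x.

Lemma elementary_sum (I : Type) (r : seq I) (F : I -> V -> R) :
  (forall k, elementary (F k)) -> elementary (fun x => \sum_(k <- r) F k x).
Proof.
move=> HF; elim: r => [|a r IH].
  by under eq_fun do rewrite big_nil; exact: elementary_cst.
by under eq_fun do rewrite big_cons; exact: elementaryD.
Qed.

Lemma elementary_laplacian f : elementary f -> elementary (laplacian f).
Proof.
by move=> Hf; apply: elementary_sum => i; do 2 apply: elementary_partial.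
Qed.

Lemma laplacianD f g : elementary f -> elementary g ->
  laplacian (fun x => f x + g x) = (fun x => laplacian f x + laplacian g x).
Proof.
move=> Hf Hg; have HE := elementary_partial.
apply/funext => x; rewrite /laplacian -big_split; apply: eq_bigr => i _ /=.
by rewrite !partialD; auto.
Qed.

Lemma laplacianZ c f : elementary f ->
  laplacian (fun x => c * f x) = (fun x => c * laplacian f x).
Proof.
move=> Hf; have HE := elementary_partial; have HC := elementary_cst.
apply/funext => x; rewrite /laplacian mulr_sumr; apply: eq_bigr => i _ /=.
have H g : elementary g -> partial i (fun x => c * g x) = (fun x => c * partial i g x).
  by move=> Hg; rewrite partialM ?partial_cst; auto; apply/funext => y; ring.
by rewrite !H; auto.
Qed.

Lemma laplacian_radialM (G : nat -> R -> R) f : derivative_seq G -> elementary f ->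
  laplacian (fun x => G 0%N (sqnorm x) * f x) =
  (fun x => (4 * sqnorm x * G 2%N (sqnorm x) + 2 * d%:R * G 1%N (sqnorm x)) * f x
    + 4 * G 1%N (sqnorm x) * (\sum_(i < d) x ord0 i * partial i f x)
    + G 0%N (sqnorm x) * laplacian f x).
Proof.
move=> HG Hf; have HE := elementary_partial; have HC := elementary_cst.
have Hx := elementary_coor; have HM := elementaryM; have HD := elementaryD.
have HGc := elementary_comp.
apply/funext => x; rewrite /laplacian.
have H i : partial i (partial i (fun x => G 0%N (sqnorm x) * f x)) x =
   4 * f x * G 2%N (sqnorm x) * (x ord0 i ^+ 2) + 2 * G 1%N (sqnorm x) * f x
   + 4 * G 1%N (sqnorm x) * (x ord0 i * partial i f x)
   + G 0%N (sqnorm x) * partial i (partial i f) x.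
  rewrite partialM; auto. rewrite partial_comp; auto. rewrite partial_sqnorm.
  rewrite partialD; auto. rewrite !partialM; auto. rewrite !partial_comp; auto.
  rewrite partial_sqnorm partial_cst partial_coor eqxx /=.
  by move: (partial i (partial i f) x) (partial i f x) => u v; ring.
apply: etrans; first by apply: eq_bigr => i _; exact: H.
rewrite !big_split /= -!mulr_sumr sumr_const card_ord.
rewrite -/(sqnorm x) -[_ *+ d]mulr_natr.
move: (sqnorm x) (G _ _) (G _ _) (G _ _) => a b c e; ring.
Qed.

Inductive homogeneous : nat -> (V -> R) -> Prop :=
| homogeneous_cst c : homogeneous 0 (fun _ => c)
| homogeneous_mulX n i f : homogeneous n f ->
    homogeneous n.+1 (fun x => x ord0 i * f x)
| homogeneousD n f g : homogeneous n f -> homogeneous n g ->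
    homogeneous n (fun x => f x + g x)
| homogeneous_zero n : homogeneous n (fun _ => 0).

Lemma homogeneous_polynomial n f : homogeneous n f -> polynomial_fun f.
Proof.
elim=> [c|{}n i {}f _ Hf|{}n {}f g _ Hf _ Hg|{}n].
- exact: polynomial_cst.
- by apply: polynomialM => //; exact: polynomial_coor.
- exact: polynomialD.
- exact: polynomial_cst.
Qed.

Lemma homogeneous_elementary n f : homogeneous n f -> elementary f.
Proof. by move=> /homogeneous_polynomial/polynomial_elementary. Qed.
Hint Resolve homogeneous_elementary : core.

Lemma homogeneousZ n c f : homogeneous n f -> homogeneous n (fun x => c * f x).
Proof.
elim=> [e|{}n i {}f _ Hf|{}n {}f g _ Hf _ Hg|{}n].
- exact: homogeneous_cst.
- by under eq_fun do rewrite mulrCA; exact: homogeneous_mulX.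
- by under eq_fun do rewrite mulrDr; exact: homogeneousD.
- by under eq_fun do rewrite mulr0; exact: homogeneous_zero.
Qed.

Lemma homogeneousM n k f g : homogeneous n f -> homogeneous k g ->
  homogeneous (n + k) (fun x => f x * g x).
Proof.
move=> Hf Hg; elim: Hf => [e|{}n i {}f _ Hf|{}n {}f f' _ Hf _ Hf'|{}n].
- exact: homogeneousZ.
- by under eq_fun do rewrite -mulrA; exact: homogeneous_mulX.
- by under eq_fun do rewrite mulrDl; exact: homogeneousD.
- by under eq_fun do rewrite mul0r; exact: homogeneous_zero.
Qed.

Lemma homogeneous_partial n i f : homogeneous n f ->
  if n is n'.+1 then homogeneous n' (partial i f) else partial i f = (fun _ => 0).
Proof.
elim=> [e|{}n j {}f Hf IH|{}n {}f g Hf IHf Hg IHg|{}n].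
- by rewrite partial_cst.
- rewrite partialM; [|by move=> x; exact: differentiable_coor|eauto].
  rewrite partial_coor; apply: homogeneousD; first exact: homogeneousZ.
  case: n Hf IH => [|n] Hf IH; last exact: homogeneous_mulX.
  by rewrite IH; under eq_fun do rewrite mulr0; exact: homogeneous_zero.
- rewrite partialD; [|eauto|eauto].
  case: n Hf IHf Hg IHg => [|n] _ IHf _ IHg; last exact: homogeneousD.
  by rewrite IHf IHg; under eq_fun do rewrite addr0.
- by rewrite partial_cst; case: n => // n; exact: homogeneous_zero.
Qed.

Lemma euler n f x : homogeneous n f ->
  \sum_(i < d) x ord0 i * partial i f x = n%:R * f x.
Proof.
elim=> [e|{}n j {}f Hf IH|{}n {}f g Hf IHf Hg IHg|{}n].
- by rewrite mul0r big1// => i _; rewrite partial_cst mulr0.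
- have H i : x ord0 i * partial i (fun y => y ord0 j * f y) x =
     x ord0 i * (i == j)%:R * f x + x ord0 j * (x ord0 i * partial i f x).
    rewrite partialM; [|by move=> y; exact: differentiable_coor|eauto].
    by rewrite partial_coor; ring.
  rewrite (eq_bigr _ (fun i _ => H i)) big_split /= -mulr_suml -mulr_sumr IH.
  rewrite (bigD1 j)//= big1 => [|i /negPf ->]; last by rewrite mulr0.
  by rewrite eqxx addr0 mulr1 -[in RHS]natr1; ring.
- rewrite mulrDr -IHf -IHg -big_split; apply: eq_bigr => i _ /=.
  by rewrite -mulrDr partialD; eauto.
- by rewrite mulr0 big1// => i _; rewrite partial_cst mulr0.
Qed.

Lemma homogeneous_sum n (I : Type) (r : seq I) (F : I -> V -> R) :
  (forall a, homogeneous n (F a)) -> homogeneous n (fun x => \sum_(i <- r) F i x).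
Proof.
move=> HF; elim: r => [|a r IH].
  by under eq_fun do rewrite big_nil; exact: homogeneous_zero.
by under eq_fun do rewrite big_cons; exact: homogeneousD.
Qed.

Lemma homogeneous_sqnormX k : homogeneous k.*2 (fun x => sqnorm x ^+ k).
Proof.
elim: k => [|k IH]; first by under eq_fun do rewrite expr0; exact: homogeneous_cst.
under eq_fun do rewrite exprS.
rewrite doubleS -[k.*2.+2]add2n; apply: homogeneousM => //.
apply: homogeneous_sum => i.
by apply: homogeneous_mulX; rewrite -[X in homogeneous _ X](_ : (fun x => x ord0 i * 1) = _);
  [apply: homogeneous_mulX; exact: homogeneous_cst|apply/funext => x; rewrite mulr1].
Qed.

Lemma homogeneous_laplacian n f : homogeneous n f -> homogeneous n.-2 (laplacian f) /\
  ((n < 2)%N -> laplacian f = (fun _ => 0)).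
Proof.
move=> Hf; have H i : homogeneous n.-2 (partial i (partial i f)) /\
    ((n < 2)%N -> partial i (partial i f) = (fun _ => 0)).
  have := homogeneous_partial i Hf.
  case: n Hf => [|n] _ H1.
    by rewrite H1 partial_cst; split => //; exact: homogeneous_zero.
  have := homogeneous_partial i H1; case: n H1 => [|n] _ H2.
    by rewrite H2; split => //; exact: homogeneous_zero.
  by split.
split; first by apply: homogeneous_sum => i; have [] := H i.
by move=> n2; apply/funext => x; rewrite /laplacian big1// => i _; have [_ ->] := H i.
Qed.

(** The first order term has two sources: 2 d p' from the laplacian of |x|^2, and 4 n p' from the
    cross term, evaluated by Euler's identity. *)
Lemma laplacian_poly_harmonic n f (p : {poly R}) : homogeneous n f ->
  laplacian f = (fun _ => 0) ->
  laplacian (fun x => p.[sqnorm x] * f x) =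
  (fun x => (4%:P * 'X * p^`()^`() + (2 * (d + n.*2)%:R) *: p^`()).[sqnorm x] * f x).
Proof.
move=> Hf Lf; pose G k := horner (p^`(k)).
have HG : derivative_seq G by move=> k x; rewrite /G derivnS; exact: is_derive_poly.
rewrite (_ : (fun x => p.[sqnorm x] * f x) = fun x => G 0%N (sqnorm x) * f x)//.
rewrite laplacian_radialM; [|by []|by eauto].
apply/funext => x; rewrite (euler _ Hf) Lf /G.
rewrite !(hornerD, hornerM, hornerZ, hornerC, hornerX) /= natrD -muln2 natrM.
ring.
Qed.

End elementary.

(** * Cut-off test functions on the ball *)

Section cutoff_test_functions.
Variables (R : realType) (d : nat).
Local Notation V := 'rV[R]_d.
Local Notation B := (@unit_ball R d).
Implicit Types (f g P Q : V -> R) (i : 'I_d) (s : seq 'I_d) (x : V).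

(* The shape of the derivatives of order at most m of F(|x|^2) P(x), uniformly in
   the sequence F of derivatives of a function on the line. *)
Inductive jet_expr (m : nat) : ((nat -> R -> R) -> V -> R) -> Prop :=
| jet_term k Q : (k <= m)%N -> polynomial_fun Q ->
    jet_expr m (fun F x => F k (sqnorm x) * Q x)
| jet_add S T : jet_expr m S -> jet_expr m T -> jet_expr m (fun F x => S F x + T F x).

Lemma jet_expr_elementary m T F : jet_expr m T -> derivative_seq F -> elementary (T F).
Proof.
move=> HT HF; elim: HT => [k Q _ HQ|S {}T _ HS _ HT]; last exact: elementaryD.
apply: elementaryM; last exact: polynomial_elementary.
by apply: elementary_comp => //; exact: elementary_sqnorm.
Qed.

Lemma jet_expr_partial i m T : jet_expr m T -> exists2 U, jet_expr m.+1 U &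
  forall F, derivative_seq F -> partial i (T F) = U F.
Proof.
elim=> [k Q km HQ|S {}T HS [S' HS' ES] HT [T' HT' ET]].
  exists (fun F x => F k.+1 (sqnorm x) * (2 * x ord0 i * Q x) +
                     F k (sqnorm x) * partial i Q x).
    apply: jet_add; apply: jet_term => //; last exact: polynomial_partial.
      apply: polynomialM => //.
      by apply: polynomialM; [exact: polynomial_cst|exact: polynomial_coor].
    exact: leqW.
  move=> F HF.
  have Hq := elementary_sqnorm R d.
  rewrite partialM => [|x|x]; last 2 first.
  - by apply/elementary_differentiable/elementary_comp.
  - by apply/elementary_differentiable/polynomial_elementary.
  rewrite partial_comp//; last by move=> x; exact: elementary_differentiable.
  by rewrite partial_sqnorm; apply/funext => x; rewrite !mulrA.
exists (fun F x => S' F x + T' F x); first exact: jet_add.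
move=> F HF; rewrite partialD => [|x|x]; last 2 first.
- exact/elementary_differentiable/(jet_expr_elementary HS).
- exact/elementary_differentiable/(jet_expr_elementary HT).
by rewrite ES// ET.
Qed.

Lemma jet_exprW m n T : (m <= n)%N -> jet_expr m T -> jet_expr n T.
Proof.
move=> mn; elim=> [k Q km HQ|S {}T _ HS _ HT]; last exact: jet_add.
by apply: jet_term => //; exact: leq_trans mn.
Qed.

(** T is chosen before F: one expression serves all cut-offs and their limit, so bounds and limits
    can be read off the factors [F k]. *)
Lemma partials_radialM s P : polynomial_fun P ->
  exists2 T, jet_expr (size s) T & forall F, derivative_seq F ->
    partials s (fun x => F 0%N (sqnorm x) * P x) = T F.
Proof.
move=> HP; elim: s => [|i s [T HT ET]] /=.
  by exists (fun F x => F 0%N (sqnorm x) * P x) => //; exact: jet_term.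
have [U HU EU] := jet_expr_partial i HT; exists U => // F HF.
by rewrite ET// EU.
Qed.

Lemma unit_ballE x : B x = (sqnorm x < 1) :> Prop.
Proof. by []. Qed.

Lemma sqnorm_ge0 x : 0 <= sqnorm x.
Proof. by apply: sumr_ge0 => i _; exact: sqr_ge0. Qed.

Lemma sqr_coor_le_sqnorm x i : x ord0 i ^+ 2 <= sqnorm x.
Proof.
by rewrite /sqnorm (bigD1 i)//= lerDl sumr_ge0// => j _; exact: sqr_ge0.
Qed.

Lemma unit_ball_coor x i : B x -> `|x ord0 i| < 1.
Proof.
move=> Bx; rewrite -(@expr_lt1 _ 2)// real_normK ?num_real//.
exact: le_lt_trans (sqr_coor_le_sqnorm x i) Bx.
Qed.

Definition bounded_on_ball f := exists C : R, forall x, B x -> `|f x| <= C.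

Lemma bounded_on_ballD f g : bounded_on_ball f -> bounded_on_ball g ->
  bounded_on_ball (fun x => f x + g x).
Proof.
move=> [C HC] [D HD]; exists (C + D) => x Bx.
by apply: le_trans (ler_normD _ _) _; apply: lerD; auto.
Qed.

Lemma bounded_on_ballM f g : bounded_on_ball f -> bounded_on_ball g ->
  bounded_on_ball (fun x => f x * g x).
Proof.
by move=> [C HC] [D HD]; exists (C * D) => x Bx; rewrite normrM; apply: ler_pM; auto.
Qed.

Lemma polynomial_bounded P : polynomial_fun P -> bounded_on_ball P.
Proof.
elim=> [c|i|{}f g _ Hf _ Hg|{}f g _ Hf _ Hg].
- by exists `|c|.
- by exists 1 => x Bx; apply/ltW/unit_ball_coor.
- exact: bounded_on_ballD.
- exact: bounded_on_ballM.
Qed.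

Lemma jet_expr_bounded m T (F : nat -> nat -> R -> R) : jet_expr m T ->
  (forall k, (k <= m)%N -> exists C : R, forall n (r : R), 0 <= r -> `|F n k r| <= C) ->
  exists C : R, forall n x, B x -> `|T (F n) x| <= C.
Proof.
move=> HT HF; elim: HT => [k Q km HQ|S {}T _ [C HC] _ [D HD]].
  have [C HC] := HF k km; have [D HD] := polynomial_bounded HQ.
  exists (C * D) => n x Bx; rewrite normrM; apply: ler_pM; auto.
  by apply: HC; exact: sqnorm_ge0.
exists (C + D) => n x Bx.
by apply: le_trans (ler_normD _ _) _; apply: lerD; auto.
Qed.

Lemma jet_expr_cvg m T (F : nat -> nat -> R -> R) (F' : nat -> R -> R) x :
  jet_expr m T ->
  (forall k, (k <= m)%N -> (fun n => F n k (sqnorm x)) @ \oo --> F' k (sqnorm x)) ->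
  (fun n => T (F n) x) @ \oo --> T F' x.
Proof.
move=> HT HF; elim: HT => [k Q km HQ|S {}T _ HS _ HT]; last exact: cvgD.
by apply: cvgMl; exact: HF.
Qed.

Definition cutoff_fun m n P x : R := cutoff m n 0 (sqnorm x) * P x.

Lemma partials_cutoff_bounded m P s : (size s <= m)%N -> polynomial_fun P ->
  exists C : R, forall n x, B x -> `|partials s (cutoff_fun m n P) x| <= C.
Proof.
move=> sm HP; have [T /(jet_exprW sm) HT ET] := partials_radialM s HP.
have [C HC] := @jet_expr_bounded m T (cutoff m) HT (@cutoff_bounded R m).
exists C => n x Bx; rewrite ET; last exact: derivative_seq_cutoff.
exact: HC.
Qed.

Lemma partials_cutoff_cvg m P s x : (size s <= m)%N -> polynomial_fun P -> B x ->
  (fun n => partials s (cutoff_fun m n P) x) @ \oo -->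
  partials s (fun x => (1 - sqnorm x) ^+ m * P x) x.
Proof.
move=> sm HP Bx; have [T /(jet_exprW sm) HT ET] := partials_radialM s HP.
have -> : (fun x => (1 - sqnorm x) ^+ m * P x) =
    (fun x => onem_power m 0 (sqnorm x) * P x).
  by apply/funext => y; rewrite /onem_power /power_seq ffactn0 subn0 expr0 !mul1r.
rewrite ET; last exact: derivative_seq_onem_power.
under eq_fun do (rewrite ET; last exact: derivative_seq_cutoff).
by apply: jet_expr_cvg HT _ => k km; exact: cutoff_cvg.
Qed.

Lemma elementary_cutoff m n P : elementary P -> elementary (cutoff_fun m n P).
Proof.
move=> HP; apply: elementaryM => //; apply: elementary_comp.
  exact: derivative_seq_cutoff.
exact: elementary_sqnorm.
Qed.

Lemma closed_sqnorm_le (c : R) : closed [set x : V | sqnorm x <= c].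
Proof.
apply: (@preimage_closed _ _ (@sqnorm R d) [set y | y <= c]).
  by move=> x _; apply: elementary_continuous; exact: elementary_sqnorm.
exact: closed_le.
Qed.

Lemma compact_sqnorm_le (c : R) : c <= 1 -> compact [set x : V | sqnorm x <= c].
Proof.
move=> c1; apply: bounded_closed_compact; last exact: closed_sqnorm_le.
exists 1; split; first exact: num_real.
move=> M M1 x /= xc; rewrite /Num.norm/= mx_normrE.
apply: bigmax_le => [|[i j] _ /=]; first by rewrite (le_trans ler01)// ltW.
apply: ltW; apply: le_lt_trans M1; rewrite (ord1 i).
rewrite -(@expr_le1 _ 2)// real_normK ?num_real//.
exact: le_trans (sqr_coor_le_sqnorm x j) (le_trans xc c1).
Qed.

(** The shift by 1/(n+1) inside [cutoff] keeps the support in a closed ball of radius less than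
    1. *)
Lemma test_function_cutoff m n P : elementary P -> test_function (cutoff_fun m n P).
Proof.
move=> HP; have n0 : 0 < n.+1%:R^-1 :> R by rewrite invr_gt0.
have H : closure [set x | cutoff_fun m n P x != 0] `<=`
    [set x | sqnorm x <= 1 - n.+1%:R^-1].
  rewrite [X in _ `<=` X](closure_id _).1; last exact: closed_sqnorm_le.
  apply: closureS => x /=; rewrite /cutoff_fun mulf_eq0 negb_or => /andP[+ _].
  by rewrite cutoff0_neq0 => /ltW.
split.
- exact/elementary_smooth/elementary_cutoff.
- apply: subclosed_compact H; first exact: closed_closure.
  by apply: compact_sqnorm_le; rewrite gerBl ltW.
- move=> x /H /= xc; rewrite unit_ballE; apply: le_lt_trans xc _.
  by rewrite ltrBlDr ltrDl.
Qed.

End cutoff_test_functions.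

(** * Lebesgue measure and integrals on the ball *)

Section measure_rV.
Variable R : realType.

Lemma measurable_box n (A : 'I_n -> set (measurableTypeR R)) :
  (forall i, measurable (A i)) ->
  measurable [set x : 'rV[R]_n | forall i, A i (x ord0 i)].
Proof.
move=> mA; rewrite (_ : mkset _ = \bigcap_(i in [set: 'I_n])
    ((fun x : 'rV[R]_n => x ord0 i) @^-1` A i)).
  apply: fin_bigcap_measurable => // i _.
  by rewrite -[X in measurable X]setTI; exact: measurable_coord.
by apply/seteqP; split => x /= H i => [_|]; exact: H.
Qed.

Lemma measurable_ball_rV n (x : 'rV[R]_n) (e : R) : 0 < e -> measurable (ball x e).
Proof.
move=> e0.
rewrite (_ : ball x e = [set y : 'rV[R]_n | forall i, ball (x ord0 i) e (y ord0 i)]).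
  apply: (@measurable_box n (fun i => ball (x ord0 i) e)) => i.
  by apply: open_measurable; exact: ball_open.
apply/seteqP; split => y /=.
  by move=> [_ H] i; exact: H.
by move=> H; split => // i j; rewrite (ord1 i).
Qed.

(** The sigma-algebra is generated by the coordinates, so an open set has to be written as a
    countable union of boxes. Balls of the maximum norm are boxes, and those with rational centre
    and radius 1/(k+1) suffice. *)
Lemma open_measurable_rV n (U : set 'rV[R]_n) : open U -> measurable U.
Proof.
move=> oU; pose c (p : 'rV[rat]_n * nat) : 'rV[R]_n := map_mx ratr p.1.
pose D := [set p : 'rV[rat]_n * nat | ball (c p) p.2.+1%:R^-1 `<=` U].
have -> : U = \bigcup_(p in D) ball (c p) p.2.+1%:R^-1.
  apply/seteqP; split => [x Ux|x [p Dp]]; last exact: Dp.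
  have /nbhs_ballP[e /= e0 He] : nbhs x U by exact: open_nbhs_nbhs.
  have [k Hk] : exists k : nat, k.+1%:R^-1 < e / 2 :> R.
    have := @near_infty_natSinv_lt R (PosNum (divr_gt0 e0 (ltr0n R 2))).
    by move=> [k _ /(_ k (leqnn _))]; exists k.
  have H i : exists q : rat, ball (x ord0 i) (k.+1%:R^-1 : R) (ratr q : R).
    have [] := @dense_rat R (ball (x ord0 i) k.+1%:R^-1).
    - by exists (x ord0 i); apply: ballxx; rewrite invr_gt0.
    - exact: ball_open.
    - by move=> y [yB [q _ qy]]; exists q; rewrite qy.
  have [q Hq] := choice H.
  have xc : ball (c (\row_i q i, k)) (k.+1%:R^-1 : R) x.
    split; first by rewrite invr_gt0.
    by move=> i j; rewrite (ord1 i) /c !mxE; apply: ball_sym; exact: Hq.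
  exists (\row_i q i, k); last exact: xc.
  move=> y yB; apply: He; rewrite [e]splitr.
  apply: (@ball_triangle _ _ (c (\row_i q i, k))).
    by apply: ball_sym; apply: le_ball xc; exact: ltW.
  by apply: le_ball yB; exact: ltW.
rewrite bigcup_mkcond; apply: countable_bigcupT_measurable => [|p].
  exact: countableP.
by case: ifP => // _; apply: measurable_ball_rV; rewrite invr_gt0.
Qed.

Lemma continuous_measurable_rV n (f : 'rV[R]_n -> R) : continuous f ->
  measurable_fun setT f.
Proof.
move=> cf; apply: (measurability _ (RGenOInfty.measurableE R)).
move=> _ [_ [x ->] <-]; rewrite setTI; apply: open_measurable_rV.
by apply: open_comp => // y _; exact: cf.
Qed.

Lemma measurable_elementary n (f : 'rV[R]_n -> R) : elementary f -> measurable_fun setT f.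
Proof. by move=> /elementary_continuous; exact: continuous_measurable_rV. Qed.

Definition unit_cube (n : nat) : set 'rV[R]_n :=
  [set x | forall i, `[-1, 1]%classic (x ord0 i)].

Arguments unit_cube : clear implicits.

Lemma measurable_unit_cube n : measurable (unit_cube n).
Proof.
by apply: (@measurable_box n (fun=> `[-1, 1]%classic)) => i; exact: measurable_itv.
Qed.

Lemma unit_cube_lty n : (lebesgue_rV R n (unit_cube n) < +oo)%E.
Proof.
rewrite /unit_cube (@lebesgue_rV_box R n (fun=> `[-1, 1]%classic)); last first.
  by move=> i; exact: measurable_itv.
apply: (@le_lt_trans _ _ (\prod_(i < n) (2%:E : \bar R))%E); last first.
  have : (\prod_(i < n) (2%:E : \bar R))%E \is a fin_num.
    by elim/big_ind : _ => // x y; exact: fin_numM.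
  by move=> /fin_numPlt/andP[].
rewrite le_eqVlt; apply/orP; left; apply/eqP/eq_bigr => i _.
by rewrite lebesgue_measure_itv /= lte_fin ifT; [rewrite -EFinD; congr (_%:E); ring|lra].
Qed.

Lemma unit_ball_cube n : @unit_ball R n `<=` unit_cube n.
Proof.
move=> x Bx i /=; rewrite in_itv /= -ler_norml; exact/ltW/unit_ball_coor.
Qed.

Lemma measurable_unit_ball n : measurable (@unit_ball R n).
Proof.
rewrite (_ : @unit_ball R n = (@sqnorm R n) @^-1` `]-oo, 1[%classic).
  rewrite -[X in measurable X]setTI; apply: measurable_elementary => //.
  exact: elementary_sqnorm.
by apply/seteqP; split => x /=; rewrite in_itv.
Qed.

Lemma unit_ball_lty n : (lebesgue_rV R n (@unit_ball R n) < +oo)%E.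
Proof.
apply: le_lt_trans (unit_cube_lty n); apply: le_measure; rewrite ?inE.
- exact: measurable_unit_ball.
- exact: measurable_unit_cube.
- exact: unit_ball_cube.
Qed.

(** In dimension n + 1 the measure is by construction the image of a product measure under
    [row_cons]; this form gives access to Fubini's theorem. *)
Lemma integral_rV_Sn n (f : 'rV[R]_n.+1 -> R) :
  (lebesgue_rV R n.+1).-integrable setT (EFin \o f) ->
  measurable_fun setT f ->
  (@lebesgue_measure R \x lebesgue_rV R n)%E.-integrable setT
    (fun p => (f (row_cons p))%:E) /\
  (\int[lebesgue_rV R n.+1]_x (f x)%:E =
   \int[@lebesgue_measure R \x lebesgue_rV R n]_p (f (row_cons p))%:E)%E.
Proof.
move=> /integrableP[_ fi] mf.
have mE : measurable_fun setT (fun x => (f x)%:E) by exact/measurable_EFinP.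
have mc := @measurable_row_cons R n.
have mfc : measurable_fun setT (fun p => (f (row_cons p))%:E).
  apply: (measurableT_comp mE); exact: mc.
have I1 : (@lebesgue_measure R \x lebesgue_rV R n)%E.-integrable setT
    (fun p => (f (row_cons p))%:E).
  apply/integrableP; split => //.
  apply: le_lt_trans fi.
  rewrite (@ge0_integral_pushforward _ _ _ _ R _ mc
    (@lebesgue_measure R \x lebesgue_rV R n)%E setT)//.
  exact: measurableT_comp.
split => //.
by rewrite (@integral_pushforward _ _ _ _ R _ mc
  (@lebesgue_measure R \x lebesgue_rV R n)%E setT).
Qed.

Lemma row_cons_delta0 n (a h : R) (v : 'rV[R]_n) :
  h *: delta_mx ord0 ord0 + row_cons (a, v) = row_cons (h + a, v).
Proof.
apply/rowP => i; rewrite [LHS]mxE [X in X + _]mxE [X in _ * X + _]mxE eqxx /=.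
case: (unliftP ord0 i) => [j|] ->.
  by rewrite !row_consS mulr0 add0r.
by rewrite eqxx !row_cons0 mulr1.
Qed.

Lemma row_cons_deltaS n (a h : R) (v : 'rV[R]_n) (k : 'I_n) :
  h *: delta_mx ord0 (lift ord0 k) + row_cons (a, v) = row_cons (a, h *: delta_mx ord0 k + v).
Proof.
apply/rowP => i; rewrite [LHS]mxE [X in X + _]mxE [X in _ * X + _]mxE eqxx /=.
case: (unliftP ord0 i) => [j|] ->.
  by rewrite !row_consS !mxE eqxx /= (inj_eq lift_inj).
by rewrite !row_cons0 (negPf (neq_lift _ _)) mulr0 add0r.
Qed.

Lemma continuous_row_cons n : continuous
  (fun p : R * 'rV[R]_n => row_cons (p : measurableTypeR R * 'rV[R]_n)).
Proof.
move=> [a v]; apply/cvg_ballP => e e0.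
exists (ball a e, ball v e) => [|p [/= Ha [_ Hv]]]; first by split; exact: nbhsx_ballx.
split => // i j; rewrite (ord1 i); case: (unliftP ord0 j) => [k|] ->.
  by rewrite !row_consS; exact: Hv.
by rewrite !row_cons0.
Qed.

Lemma integral_derive_line (f g : R -> R) :
  (forall x : R, is_derive x 1 f (g x)) -> continuous g ->
  (forall x : R, 1 < `|x| -> f x = 0 /\ g x = 0) ->
  (\int[@lebesgue_measure R]_x (g x)%:E)%E = 0.
Proof.
move=> fg cg f0.
have df x : derivable f x 1 by have [] := fg x.
(* The interval is [-2, 2] because f is only assumed to vanish where |x| > 1; this includes both
   endpoints. *)
have -> : (\int[@lebesgue_measure R]_x (g x)%:E)%E =
    (\int[@lebesgue_measure R]_(x in `[(-2)%R, 2%R]) (g x)%:E)%E.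
  rewrite [RHS]integral_mkcond; apply: eq_integral => x _; rewrite /patch.
  case: ifPn => //; rewrite notin_setE /= in_itv /= -ler_norml => /negP.
  by rewrite -ltNge => x2; have [|_ ->] := f0 x => //; apply: lt_trans x2; rewrite ltr1n.
rewrite (@continuous_FTC2 _ g f).
- by rewrite !(f0 _ _).1 ?normrN ?ger0_norm ?ltr1n// subee.
- lra.
- exact: continuous_subspaceT.
- split => [x _|  |]; first exact: df.
  + apply: cvg_at_right_filter; apply: differentiable_continuous.
    exact/derivable1_diffP.
  + apply: cvg_at_left_filter; apply: differentiable_continuous.
    exact/derivable1_diffP.
- by move=> x _; rewrite derive1E; have [_ ->] := fg x.
Qed.

Lemma integrable_cube n (g : 'rV[R]_n -> R) (C : R) : measurable_fun setT g ->
  (forall x, `|g x| <= C) ->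
  (forall x : 'rV[R]_n, (exists j, 1 < `|x ord0 j|) -> g x = 0) ->
  (lebesgue_rV R n).-integrable setT (EFin \o g).
Proof.
move=> mg gC g0.
have -> : EFin \o g = (EFin \o g) \_ (unit_cube n).
  apply/funext => x; rewrite /patch; case: ifPn => // /negP H /=.
  rewrite g0//; apply: contrapT => H2; apply: H; rewrite inE => i /=.
  rewrite in_itv /= -ler_norml leNgt; apply/negP => H3; apply: H2; by exists i.
rewrite -integrable_mkcond; last exact: measurable_unit_cube.
apply: measurable_bounded_integrable.
- exact: measurable_unit_cube.
- exact: unit_cube_lty.
- exact: measurable_funS mg.
- by exists C; split; [exact: num_real|move=> M CM x _; exact: le_trans (gC x) (ltW CM)].
Qed.

(** The divergence theorem for functions supported in the cube. If i is the first coordinate, Fubini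
    integrates along it first and the fundamental theorem of calculus applies on lines; otherwise
    the induction hypothesis applies to the slices with fixed first coordinate. *)
Lemma integral_partial0 n (i : 'I_n) (f g : 'rV[R]_n -> R) (C : R) :
  (forall x, is_derive x (delta_mx ord0 i) f (g x)) -> continuous g ->
  (forall x, `|g x| <= C) ->
  (forall x : 'rV[R]_n, (exists j, 1 < `|x ord0 j|) -> f x = 0 /\ g x = 0) ->
  (\int[lebesgue_rV R n]_x (g x)%:E)%E = 0.
Proof.
elim: n i f g => [|n IH] i f g; first by case: i.
move=> fg cg gC f0.
have mg := continuous_measurable_rV cg.
have ig := integrable_cube mg gC (fun x H => (f0 x H).2).
have [ig' ->] := integral_rV_Sn ig mg.
case: (unliftP ord0 i) => [k|] Ei.
  rewrite -integral12_prod_meas1//.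
  rewrite (eq_integral (cst 0%E)) ?integral0// => a _; rewrite /fubini_F.
  apply: (IH k (fun v => f (row_cons (a, v))) (fun v => g (row_cons (a, v)))).
  - move=> v; have [dv Dv] := fg (row_cons (a, v)).
    have E : (fun h => h^-1 *: (f (row_cons (a, h *: delta_mx ord0 k + v)) -
              f (row_cons (a, v)))) =
      (fun h => h^-1 *: (f (h *: delta_mx ord0 i + row_cons (a, v)) - f (row_cons (a, v)))).
      by apply/funext => h; rewrite Ei row_cons_deltaS.
    split; first by rewrite /derivable E.
    by rewrite /derive E.
  - move=> v; apply: (@continuous_comp _ _ _ (fun v => row_cons (a, v)) g); last exact: cg.
    apply: (@continuous_comp _ _ _ (fun v => (a, v))
      (fun p : R * 'rV[R]_n => row_cons (p : measurableTypeR R * _))).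
      move=> A [[P Q] [/= Pa Qv] PQ]; apply: filterS Qv => w Qw; apply: PQ.
      by split => //=; exact: nbhs_singleton Pa.
    exact: continuous_row_cons.
  - by move=> v.
  - by move=> v [j Hj]; apply: f0; exists (lift ord0 j); rewrite row_consS.
rewrite -integral21_prod_meas1//.
rewrite (eq_integral (cst 0%E)) ?integral0// => v _; rewrite /fubini_G.
apply: (@integral_derive_line (fun a => f (row_cons (a : measurableTypeR R, v)))).
- move=> a; have [dv Dv] := fg (row_cons (a, v)).
  have E : (fun h => h^-1 *: (f (row_cons (h *: (1 : R) + a : measurableTypeR R, v)) -
              f (row_cons (a, v)))) =
      (fun h => h^-1 *: (f (h *: delta_mx ord0 i + row_cons (a, v)) - f (row_cons (a, v)))).
    by apply/funext => h; rewrite Ei row_cons_delta0 [_ *: 1]mulr1.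
  split; first by rewrite /derivable E.
  by rewrite /derive E.
- move=> a; apply: (@continuous_comp _ _ _
    (fun a => row_cons (a : measurableTypeR R, v)) g); last exact: cg.
  apply: (@continuous_comp _ _ _ (fun a => (a, v))
    (fun p : R * 'rV[R]_n => row_cons (p : measurableTypeR R * _))).
    move=> A [[P Q] [/= Pa Qv] PQ]; apply: filterS Pa => w Pw; apply: PQ.
    by split => //=; exact: nbhs_singleton Qv.
  exact: continuous_row_cons.
- by move=> a a1; apply: f0; exists ord0; rewrite row_cons0.
Qed.

End measure_rV.

(** * Polynomials converging to a step function *)

Section step_polynomials.
Variable R : realType.

Lemma bernoulli_le (x : R) n : -1 <= x -> 1 + n%:R * x <= (1 + x) ^+ n.
Proof.
move=> x1; elim: n => [|n IH]; first by rewrite mul0r addr0 expr0.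
rewrite exprS; apply: (@le_trans _ _ ((1 + x) * (1 + n%:R * x))).
  by rewrite -natr1; have := sqr_ge0 x; have := ler0n R n; nra.
by rewrite ler_wpM2l//; lra.
Qed.

Lemma cvg_natM_expr (z : R) : 0 <= z < 1 -> (fun n => n%:R * z ^+ n) @ \oo --> (0 : R).
Proof.
move=> /andP[z0 z1]; have [->|zn0] := eqVneq z 0.
  apply: cvg_near_cst; exists 1%N => // n /= n0.
  by rewrite expr0n eqn0Ngt n0 mulr0.
(* Half of the decay of z^n = w^n w^n is spent on the factor n, by Bernoulli's inequality for (1 +
   e)^n = w^(-n); the other half goes to 0. *)
pose w := Num.sqrt z; have w0 : 0 < w by rewrite sqrtr_gt0 lt_neqAle eq_sym zn0.
have wz : w ^+ 2 = z by rewrite sqr_sqrtr.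
have w1 : w < 1 by rewrite -(@expr_lt1 _ 2) ?wz// ltW.
pose e := w^-1 - 1; have e0 : 0 < e by rewrite subr_gt0 invf_gt1.
have H n : n%:R * z ^+ n <= e^-1 * w ^+ n.
  rewrite -wz -exprM mulnC exprM expr2 mulrA; apply: ler_wpM2r.
    by rewrite exprn_ge0// ltW.
  have : 1 + n%:R * e <= (1 + e) ^+ n by apply: bernoulli_le; lra.
  have -> : 1 + e = w^-1 by rewrite /e addrC subrK.
  rewrite exprVn => H1.
  have wn0 : 0 < w ^+ n by rewrite exprn_gt0.
  rewrite -(@ler_pM2r _ (w ^- n)) ?invr_gt0// mulfK ?gt_eqF//.
  rewrite -(@ler_pM2l _ e)// mulrA mulfV ?gt_eqF// mul1r mulrC.
  by apply: le_trans H1; rewrite lerDr.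
apply: (@squeeze_cvgr _ _ _ _ (fun=> 0) (fun n => e^-1 * w ^+ n)).
- by near=> n; rewrite H mulr_ge0// exprn_ge0.
- exact: cvg_cst.
- by apply: cvg_geometric; rewrite ger0_norm 1?ltW.
Unshelve. all: by end_near. Qed.

(* Polynomials converging to the indicator of [0, 1/2[: by Bernoulli,
   1 - n (2y)^n <= (1 - y^n)^N and (1 - y^n)^N (1 + y^n)^N <= 1 for N = n 2^n. *)
Definition step_power (n : nat) (y : R) : R := (1 - y ^+ n) ^+ (n * 2 ^ n).

Lemma step_power_itv n y : 0 <= y <= 1 -> 0 <= step_power n y <= 1.
Proof.
move=> /andP[y0 y1]; have := exprn_ge0 n y0; have := exprn_ile1 n y0 y1.
by move=> H1 H2; rewrite exprn_ge0 ?exprn_ile1//; lra.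
Qed.

Lemma cvg_step_power y : 0 <= y <= 1 ->
  (fun n => step_power n y) @ \oo --> ((y < 2^-1)%R%:R : R).
Proof.
move=> /andP[y0 y1]; case: ltP => y2.
  apply: (@squeeze_cvgr _ _ _ _ (fun n => 1 - n%:R * (2 * y) ^+ n) (fun=> 1)); last 2 first.
  - rewrite -[X in _ --> X]subr0; apply: cvgB; first exact: cvg_cst.
    by apply: cvg_natM_expr; lra.
  - exact: cvg_cst.
  near=> n; have /andP[_ ->] := @step_power_itv n y ltac:(lra).
  rewrite andbT exprMn mulrA -natrX -natrM -mulrN; apply: bernoulli_le.
  by rewrite lerN2 exprn_ile1.
apply: (@squeeze_cvgr _ _ _ _ (fun=> 0) (fun n => n.+1%:R^-1)); last 2 first.
- exact: cvg_cst.
- exact: cvg_harmonic.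
near=> n; have /andP[-> _] := @step_power_itv n y ltac:(lra).
rewrite /step_power; set N := (n * 2 ^ n)%N; set x := y ^+ n.
have x0 : 0 <= x by rewrite exprn_ge0.
have x1 : x <= 1 by rewrite exprn_ile1.
(* Here N y^n = n (2y)^n, and 2y >= 1. *)
have Nx : n%:R <= N%:R * x.
  have H : 1 <= 2 ^+ n * x by rewrite -exprMn exprn_ege1//; lra.
  by rewrite natrM natrX -mulrA; have := ler0n R n; nra.
have H1 : 1 + N%:R * x <= (1 + x) ^+ N by apply: bernoulli_le; lra.
have H2 : (1 - x) ^+ N * (1 + x) ^+ N <= 1.
  by rewrite -exprMn exprn_ile1//; nra.
rewrite -ler_pdivlMr ?mul1r// ?exprn_gt0 in H2; last lra.
apply: le_trans H2 _; rewrite lef_pV2 ?posrE ?exprn_gt0//; last lra.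
by apply: le_trans H1; rewrite -natr1; lra.
Unshelve. all: by end_near. Qed.

End step_polynomials.

(** * Integrals on the ball and criteria for vanishing almost everywhere *)

Section integrals_on_the_ball.
Variables (R : realType) (d : nat).
Local Notation V := 'rV[R]_d.
Local Notation mu := (lebesgue_rV R d).
Local Notation B := (@unit_ball R d).
Local Notation intB f := (mu.-integrable B (EFin \o f)).
Local Notation I f := (\int[mu]_(x in B) f x).
Implicit Types (f g u v w P : V -> R).

Let mB : measurable B := @measurable_unit_ball R d.
Hint Resolve mB : core.

Lemma bounded_on_ballP f : bounded_on_ball f -> [bounded f x | x in B].
Proof.
move=> [C HC]; exists C; split; first exact: num_real.
by move=> M /ltW CM x Bx; exact: le_trans (HC x Bx) CM.
Qed.

Lemma integrable_boundedM f g : intB f -> measurable_fun B g -> bounded_on_ball g ->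
  intB (fun x => f x * g x).
Proof.
move=> fi mg /bounded_on_ballP bg.
have := integrableMr mB mg bg fi.
by apply: eq_integrable => // x _ /=; rewrite mulrC EFinM.
Qed.

Lemma bounded_integrable f : measurable_fun B f -> bounded_on_ball f -> intB f.
Proof.
move=> mf /bounded_on_ballP bf; apply: measurable_bounded_integrable => //.
exact: unit_ball_lty.
Qed.

Lemma polynomial_measurable P : polynomial_fun P -> measurable_fun B P.
Proof.
move=> HP; apply: measurable_funS (measurable_elementary _) => //.
exact: polynomial_elementary.
Qed.

Lemma L2_ball_integrable u : L2_ball u -> intB u.
Proof.
move=> [mu_ iu]; apply: (@le_integrable _ _ _ _ _ mB _ (EFin \o (fun x => 1 + u x ^+ 2))).
- exact/measurable_EFinP.
- move=> x Bx /=; rewrite lee_fin [leRHS]ger0_norm ?addr_ge0 ?sqr_ge0//.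
  rewrite -[u x ^+ 2]real_normK ?num_real//; have := normr_ge0 (u x).
  by have := sqr_ge0 (`|u x| - 1); nra.
- have -> : EFin \o (fun x => 1 + u x ^+ 2) =
      (EFin \o (fun=> 1)) \+ (fun x => (u x ^+ 2)%:E) by [].
  apply: integrableD => //; apply: bounded_integrable; first exact: measurable_cst.
  by exists 1 => x _; rewrite normr1.
Qed.

Lemma Rintegral_dominated (f_ : nat -> V -> R) f g :
  (forall n, measurable_fun B (f_ n)) ->
  (forall x, B x -> (fun n => f_ n x) @ \oo --> f x) -> intB g ->
  (forall n x, B x -> `|f_ n x| <= g x) ->
  intB f /\ (fun n => I (f_ n)) @ \oo --> I f.
Proof.
move=> mf_ f_f ig fg.
have mf : measurable_fun B f by apply: (measurable_fun_cvg mf_).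
have [] := @dominated_convergence _ _ _ mu B mB (fun n => EFin \o f_ n) (EFin \o f) (EFin \o g).
- by move=> n; exact/measurable_EFinP.
- exact/measurable_EFinP.
- by apply: aeW => x Bx; apply: cvg_EFin; [near=> n|exact: f_f].
- exact: ig.
- by apply: aeW => x n Bx /=; rewrite lee_fin; exact: fg.
move=> fi _ H; split => //; apply: fine_cvg.
by rewrite /Rintegral fineK//; exact: integrable_fin_num.
Unshelve. all: by end_near. Qed.

Definition orthant (a : 'I_d -> R) : set V := [set x | forall i, x ord0 i < a i].

(** A half-space x_i < a is the countable union of the orthants whose other bounds are all equal to
    n, and half-spaces generate the sigma-algebra of the coordinates. *)
Lemma measurable_orthants (A : set V) : measurable A -> <<s range orthant >> A.
Proof.
move=> mA; pose T := g_sigma_algebraType (range orthant).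
have mid : measurable_fun [set: T] (id : T -> V).
  apply: measurable_rowP => i.
  apply: (measurability _ (RGenInftyO.measurableE R)) => _ [_ [a ->] <-].
  rewrite setTI.
  have -> : (fun x : V => x ord0 i) @^-1` `]-oo, a[%classic =
      \bigcup_n orthant (fun j => if j == i then a else n%:R).
    apply/seteqP; split => [x /=|x [n _ /(_ i)]]; last by rewrite eqxx /= in_itv.
    rewrite in_itv /= => xa.
    exists (Num.truncn (\sum_j `|x ord0 j|)).+1 => // j; case: eqP => [->//|_].
    apply: le_lt_trans (truncnS_gt _); apply: le_trans (ler_norm _) _.
    by rewrite (bigD1 j)//= lerDl sumr_ge0.
  by apply: bigcupT_measurable => n; apply: sub_sigma_algebra; eexists.
by have := mid measurableT A mA; rewrite setTI.
Qed.

(** Dynkin's argument: the sets A on which v has integral 0 form a lambda-system, and orthants are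
    stable under intersection and generate. The integral over the whole ball accounts for the full
    space, which is not an orthant in positive dimension. *)
Lemma ae_eq0_of_orthants v : intB v ->
  (forall a, \int[mu]_(x in B `&` orthant a) v x = 0) -> I v = 0 ->
  {ae mu, forall x, B x -> v x = 0}.
Proof.
move=> iv Ha HB; have mv : measurable_fun B (EFin \o v) by have /integrableP[] := iv.
have fin0 A : measurable A -> \int[mu]_(x in B `&` A) v x = 0 <->
    (\int[mu]_(x in B `&` A) (v x)%:E = 0)%E.
  move=> mA; rewrite /Rintegral; split => [H|->//].
  rewrite -[LHS]fineK; first by rewrite H.
  apply: integrable_fin_num; first exact: measurableI.
  by apply: (integrableS mB) iv => //; exact: measurableI.
have mo a : measurable (orthant a).
  apply: (@measurable_box R d (fun i => `]-oo, a i[%classic)) => i.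
  exact: measurable_itv.
pose H A := measurable A /\ (\int[mu]_(x in B `&` A) (v x)%:E = 0)%E.
have HT : H setT.
  by split; [exact: measurableT|apply/fin0; [exact: measurableT|rewrite setIT]].
have dH : lambda_system setT H.
  apply/dynkin_lambda_system; split => //.
  - move=> A [mA HA]; split; first exact: measurableC.
    have := HT.2; rewrite setIT -{1}(setUIDK B A).
    rewrite (integral_setU _ (measurableI _ _ mB mA) (measurableD mB mA)).
    + by rewrite HA add0e setDE.
    + by rewrite setUIDK.
    + by rewrite disj_set2E setDE setIACA setICr setI0.
  - move=> F tF HF; have mF n : measurable (F n) := (HF n).1.
    split; first exact: bigcupT_measurable.
    rewrite setI_bigcupr integral_bigcup.
    + rewrite (eq_eseriesr (fun n _ => (HF n).2)) eseries0//.
    + apply/trivIsetP => i j _ _ ij; rewrite setIACA.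
      by move/trivIsetP : tF => /(_ i j Logic.I Logic.I ij) ->; rewrite setI0.
    + by move=> k; exact: measurableI.
    + rewrite -setI_bigcupr; apply: (integrableS mB) iv => //.
      by apply: measurableI => //; exact: bigcupT_measurable.
have HA A : measurable A -> H A.
  move=> /measurable_orthants; apply: (@lambda_system_subset _ _ _ setT H dH) => //.
  - move=> _ _ [a _ <-] [b _ <-]; exists (fun i => Num.min (a i) (b i)) => //.
    apply/seteqP; split => [x /= xab|x [/= xa xb] i].
      by split => i; have := xab i; rewrite lt_min => /andP[].
    by rewrite lt_min xa xb.
  - by move=> _ [a _ <-]; split => //; apply/fin0.
have := @integral_ae_eq _ _ _ mu B mB (cst 0%E) (EFin \o v) iv (measurable_cst _).
move=> K; have : ae_eq mu B (EFin \o v) (cst 0%E).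
  apply: K => E EB mE; rewrite integral0.
  by have [_ ] := HA E mE; rewrite setIidr.
by apply: filterS => x K1 /K1 /= [].
Qed.

Lemma cvg_prod_ord (n : nat) (F : 'I_n -> nat -> R) (l : 'I_n -> R) :
  (forall i, F i @ \oo --> l i) ->
  (fun k => \prod_(i < n) F i k) @ \oo --> \prod_(i < n) l i.
Proof.
elim: n F l => [|n IH] F l H.
  by under eq_fun do rewrite big_ord0; rewrite big_ord0; exact: cvg_cst.
under eq_fun do rewrite big_ord_recl.
by rewrite big_ord_recl; apply: cvgM => //; apply: IH.
Qed.

Lemma polynomial_prod (n : nat) (F : 'I_n -> V -> R) :
  (forall i, polynomial_fun (F i)) -> polynomial_fun (fun x => \prod_(i < n) F i x).
Proof.
elim: n F => [|n IH] F H.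
  by under eq_fun do rewrite big_ord0; exact: polynomial_cst.
under eq_fun do rewrite big_ord_recl.
by apply: polynomialM => //; apply: IH.
Qed.

(* Indicators of orthants are bounded limits of polynomials on the ball. *)
Lemma ae_eq0_of_polynomials v : intB v ->
  (forall P, polynomial_fun P -> I (fun x => v x * P x) = 0) ->
  {ae mu, forall x, B x -> v x = 0}.
Proof.
move=> iv HP; have mv : measurable_fun B v.
  by apply/measurable_EFinP; have /integrableP[] := iv.
apply: ae_eq0_of_orthants => //; last first.
  have := HP _ (polynomial_cst _ 1); under eq_fun do rewrite mulr1.
  by [].
move=> a; pose M := 1 + \sum_i `|a i|.
have aM i : `|a i| <= M - 1.
  by rewrite /M addrAC subrr add0r (bigD1 i)//= lerDl sumr_ge0.
have M1 : 1 <= M by rewrite lerDl sumr_ge0.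
(* An affine change of variable sending the ball into [0, 1] and the hyperplane x_i = a_i to 1/2,
   where [step_power] jumps; M bounds |x_i - a_i| on the ball. *)
pose y i (x : V) : R := (x ord0 i - a i) / (2 * M) + 2^-1.
have yitv i x : B x -> 0 <= y i x <= 1.
  move=> Bx; have /ltW := unit_ball_coor i Bx; rewrite ler_norml => /andP[x1 x2].
  have := aM i; rewrite ler_norml => /andP[a1 a2].
  have M0 : 0 < 2 * M by lra.
  have : -1 <= (x ord0 i - a i) / M <= 1 by rewrite ler_pdivrMr ?ler_pdivlMr; lra.
  have -> : y i x = ((x ord0 i - a i) / M + 1) / 2.
    by rewrite /y; field; lra.
  lra.
have ylt i x : (y i x < 2^-1) = (x ord0 i < a i).
  by rewrite /y -ltrBrDr subrr pmulr_llt0 ?subr_lt0// invr_gt0; lra.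
pose P n x := \prod_(i < d) step_power n (y i x).
have PP n : polynomial_fun (P n).
  apply: polynomial_prod => i; apply: polynomialX.
  rewrite (_ : (fun x => _) = (fun x => 1 + (-1) * (y i x ^+ n))); last first.
    by apply/funext => x; rewrite mulN1r.
  apply: polynomialD; first exact: polynomial_cst.
  apply: polynomialM; [exact: polynomial_cst|apply: polynomialX].
  apply: polynomialD; last exact: polynomial_cst.
  apply: polynomialM; last exact: polynomial_cst.
  by apply: polynomialD; [exact: polynomial_coor|exact: polynomial_cst].
have Pitv n x : B x -> `|P n x| <= 1.
  move=> Bx; rewrite normr_prod.
  suff /andP[] : 0 <= \prod_(i < d) `|step_power n (y i x)| <= 1 by [].
  elim/big_ind : _ => [|p q /andP[p0 p1] /andP[q0 q1]|i _].
  - by rewrite ler01 lexx.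
  - by rewrite mulr_ge0// mulr_ile1.
  - have /andP[H1 H2] := step_power_itv n (yitv i x Bx).
    by rewrite normr_ge0 ger0_norm.
have Pcvg x : B x -> (fun n => P n x) @ \oo --> (\1_(orthant a) x : R).
  move=> Bx; have -> : (\1_(orthant a) x : R) = \prod_(i < d) ((y i x < 2^-1)%R%:R : R).
    rewrite indicE; have [xa|xa] := pselect (orthant a x).
      by rewrite mem_set// big1// => i _; rewrite ylt xa.
    rewrite memNset//; move/existsNP : xa => [i /negP xai].
    by rewrite (bigD1 i)//= ylt (negPf xai) mul0r.
  by apply: cvg_prod_ord => i; apply: cvg_step_power; exact: yitv.
have [_ H] : intB (fun x => v x * \1_(orthant a) x) /\
    (fun n => I (fun x => v x * P n x)) @ \oo --> I (fun x => v x * \1_(orthant a) x).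
  apply: (@Rintegral_dominated _ _ (fun x => `|v x|)).
  - by move=> n; apply: measurable_funM => //; exact: polynomial_measurable.
  - by move=> x Bx; apply: cvgMr; exact: Pcvg.
  - exact: integrable_norm.
  - by move=> n x Bx; rewrite normrM ler_piMr// Pitv.
have {}H : I (fun x => v x * \1_(orthant a) x) = 0.
  rewrite -(cvg_lim _ H)//; under eq_fun do rewrite HP//.
  exact: lim_cst.
rewrite Rintegral_mkcondr -[RHS]H; apply: eq_Rintegral => x _.
by rewrite /patch indicE; case: ifP => _; rewrite ?mulr1 ?mulr0.
Qed.

(** The fundamental lemma of the calculus of variations. Multiplied by a cut-off of order 0, v
    becomes integrable and orthogonal to all polynomials P, since the cut-off times P is a test
    function. Every point of the ball lies where some cut-off is nonzero. *)
Lemma ae_eq0_of_test_functions v : locally_integrable_ball v ->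
  (forall eta, test_function eta -> I (fun x => v x * eta x) = 0) ->
  {ae mu, forall x, B x -> v x = 0}.
Proof.
move=> [mv lv] Hv.
pose c n := @cutoff_fun R d 0 n (fun=> 1).
have H n : {ae mu, forall x, B x -> v x * c n x = 0}.
  have ec : elementary (c n) by apply: elementary_cutoff; exact: elementary_cst.
  have mc : measurable_fun B (c n).
    by apply: measurable_funS (measurable_elementary ec).
  apply: ae_eq0_of_polynomials.
    pose K := [set x : V | sqnorm x <= 1 - n.+1%:R^-1].
    have n0 : 0 < n.+1%:R^-1 :> R by rewrite invr_gt0.
    have KB : K `<=` B by move=> x; rewrite unit_ballE => /le_lt_trans; apply; rewrite gtrBl.
    have mK : measurable K.
      rewrite (_ : K = (@sqnorm R d) @^-1` `]-oo, 1 - n.+1%:R^-1]%classic).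
        rewrite -[X in measurable X]setTI; apply: measurable_elementary => //.
        exact: elementary_sqnorm.
      by apply/seteqP; split => x /=; rewrite in_itv.
    have iK : mu.-integrable K (EFin \o v).
      by apply: lv => //; apply: compact_sqnorm_le; rewrite gerBl ltW.
    have iKc : mu.-integrable K (EFin \o (fun x => v x * c n x)).
      have := @integrableMr _ _ _ mu K mK (c n) (EFin \o v) (measurable_funS mB KB mc) _ iK.
      move=> /(_ _)/eq_integrable; apply => //; last first.
        have [C HC] := @cutoff_bounded R 0 0 (leqnn _).
        exists C; split; first exact: num_real.
        move=> M /ltW CM x _; rewrite /= /c /cutoff_fun mulr1.
        by apply: le_trans CM; apply: HC; exact: sqnorm_ge0.
      by move=> x _ /=; rewrite mulrC EFinM.
    have : mu.-integrable B ((EFin \o (fun x => v x * c n x)) \_ K).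
      apply: (@integrableS _ _ _ mu setT B) => //.
      by rewrite -integrable_mkcond.
    apply: eq_integrable => // x /set_mem Bx; rewrite /patch; case: ifPn => //.
    rewrite notin_setE /K /= => /negP; rewrite -ltNge => xc.
    rewrite /c /cutoff_fun (_ : cutoff _ _ _ _ = 0) ?mul0r ?mulr0//.
    by apply/eqP/negbFE; rewrite cutoff0_neq0; apply/negP => /(lt_trans xc); rewrite ltxx.
  move=> P HP; rewrite -[RHS](Hv (cutoff_fun 0 n P)); last first.
    by apply: test_function_cutoff; exact: polynomial_elementary.
  by apply: eq_Rintegral => x _; rewrite /c /cutoff_fun mulr1 mulrA.
have : {ae mu, forall x, forall n, B x -> v x * c n x = 0}.
  apply/ae_foralln => n; exact: H.
apply: filterS => x Hx Bx.
have [n Hn] : exists n : nat, n.+1%:R^-1 < 1 - sqnorm x :> R.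
  have q1 : 0 < 1 - sqnorm x by rewrite subr_gt0.
  have := @near_infty_natSinv_lt R (PosNum q1).
  by move=> [k _ /(_ k (leqnn _))]; exists k.
have /eqP := Hx n Bx; rewrite mulf_eq0 => /orP[/eqP//|].
suff /negPf-> : c n x != 0 by [].
by rewrite /c /cutoff_fun mulr1 cutoff0_neq0 ltrBrDr addrC -ltrBrDr.
Qed.

End integrals_on_the_ball.

(** * Weak derivatives and the energy forms *)

Section weak_derivatives.
Variables (R : realType) (d : nat).
Local Notation V := 'rV[R]_d.
Local Notation mu := (lebesgue_rV R d).
Local Notation B := (@unit_ball R d).
Local Notation intB f := (mu.-integrable B (EFin \o f)).
Local Notation I f := (\int[mu]_(x in B) f x).
Local Notation aeB f g := {ae mu, forall x, B x -> f x = g x}.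
Implicit Types (f g u v w P psi eta : V -> R) (i : 'I_d) (s : seq 'I_d).
Implicit Types (L : seq (seq 'I_d)).

Let mB : measurable B := @measurable_unit_ball R d.
Hint Resolve mB : core.

Lemma partialE i f x : partial i f x = 'D_(delta_mx ord0 i) f x.
Proof. by []. Qed.

Lemma partialsS i s f : partials (i :: s) f = partial i (partials s f).
Proof. by []. Qed.

Opaque partial.

Lemma smooth_partial i f : smooth f -> smooth (partial i f).
Proof.
move=> sf s x; have := sf (s ++ [:: i]) x; rewrite partials_cat /=.
by move=> [].
Qed.

Lemma smooth_partials s f : smooth f -> smooth (partials s f).
Proof. by move=> sf; elim: s => [//|i s IH]; rewrite partialsS; exact: smooth_partial. Qed.

Lemma smooth_continuous f : smooth f -> continuous f.
Proof. by move=> sf x; have [] := sf [::] x. Qed.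

Lemma partialsD s f g : smooth f -> smooth g ->
  partials s (fun x => f x + g x) = (fun x => partials s f x + partials s g x).
Proof.
move=> sf sg; elim: s => [//|i s IH]; rewrite !partialsS IH; apply/funext => x.
by rewrite !partialE; apply: deriveD; [have [_] := sf s x|have [_] := sg s x].
Qed.

Lemma smoothD f g : smooth f -> smooth g -> smooth (fun x => f x + g x).
Proof.
move=> sf sg s x; rewrite partialsD//.
have [cf df] := sf s x; have [cg dg] := sg s x; split.
  exact: (@continuousD _ _ _ (partials s f) (partials s g)).
by move=> i; exact: derivableD.
Qed.

Lemma smooth_cst (c : R) : @smooth R d (fun _ => c).
Proof. exact/elementary_smooth/elementary_cst. Qed.

(** A differential operator with constant coefficients, as a list of multi-indices with repetitions.
    Iterated laplacians and their partial derivatives have this form, with all terms of one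
    order. *)
Definition sum_partials L f x : R := \sum_(s <- L) partials s f x.

Lemma sum_partials_cons s L f :
  sum_partials (s :: L) f = (fun x => partials s f x + sum_partials L f x).
Proof. by apply/funext => x; rewrite /sum_partials big_cons. Qed.

Lemma smooth_sum_partials L f : smooth f -> smooth (sum_partials L f).
Proof.
move=> sf; elim: L => [|s L IH].
  rewrite (_ : sum_partials _ _ = fun=> 0); first exact: smooth_cst.
  by apply/funext => x; rewrite /sum_partials big_nil.
by rewrite sum_partials_cons; exact: smoothD (smooth_partials s sf) IH.
Qed.

Lemma partials_sum_partials s L f : smooth f ->
  partials s (sum_partials L f) = sum_partials [seq s ++ r | r <- L] f.
Proof.
move=> sf; elim: L => [|r L IH] /=.
  rewrite (_ : sum_partials _ _ = fun=> 0); last first.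
    by apply/funext => x; rewrite /sum_partials big_nil.
  by elim: s => [//|i s IH]; rewrite partialsS IH partial_cst.
rewrite !sum_partials_cons.
by rewrite (partialsD s (smooth_partials r sf) (smooth_sum_partials L sf)) IH partials_cat.
Qed.

Lemma compact_measurable_rV (K : set V) : compact K -> measurable K.
Proof.
move=> /compact_closed => /(_ (@norm_hausdorff _ _)) cK.
by rewrite -[K]setCK; apply: measurableC; apply: open_measurable_rV; exact: closed_openC.
Qed.

Lemma continuous_bounded_on_ball f : continuous f -> bounded_on_ball f.
Proof.
move=> cf.
have [||c _ Hc] := @EVT_max_rV R d (fun x => `|f x|) [set x | sqnorm x <= 1] _
    (compact_sqnorm_le (lexx 1)).
- exists 0; rewrite /= /sqnorm big1// => i _.
  by rewrite mxE expr0n.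
- apply: continuous_subspaceT => x; apply: continuous_comp; first exact: cf.
  exact: norm_continuous.
- by exists `|f c| => x Bx; apply: Hc; rewrite inE /=; exact: ltW.
Qed.

Lemma continuous_measurable_ball f : continuous f -> measurable_fun B f.
Proof. by move=> cf; apply: measurable_funS (continuous_measurable_rV cf). Qed.

Lemma smooth_bounded f : smooth f -> bounded_on_ball f.
Proof. by move=> /smooth_continuous; exact: continuous_bounded_on_ball. Qed.

Lemma smooth_measurable f : smooth f -> measurable_fun B f.
Proof. by move=> /smooth_continuous; exact: continuous_measurable_ball. Qed.

Lemma smoothM_integrable f g : smooth f -> smooth g -> intB (fun x => f x * g x).
Proof.
move=> sf sg; apply: bounded_integrable.
  by apply: measurable_funM; exact: smooth_measurable.
by apply: bounded_on_ballM; exact: smooth_bounded.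
Qed.

Lemma test_function_out psi x : test_function psi -> ~ B x -> psi x = 0.
Proof.
move=> [_ _ sub] nB; apply/eqP/negPn/negP => n0; apply: nB.
by apply: sub; exact: subset_closure.
Qed.

Lemma partial_out psi i x : ~ closure [set x | psi x != 0] x -> partial i psi x = 0.
Proof.
move=> nK; have oK : open (~` closure [set x | psi x != 0]).
  by apply: closed_openC; exact: closed_closure.
have H : \near x, psi x = (cst 0 : V -> R) x.
  have : \forall z \near x, (~` closure [set x | psi x != 0]) z.
    exact: open_nbhs_nbhs.
  apply: filterS => z nz; apply/eqP/negPn/negP => n0; apply: nz.
  exact: subset_closure.
by rewrite partialE (near_eq_derive _ H) derive_cst.
Qed.

Lemma test_function_partial i psi : test_function psi -> test_function (partial i psi).
Proof.
move=> [spsi cK KB].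
have H : closure [set x | partial i psi x != 0] `<=` closure [set x | psi x != 0].
  rewrite [X in _ `<=` X](closure_id _).1; last exact: closed_closure.
  apply: closureS => x /=; apply: contraNP => /partial_out -> //.
split; first exact: smooth_partial.
  by apply: subclosed_compact cK H; exact: closed_closure.
exact: subset_trans KB.
Qed.

Lemma test_function_partials s psi : test_function psi -> test_function (partials s psi).
Proof. by move=> tpsi; elim: s => //= i s; exact: test_function_partial. Qed.

(** The derivative of psi g vanishes off the ball, so its integral over the ball is one over the
    whole space, equal to 0 whatever g does at the boundary. *)
Lemma integral_by_parts i psi g : test_function psi -> smooth g ->
  I (fun x => partial i psi x * g x) = - I (fun x => psi x * partial i g x).
Proof.
move=> tpsi sg; have tdpsi := test_function_partial i tpsi.
have [spsi _ _] := tpsi; have [sdpsi _ _] := tdpsi.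
have sdg := smooth_partial i sg.
pose G x := partial i psi x * g x + psi x * partial i g x.
have Gout x : ~ B x -> G x = 0.
  by move=> nB; rewrite /G (test_function_out tpsi)// (test_function_out tdpsi)// !mul0r addr0.
have cG : continuous G.
  have cc f h : smooth f -> smooth h -> continuous (fun x => f x * h x).
    move=> sf sh x; apply: (@continuousM _ _ f h x).
      exact: smooth_continuous sf x.
    exact: smooth_continuous sh x.
  move=> x; apply: (@continuousD _ _ _ (fun x => partial i psi x * g x)
    (fun x => psi x * partial i g x)).
    exact: cc sdpsi sg x.
  exact: cc spsi sdg x.
have [C HC] := continuous_bounded_on_ball cG.
have C0 : `|C| >= 0 by [].
have cubeB (x : V) : (exists j, 1 < `|x ord0 j|) -> ~ B x.
  move=> [j xj] /(unit_ball_coor j) /(lt_trans xj); rewrite ltxx.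
  by [].
have : (\int[mu]_x (G x)%:E)%E = 0.
  apply: (@integral_partial0 R d i (fun x => psi x * g x) G `|C|) => //.
  - move=> x; have [dpsi dg] : derivable psi x (delta_mx ord0 i) /\
        derivable g x (delta_mx ord0 i).
      by split; [have [_] := spsi [::] x|have [_] := sg [::] x].
    have := @is_deriveM _ _ psi g x _ _ _ (derivableP dpsi) (derivableP dg).
    apply: is_derive_ext => //.
    by rewrite /G /GRing.scale/= addrC [g x * _]mulrC.
  - move=> x; have [Bx|nB] := pselect (B x).
      exact: le_trans (HC x Bx) (ler_norm _).
    by rewrite Gout// normr0.
  - move=> x /cubeB nB; split; last exact: Gout.
    by rewrite (test_function_out tpsi)// mul0r.
move=> H; have : I G = 0.
  rewrite /Rintegral integral_mkcond (_ : _ \_ _ = EFin \o G) ?H//.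
  apply/funext => x; rewrite /patch; case: ifPn => //.
  by rewrite notin_setE => /Gout /= ->.
rewrite (RintegralD mB (smoothM_integrable sdpsi sg) (smoothM_integrable spsi sdg)).
by move=> /eqP; rewrite addr_eq0 => /eqP.
Qed.

(** The outermost derivative of psi is moved first and so becomes the innermost one on g; hence the
    reversed list. *)
Lemma integral_by_parts_seq s psi g : test_function psi -> smooth g ->
  I (fun x => partials s psi x * g x) =
  (-1) ^+ size s * I (fun x => psi x * partials (rev s) g x).
Proof.
move=> tpsi; elim: s g => [|i s IH] g sg /=; first by rewrite expr0 mul1r.
rewrite (integral_by_parts i (test_function_partials s tpsi) sg).
rewrite (IH _ (smooth_partial i sg)).
by rewrite rev_cons -cats1 partials_cat /= exprS mulN1r mulNr.
Qed.

Lemma sum_partials_by_parts p L psi g : test_function psi -> elementary g ->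
  (forall s, s \in L -> size s = p) ->
  I (fun x => sum_partials L psi x * g x) =
  (-1) ^+ p * I (fun x => psi x * sum_partials L g x).
Proof.
move=> tpsi eg; have sg := elementary_smooth eg; have [spsi _ _] := tpsi.
elim: L => [|s L IH] HL.
  rewrite (eq_Rintegral _ (g := fun=> 0)) => [|x _]; last first.
    by rewrite /sum_partials big_nil mul0r.
  rewrite [in RHS](eq_Rintegral _ (g := fun=> 0)) => [|x _]; last first.
    by rewrite /sum_partials big_nil mulr0.
  by rewrite Rintegral_cst// mul0r mulr0.
rewrite !sum_partials_cons.
under eq_Rintegral do rewrite mulrDl.
under [in RHS]eq_Rintegral do rewrite mulrDr.
rewrite !RintegralD ?IH ?mulrDr//; first last.
- exact: smoothM_integrable (smooth_sum_partials L spsi) sg.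
- exact: smoothM_integrable (smooth_partials s spsi) sg.
- exact: smoothM_integrable spsi (smooth_sum_partials L sg).
- exact: smoothM_integrable spsi (smooth_partials s sg).
- by move=> r rL; apply: HL; rewrite in_cons rL orbT.
by rewrite integral_by_parts_seq// elementary_partials_rev// HL// mem_head.
Qed.

Lemma L2_ball_locally_integrable u : L2_ball u -> locally_integrable_ball u.
Proof.
move=> uL2; split; first by case: uL2.
move=> K KB /compact_measurable_rV mK.
by apply: (integrableS mB) KB _ => //; exact: L2_ball_integrable.
Qed.

Lemma locally_integrable_test v eta : locally_integrable_ball v -> test_function eta ->
  intB (fun x => v x * eta x).
Proof.
move=> [mv lv] teta; have [seta cK KB] := teta.
set K := closure _ in cK KB; have mK := compact_measurable_rV cK.
have [C HC] := smooth_bounded seta.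
have iK : mu.-integrable K (EFin \o (fun x => v x * eta x)).
  have := @integrableMr _ _ _ mu K mK eta (EFin \o v)
     (measurable_funS mB KB (smooth_measurable seta)) _ (lv K KB cK).
  move=> /(_ _)/eq_integrable; apply => //; last first.
    exists C; split; first exact: num_real.
    by move=> M /ltW CM x /= Kx; apply: le_trans CM; apply: HC; exact: KB.
  by move=> x _ /=; rewrite mulrC EFinM.
have : mu.-integrable B ((EFin \o (fun x => v x * eta x)) \_ K).
  apply: (@integrableS _ _ _ mu setT B) => //.
  by rewrite -integrable_mkcond.
apply: eq_integrable => // x _; rewrite /patch; case: ifPn => //.
rewrite notin_setE => nK; rewrite /= (_ : eta x = 0) ?mulr0//.
by apply/eqP/negPn/negP => n0; apply: nK; exact: subset_closure.
Qed.

Lemma weak_derivative_unique s u v w :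
  is_weak_derivative s u v -> is_weak_derivative s u w -> aeB v w.
Proof.
move=> [lv Hv] [lw Hw].
have lvw : locally_integrable_ball (fun x => v x - w x).
  split; first by apply: measurable_funB; [case: lv|case: lw].
  move=> K KB cK; have -> : EFin \o (fun x => v x - w x) = ((EFin \o v) \- (EFin \o w))%E by [].
  apply: integrableB; first exact: compact_measurable_rV.
    by case: lv => _; exact.
  by case: lw => _; exact.
have : aeB (fun x => v x - w x) (fun=> 0).
  apply: ae_eq0_of_test_functions => // eta teta.
  under eq_Rintegral do rewrite mulrBl.
  rewrite RintegralB//; try exact: locally_integrable_test.
  apply/eqP; rewrite subr_eq0; apply/eqP.
  have := Hv eta teta; rewrite (Hw eta teta).
  have n1 : (-1) ^+ size s != 0 :> R by rewrite expf_neq0// oppr_eq0 oner_neq0.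
  by move/(mulfI n1).
by apply: filterS => x H Bx; apply/eqP; rewrite -subr_eq0; apply/eqP; exact: H.
Qed.

Lemma weak_derivativeP s u v : is_weak_derivative s u v ->
  is_weak_derivative s u (weak_derivative s u).
Proof. by move=> H; apply: getPex; exists v. Qed.

Lemma aeB_Rintegral f g : measurable_fun B f -> measurable_fun B g -> aeB f g ->
  I f = I g.
Proof.
move=> mf mg fg; rewrite /Rintegral; congr fine; apply: ae_eq_integral => //.
- exact/measurable_EFinP.
- exact/measurable_EFinP.
- by apply: filterS fg => x H Bx; rewrite H.
Qed.

Lemma aeB_L2 f g : measurable_fun B g -> aeB f g -> L2_ball f -> L2_ball g.
Proof.
move=> mg fg [mf /integrableP[m1 H1]]; split => //.
have m2 : measurable_fun B (fun x => (g x ^+ 2)%:E).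
  by apply/measurable_EFinP; exact: measurable_funX.
apply/integrableP; split => //.
suff <- : (\int[mu]_(x in B) `|(f x ^+ 2)%:E| = \int[mu]_(x in B) `|(g x ^+ 2)%:E|)%E by [].
apply: ae_eq_integral => //.
- exact: measurableT_comp.
- exact: measurableT_comp.
- by apply: filterS fg => x H Bx; rewrite H.
Qed.

Lemma bounded_L2 f : measurable_fun B f -> bounded_on_ball f -> L2_ball f.
Proof.
move=> mf bf; split => //; apply: bounded_integrable; first exact: measurable_funX.
exact: bounded_on_ballM.
Qed.

Lemma smooth_L2 f : smooth f -> L2_ball f.
Proof.
by move=> sf; apply: bounded_L2; [exact: smooth_measurable|exact: smooth_bounded].
Qed.

Lemma L2_ballM u v : L2_ball u -> L2_ball v -> intB (fun x => u x * v x).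
Proof.
move=> [mu1 i1] [mu2 i2].
apply: (@le_integrable _ _ _ _ _ mB _ (fun x => (u x ^+ 2)%:E + (v x ^+ 2)%:E)%E).
- by apply/measurable_EFinP; exact: measurable_funM.
- move=> x Bx /=; rewrite lee_fin [leRHS]ger0_norm ?addr_ge0 ?sqr_ge0//.
  rewrite normrM -[u x ^+ 2]real_normK ?num_real// -[v x ^+ 2]real_normK ?num_real//.
  by have := sqr_ge0 (`|u x| - `|v x|); have := normr_ge0 (u x); have := normr_ge0 (v x); nra.
- exact: integrableD.
Qed.

Lemma L2_ballD u v : L2_ball u -> L2_ball v -> L2_ball (fun x => u x + v x).
Proof.
move=> Lu Lv; have [mu1 i1] := Lu; have [mu2 i2] := Lv.
split; first exact: measurable_funD.
have iuv : mu.-integrable B (fun x => (u x ^+ 2)%:E + (v x ^+ 2)%:E)%E by exact: integrableD.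
have i3 := integrableZl mB 2 (L2_ballM Lu Lv).
have := integrableD mB iuv i3; apply: eq_integrable => // x _ /=.
by rewrite -EFinM -!EFinD; congr EFin; ring.
Qed.

Lemma L2_ballN u : L2_ball u -> L2_ball (fun x => - u x).
Proof.
move=> [mu1 i1]; split; first exact: measurable_funN.
by under eq_fun do rewrite sqrrN.
Qed.

Local Notation seqs := (nat -> V -> R).

Definition L2_cvg (g : nat -> V -> R) w :=
  (\int[mu]_(x in B) ((g n x - w x) ^+ 2)%:E)%E @[n --> \oo] --> 0%E.

Lemma aeB_L2_cvg (g : seqs) w w' : (forall k, measurable_fun B (g k)) -> measurable_fun B w ->
  measurable_fun B w' -> aeB w w' -> L2_cvg g w -> L2_cvg g w'.
Proof.
move=> mg mw mw' ww'; rewrite /L2_cvg.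
rewrite (_ : (fun n => _) =
  (fun n => \int[mu]_(x in B) ((g n x - w' x) ^+ 2)%:E)%E)//.
apply/funext => n; apply: ae_eq_integral => //.
- by apply/measurable_EFinP/measurable_funX; exact: measurable_funB.
- by apply/measurable_EFinP/measurable_funX; exact: measurable_funB.
- by apply: filterS ww' => x H Bx; rewrite H.
Qed.

Definition L2_dist2 f g : R := I (fun x => (f x - g x) ^+ 2).

Lemma L2_ballB u v : L2_ball u -> L2_ball v -> L2_ball (fun x => u x - v x).
Proof. by move=> Lu Lv; apply: L2_ballD => //; exact: L2_ballN. Qed.

Lemma L2_cvgP (g : seqs) w : (forall k, L2_ball (g k)) -> L2_ball w ->
  L2_cvg g w <-> (fun k => L2_dist2 (g k) w) @ \oo --> 0.
Proof.
move=> Lg Lw; have fn k : (\int[mu]_(x in B) ((g k x - w x) ^+ 2)%:E)%E \is a fin_num.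
  by apply: integrable_fin_num => //; have [] := L2_ballB (Lg k) Lw.
rewrite /L2_cvg; split => [H|H]; first exact: fine_cvg.
by apply/fine_cvgP; split => //; near=> k.
Unshelve. all: by end_near. Qed.

Lemma L2_cvgD (g : seqs) w (g' : seqs) w' : (forall k, L2_ball (g k)) -> L2_ball w ->
  (forall k, L2_ball (g' k)) -> L2_ball w' ->
  L2_cvg g w -> L2_cvg g' w' ->
  L2_cvg (fun k x => g k x + g' k x) (fun x => w x + w' x).
Proof.
move=> Lg Lw Lg' Lw' /(L2_cvgP Lg Lw) H /(L2_cvgP Lg' Lw') H'.
apply/L2_cvgP; [by move=> k; exact: L2_ballD|exact: L2_ballD|].
apply: (@squeeze_cvgr _ _ _ _ (fun=> 0) (fun k => 2 * L2_dist2 (g k) w + 2 * L2_dist2 (g' k) w')).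
- near=> k; apply/andP; split; first by apply: Rintegral_ge0 => x _; exact: sqr_ge0.
  have [m1 i1] := L2_ballB (Lg k) Lw; have [m2 i2] := L2_ballB (Lg' k) Lw'.
  rewrite /L2_dist2 -!RintegralZl// -RintegralD//; last 2 first.
  + exact: (integrableZl mB 2 i1).
  + exact: (integrableZl mB 2 i2).
  apply: le_Rintegral => //.
  + by have [] := L2_ballB (L2_ballD (Lg k) (Lg' k)) (L2_ballD Lw Lw').
  + exact: (integrableD mB (integrableZl mB 2 i1) (integrableZl mB 2 i2)).
  + by move=> x _; have := sqr_ge0 ((g k x - w x) - (g' k x - w' x)); nra.
- exact: cvg_cst.
- by rewrite -[X in _ --> X](addr0 0) -[X in _ --> X + _](mulr0 2) -[X in _ --> _ + X](mulr0 2);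
    apply: cvgD; exact: cvgMr.
Unshelve. all: by end_near. Qed.

(** Strong convergence implies weak convergence. Young's inequality with a free parameter delta
    plays the part of Cauchy-Schwarz. *)
Lemma L2_cvg_Rintegral (g : seqs) w (b : V -> R) :
  (forall k, L2_ball (g k)) -> L2_ball w -> L2_cvg g w -> measurable_fun B b -> bounded_on_ball b ->
  (fun k => I (fun x => g k x * b x)) @ \oo --> I (fun x => w x * b x).
Proof.
move=> Lg Lw /(L2_cvgP Lg Lw) H mb bb.
have Lb := bounded_L2 mb bb; have [C HC] := bb.
have H1 k delta : 0 < delta -> `|I (fun x => g k x * b x) - I (fun x => w x * b x)| <=
    delta^-1 * L2_dist2 (g k) w + delta * I (fun x => b x ^+ 2).
  move=> d0; have iD := L2_ballB (Lg k) Lw; have [m1 i1] := iD; have [m2 i2] := Lb.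
  rewrite -RintegralB//; try exact: L2_ballM.
  apply: le_trans (le_normr_Rintegral _ _) _ => //.
    have := L2_ballM iD Lb; apply: eq_integrable => // x _ /=.
    by rewrite mulrBl.
  rewrite /L2_dist2 -!RintegralZl// -RintegralD//; last 2 first.
  + exact: (integrableZl mB delta^-1 i1).
  + exact: (integrableZl mB delta i2).
  apply: le_Rintegral => //.
  + have := integrable_abse (L2_ballM iD Lb); apply: eq_integrable => // x _ /=.
    by rewrite mulrBl.
  + exact: (integrableD mB (integrableZl mB delta^-1 i1) (integrableZl mB delta i2)).
  + move=> x _; rewrite -mulrBl normrM.
    have e1 := real_normK (num_real (g k x - w x)); have e2 := real_normK (num_real (b x)).
    rewrite -e1 -e2; move: `|_| `|_| => p q.
    rewrite -(@ler_pM2l _ delta)// mulrDr !mulrA mulfV ?gt_eqF// mul1r.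
    by have := sqr_ge0 (p - delta * q); nra.
apply/cvgrPdist_le => e e0.
set bs := I (fun x => b x ^+ 2) in H1.
have bs0 : 0 <= bs by apply: Rintegral_ge0 => x _; exact: sqr_ge0.
(* This delta makes the term with b at most e/2; the summand 1 avoids a division by zero when b
   vanishes almost everywhere. *)
pose delta := e / (2 * (bs + 1)); have d0 : 0 < delta by rewrite divr_gt0//; lra.
near=> k; rewrite distrC; apply: le_trans (H1 k delta d0) _.
have h1 : L2_dist2 (g k) w <= delta * (e / 2).
  near: k; have /cvgrPdist_le := H; move=> /(_ (delta * (e / 2))).
  have de : 0 < delta * (e / 2) by rewrite mulr_gt0//; lra.
  move=> /(_ de); apply: filterS => k; rewrite sub0r normrN; apply: le_trans.
  exact: ler_norm.
have h2 : delta^-1 * L2_dist2 (g k) w <= e / 2.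
  by rewrite ler_pdivrMl.
have h3 : delta * bs <= e / 2.
  rewrite /delta mulrAC ler_pdivrMr; last lra.
  by nra.
lra.
Unshelve. all: by end_near. Qed.

Definition strong_limit (g : nat -> V -> R) w :=
  [/\ forall k, smooth (g k), L2_ball w & L2_cvg g w].

(** Weak derivatives are closed under L2 limits: w' is a weak derivative of w, so it agrees almost
    everywhere with the representative picked by [weak_derivative], which is thus also the limit.
    The condition [rev s = s] absorbs the reversal in integration by parts; it holds for [[:: i]]
    and [[:: i; i]], the lists to which the lemma is applied. *)
Lemma strong_limit_weak s (g : seqs) w w' : rev s = s -> strong_limit g w ->
  strong_limit (fun k => partials s (g k)) w' ->
  strong_limit (fun k => partials s (g k)) (weak_derivative s w).
Proof.
move=> rs [sg Lw gw] [sg' Lw' gw'].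
have W : is_weak_derivative s w w'.
  split; first exact: L2_ball_locally_integrable.
  move=> eta teta; have [seta _ _] := teta.
  have seta' := smooth_partials s seta.
  have E k : I (fun x => g k x * partials s eta x) =
      (-1) ^+ size s * I (fun x => partials s (g k) x * eta x).
    under eq_Rintegral do rewrite mulrC.
    rewrite (integral_by_parts_seq s teta (sg k)) rs; congr (_ * _).
    by apply: eq_Rintegral => x _; rewrite mulrC.
  have Lg k : L2_ball (g k) := smooth_L2 (sg k).
  have Lg' k : L2_ball (partials s (g k)) := smooth_L2 (sg' k).
  have C1 := L2_cvg_Rintegral Lg Lw gw (smooth_measurable seta') (smooth_bounded seta').
  have C2 := L2_cvg_Rintegral Lg' Lw' gw' (smooth_measurable seta) (smooth_bounded seta).
  have {}C2 : (fun k => (-1) ^+ size s * I (fun x => partials s (g k) x * eta x)) @ \oo -->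
      (-1) ^+ size s * I (fun x => w' x * eta x) by apply: cvgMr.
  have EE : (fun k => I (fun x => g k x * partials s eta x)) =
      (fun k => (-1) ^+ size s * I (fun x => partials s (g k) x * eta x)) by apply/funext.
  by rewrite -(cvg_lim _ C1)// EE (cvg_lim _ C2).
have W2 := weak_derivativeP W.
have ww := weak_derivative_unique W W2.
have [[mW _] _] := W2; have [mw' _] := Lw'.
split => //; first exact: aeB_L2 ww Lw'.
apply: (aeB_L2_cvg _ mw' mW ww gw') => k; exact: smooth_measurable.
Qed.

Lemma strong_limitD (g : seqs) w (g' : seqs) w' : strong_limit g w -> strong_limit g' w' ->
  strong_limit (fun k x => g k x + g' k x) (fun x => w x + w' x).
Proof.
move=> [sg Lw H] [sg' Lw' H']; split.
- by move=> k; exact: smoothD.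
- exact: L2_ballD.
- by apply: L2_cvgD => // k; exact: smooth_L2.
Qed.

Lemma strong_limit0 : strong_limit (fun _ _ => 0) (fun _ => 0).
Proof.
split; first by move=> k; exact: smooth_cst.
  exact/smooth_L2/smooth_cst.
rewrite /L2_cvg (_ : (fun n => _) = fun=> 0%E); first exact: cvg_cst.
apply/funext => n; under eq_integral do rewrite subr0 expr0n /=.
by rewrite integral0.
Qed.

Lemma strong_limit_sum (T : Type) (r : seq T) (g : T -> nat -> V -> R) (w : T -> V -> R) :
  (forall a, strong_limit (g a) (w a)) ->
  strong_limit (fun k x => \sum_(a <- r) g a k x) (fun x => \sum_(a <- r) w a x).
Proof.
move=> H; elim: r => [|a r IH].
  rewrite (_ : (fun k x => _) = fun _ _ => 0); last first.
    by apply/funext => k; apply/funext => x; rewrite big_nil.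
  rewrite (_ : (fun x => _) = fun _ => 0); last by apply/funext => x; rewrite big_nil.
  exact: strong_limit0.
rewrite (_ : (fun k x => _) = fun k x => g a k x + \sum_(b <- r) g b k x); last first.
  by apply/funext => k; apply/funext => x; rewrite big_cons.
rewrite (_ : (fun x => _) = fun x => w a x + \sum_(b <- r) w b x); last first.
  by apply/funext => x; rewrite big_cons.
exact: strong_limitD.
Qed.

End weak_derivatives.

(** * The energy forms and the weak equation tested on polynomials *)

Section energy.
Variables (R : realType) (d : nat).
Local Notation V := 'rV[R]_d.
Local Notation mu := (lebesgue_rV R d).
Local Notation B := (@unit_ball R d).
Local Notation intB f := (mu.-integrable B (EFin \o f)).
Local Notation I f := (\int[mu]_(x in B) f x).
Local Notation aeB f g := {ae mu, forall x, B x -> f x = g x}.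
Local Notation seqs := (nat -> V -> R).
Implicit Types (f u v w P phi eta : V -> R) (psi : seqs) (i : 'I_d) (s : seq 'I_d).
Implicit Types (L : seq (seq 'I_d)) (o : option 'I_d).

Let mB : measurable B := @measurable_unit_ball R d.
Hint Resolve mB : core.
Opaque partial.

(** The components of nabla^p: the single index [None] for even p, one [Some i] per coordinate for
    odd p. Both parities then become a sum over this list. *)
Definition nabla_index (p : nat) : seq (option 'I_d) :=
  if odd p then [seq Some i | i <- index_enum 'I_d] else [:: None].

Definition weak_nabla p o u : V -> R :=
  let w := iter p./2 (@weak_laplacian R d) u in
  if o is Some i then weak_derivative [:: i] w else w.

Definition nabla p o f : V -> R :=
  let g := iter p./2 (@laplacian R d) f in if o is Some i then partial i g else g.

Lemma nabla_dotE p u v x : nabla_dot p u v x =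
  \sum_(o <- nabla_index p) weak_nabla p o u x * weak_nabla p o v x.
Proof.
rewrite /nabla_dot /nabla_index /weak_nabla; case: ifP => _; last by rewrite big_seq1.
by rewrite big_map.
Qed.

Lemma iter_laplacian_sum j : exists2 L, (forall s, s \in L -> size s = j.*2) &
  forall f, smooth f -> iter j (@laplacian R d) f = sum_partials L f.
Proof.
elim: j => [|j [L HL EL]].
  exists [:: [::]] => [s|f _]; first by rewrite inE => /eqP ->.
  by apply/funext => x; rewrite /sum_partials big_seq1.
exists (flatten [seq [seq [:: i; i] ++ r | r <- L] | i <- index_enum 'I_d]).
  by move=> s /flatten_mapP[i _ /mapP[r /HL rj ->]] /=; rewrite rj.
move=> f sf; rewrite iterS EL//; apply/funext => x.
rewrite /sum_partials big_flatten big_map /laplacian; apply: eq_bigr => i _.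
have := partials_sum_partials [:: i; i] L sf; rewrite /sum_partials.
by rewrite !partialsS /= => ->.
Qed.

Lemma nabla_sum p o : o \in nabla_index p ->
  exists2 L, (forall s, s \in L -> size s = p) &
  forall f, smooth f -> nabla p o f = sum_partials L f.
Proof.
have [L HL EL] := iter_laplacian_sum p./2.
rewrite /nabla_index /nabla; case: ifP => op.
  move=> /mapP[i _ ->]; exists [seq i :: r | r <- L].
    move=> s /mapP[r /HL rp ->] /=; rewrite rp.
    by rewrite -[RHS]odd_double_half op.
  move=> f sf; rewrite EL//.
  have := partials_sum_partials [:: i] L sf.
  by rewrite partialsS.
rewrite inE => /eqP ->; exists L => // s /HL ->.
by rewrite -[RHS]odd_double_half op.
Qed.

(** The limits w are left unidentified: it is enough to know that they exist, because
    [strong_limit_weak] then matches them, one stage at a time, with the iterated weak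
    derivatives. *)
Definition approximated m u psi :=
  [/\ forall k, test_function (psi k), strong_limit psi u &
   forall L, (forall s, s \in L -> (size s <= m)%N) ->
     exists w, strong_limit (fun k => sum_partials L (psi k)) w].

Lemma approximated_smooth m u psi k : approximated m u psi -> smooth (psi k).
Proof. by move=> [/(_ k)[]]. Qed.

Lemma is_weak_derivative_nil u : L2_ball u -> is_weak_derivative [::] u u.
Proof.
move=> Lu; split; first exact: L2_ball_locally_integrable.
by move=> phi _; rewrite expr0 mul1r.
Qed.

Lemma sobolev_weak_derivative m u s : sobolev m u -> (size s <= m)%N ->
  is_weak_derivative s u (weak_derivative s u) /\ L2_ball (weak_derivative s u).
Proof.
move=> [_ H] sm; have [v Hv Lv] := H s sm; have Hw := weak_derivativeP Hv.
split => //; have [[mw _] _] := Hw.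
exact: aeB_L2 mw (weak_derivative_unique Hv Hw) Lv.
Qed.

Lemma sobolev0_approximated m u : sobolev0 m u -> exists psi, approximated m u psi.
Proof.
move=> [Su [psi [tpsi Hpsi]]]; exists psi.
have spsi k : smooth (psi k) by have [] := tpsi k.
have SL s : (size s <= m)%N -> strong_limit (fun k => partials s (psi k)) (weak_derivative s u).
  move=> sm; have [_ Lw] := sobolev_weak_derivative Su sm.
  split; [by move=> k; apply: smooth_partials|exact: Lw|exact: Hpsi].
have [Lu _] := Su.
split => //.
  (* Convergence in [sobolev0] is towards the chosen [weak_derivative [::] u], which agrees with u
     only almost everywhere. *)
  have [_ Lw H0] := SL [::] isT; split => //.
  have [W0 _] := sobolev_weak_derivative Su (leq0n m : (size ([::] : seq 'I_d) <= m)%N).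
  apply: (aeB_L2_cvg _ _ _ _ H0).
  - by move=> k; exact: smooth_measurable (spsi k).
  - by case: Lw.
  - by case: Lu.
  - exact: weak_derivative_unique W0 (is_weak_derivative_nil Lu).
elim=> [_|s L IH HL].
  exists (fun=> 0); rewrite (_ : (fun k => _) = fun _ _ => 0); first exact: strong_limit0.
  by apply/funext => k; apply/funext => x; rewrite /sum_partials big_nil.
have [|w Hw] := IH; first by move=> r rL; apply: HL; rewrite in_cons rL orbT.
exists (fun x => weak_derivative s u x + w x).
rewrite (_ : (fun k => _) = fun k x => partials s (psi k) x + sum_partials L (psi k) x).
  by apply: strong_limitD Hw; apply: SL; apply: HL; rewrite mem_head.
by apply/funext => k; rewrite sum_partials_cons.
Qed.

(** [weak_laplacian] is iterated on representatives chosen at each stage, whereas membership in H^m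
    only provides weak derivatives of u itself. The approximating test functions link the two: at
    every stage their laplacians converge, and the closedness of weak derivatives identifies the
    limit. *)
Lemma strong_limit_iter m u psi j : approximated m u psi -> (j.*2 <= m)%N ->
  strong_limit (fun k => iter j (@laplacian R d) (psi k)) (iter j (@weak_laplacian R d) u).
Proof.
move=> Ha; have [tpsi SL0 Hex] := Ha; have spsi k := approximated_smooth k Ha.
elim: j => [_|j IH jm]; first exact: SL0.
have {}IH : strong_limit (fun k => iter j (@laplacian R d) (psi k))
    (iter j (@weak_laplacian R d) u).
  by apply: IH; apply: leq_trans jm; rewrite leq_double.
apply: (@strong_limit_sum R d _ (index_enum 'I_d)
  (fun i k => partial i (partial i (iter j (@laplacian R d) (psi k))))
  (fun i => weak_derivative [:: i; i] (iter j (@weak_laplacian R d) u))) => i.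
have [L HL EL] := iter_laplacian_sum j.
have [|w Hw] := Hex [seq [:: i; i] ++ r | r <- L].
  by move=> s /mapP[r /HL rj ->] /=; rewrite rj.
apply: (@strong_limit_weak _ _ [:: i; i] _ _ w erefl IH).
rewrite (_ : (fun k => _) = fun k => sum_partials [seq [:: i; i] ++ r | r <- L] (psi k))//.
apply/funext => k; rewrite (EL _ (spsi k)).
exact: partials_sum_partials.
Qed.

Lemma strong_limit_nabla m u psi p o : approximated m u psi -> (p <= m)%N ->
  o \in nabla_index p ->
  strong_limit (fun k => nabla p o (psi k)) (weak_nabla p o u).
Proof.
move=> Ha pm oi; have [tpsi SL0 Hex] := Ha; have spsi k := approximated_smooth k Ha.
have jm : (p./2.*2 <= m)%N.
  by apply: leq_trans pm; rewrite -[leqRHS]odd_double_half leq_addl.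
have IH := strong_limit_iter Ha jm.
have [L HL EL] := nabla_sum oi.
case: o oi EL => [i|] oi EL; last exact: IH.
have [|w Hw] := Hex L; first by move=> s /HL ->.
apply: (@strong_limit_weak _ _ [:: i] _ _ w erefl IH).
rewrite (_ : (fun k => _) = fun k => sum_partials L (psi k))//.
by apply/funext => k; rewrite -EL.
Qed.

Lemma L2_eq0 f : L2_ball f -> I (fun x => f x ^+ 2) = 0 -> aeB f (fun=> 0).
Proof.
move=> [mf i2] H0.
have fn := integrable_fin_num mB i2.
have E : (\int[mu]_(x in B) `|(f x ^+ 2)%:E| = 0)%E.
  rewrite -[RHS](_ : (I (fun x => f x ^+ 2))%:E = 0%E); last by rewrite H0.
  rewrite /Rintegral fineK//; apply: eq_integral => x _.
  by rewrite /= ger0_norm// sqr_ge0.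
have m2 : measurable_fun B (fun x => (f x ^+ 2)%:E).
  by apply/measurable_EFinP; exact: measurable_funX.
have /ae_eq_integral_abs := E; move=> /(_ mB m2).
apply: filterS => x H Bx; have /= [/eqP] := H Bx.
by rewrite expf_eq0 /= => /eqP.
Qed.

Lemma strong_limit_cst f w : strong_limit (fun=> f) w -> aeB w f.
Proof.
move=> [sf Lw /L2_cvgP H].
have Lf : L2_ball f := smooth_L2 (sf 0%N).
have {}H := H (fun=> Lf) Lw.
have H0 : L2_dist2 f w = 0 by rewrite -(cvg_lim _ H)// lim_cst.
have := L2_eq0 (L2_ballB Lf Lw) H0.
by apply: filterS => x Hx Bx; apply/eqP; rewrite eq_sym -subr_eq0; apply/eqP; exact: Hx.
Qed.

Lemma is_weak_derivative_elementary s phi : elementary phi ->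
  is_weak_derivative s phi (partials s phi).
Proof.
move=> ephi; have sphi := elementary_smooth ephi.
split; first exact/L2_ball_locally_integrable/smooth_L2/smooth_partials.
move=> eta teta; under eq_Rintegral do rewrite mulrC.
rewrite (integral_by_parts_seq s teta sphi) elementary_partials_rev//; congr (_ * _).
by apply: eq_Rintegral => x _; rewrite mulrC.
Qed.

Lemma sobolev0_elementary m phi : test_function phi -> elementary phi ->
  sobolev0 m phi.
Proof.
move=> tphi ephi; have sphi := elementary_smooth ephi.
split; first split; first exact: smooth_L2.
  move=> s _; exists (partials s phi); first exact: is_weak_derivative_elementary.
  exact/smooth_L2/smooth_partials.
exists (fun=> phi); split => // s _.
have W1 := is_weak_derivative_elementary s ephi.
have W2 := weak_derivativeP W1; have W12 := weak_derivative_unique W1 W2.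
have [[m2 _] _] := W2; have sd := smooth_partials s sphi.
apply: (@aeB_L2_cvg _ _ (fun=> partials s phi) _ _ _ _ m2 W12).
- by move=> _; exact: smooth_measurable.
- exact: smooth_measurable.
rewrite /L2_cvg (_ : (fun n => _) = fun=> 0%E); first exact: cvg_cst.
apply/funext => n; under eq_integral do rewrite subrr expr0n /=.
by rewrite integral0.
Qed.

(** The constant sequence phi approximates phi, so the strong limit of the classical components,
    which are themselves constant in the sequence, is the weak component. *)
Lemma weak_nabla_elementary m phi p o : test_function phi -> elementary phi ->
  (p <= m)%N -> o \in nabla_index p -> aeB (weak_nabla p o phi) (nabla p o phi).
Proof.
move=> tphi ephi pm oi; apply: strong_limit_cst.
have sphi := elementary_smooth ephi.
have cst0 f : smooth f -> strong_limit (fun=> f) f.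
  move=> sf; split => //; first exact: smooth_L2.
  rewrite /L2_cvg (_ : (fun n => _) = fun=> 0%E); first exact: cvg_cst.
  apply/funext => n; under eq_integral do rewrite subrr expr0n /=.
  by rewrite integral0.
apply: (@strong_limit_nabla m phi (fun=> phi)) => //; split => //.
  exact: cst0.
by move=> L _; exists (sum_partials L phi); apply: cst0; exact: smooth_sum_partials.
Qed.

Lemma Rintegral_sum (T : Type) (r : seq T) (F : T -> V -> R) :
  (forall a, intB (F a)) ->
  I (fun x => \sum_(a <- r) F a x) = \sum_(a <- r) I (F a).
Proof.
move=> HF; suff : intB (fun x => \sum_(a <- r) F a x) /\
  I (fun x => \sum_(a <- r) F a x) = \sum_(a <- r) I (F a) by case.
elim: r => [|a r [IH1 IH2]].
  rewrite (_ : (fun x => \sum_(a <- [::]) F a x) = fun=> 0); last first.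
    by apply/funext => x; rewrite big_nil.
  rewrite big_nil Rintegral_cst// mul0r; split => //.
  by apply: bounded_integrable; [exact: measurable_cst|exists 0 => x _; rewrite normr0].
rewrite (_ : (fun x => \sum_(b <- a :: r) F b x) =
   (fun x => F a x + \sum_(b <- r) F b x)); last first.
  by apply/funext => x; rewrite big_cons.
rewrite big_cons RintegralD// IH2; split => //.
exact: (integrableD mB (HF a) IH1).
Qed.

Lemma elementary_iter_laplacian j f : elementary f -> elementary (iter j (@laplacian R d) f).
Proof. by move=> ef; elim: j => //= j; exact: elementary_laplacian. Qed.

Lemma elementary_nabla p o f : elementary f -> elementary (nabla p o f).
Proof.
move=> ef; rewrite /nabla; case: o => [i|]; last exact: elementary_iter_laplacian.
exact/elementary_partial/elementary_iter_laplacian.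
Qed.

Lemma laplacian_partial i f : elementary f ->
  laplacian (partial i f) = partial i (laplacian f).
Proof.
move=> ef; have := @partial_sum R d i _ (index_enum 'I_d) (fun j => partial j (partial j f)).
move=> [|_]; first by move=> j; do 2 apply: elementary_partial.
rewrite /laplacian => ->; apply/funext => x; apply: eq_bigr => j _.
have ej := elementary_partial j ef.
by rewrite (elementary_partialC j i ef) (elementary_partialC j i ej).
Qed.

Lemma iter_laplacian_partial j i f : elementary f ->
  iter j (@laplacian R d) (partial i f) = partial i (iter j (@laplacian R d) f).
Proof.
move=> ef; elim: j => //= j ->; apply: laplacian_partial.
exact: elementary_iter_laplacian.
Qed.

Lemma nabla_nabla p f x : elementary f ->
  \sum_(o <- nabla_index p) nabla p o (nabla p o f) x = iter p (@laplacian R d) f x.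
Proof.
move=> ef; have ej := elementary_iter_laplacian p./2 ef.
rewrite /nabla_index /nabla; case: ifP => op.
  rewrite big_map -[in RHS](odd_double_half p) op -addnn !iterD /=.
  rewrite /laplacian; apply: eq_bigr => i _.
  by rewrite iter_laplacian_partial.
by rewrite big_seq1 -iterD addnn -[in RHS](odd_double_half p) op.
Qed.

(** There is no boundary term although f is arbitrary on the sphere: the identity holds for the test
    functions approximating u and passes to the limit. This is how the Dirichlet conditions on u
    enter. *)
Lemma nabla_by_parts m u p o f : sobolev0 m u -> (p <= m)%N -> o \in nabla_index p ->
  elementary f ->
  I (fun x => weak_nabla p o u x * nabla p o f x) =
  (-1) ^+ p * I (fun x => u x * nabla p o (nabla p o f) x).
Proof.
move=> Su pm oi ef; have [psi Ha] := sobolev0_approximated Su.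
have [sg Lw gw] := strong_limit_nabla Ha pm oi.
have [tpsi [_ Lu uw] _] := Ha; have spsi k := approximated_smooth k Ha.
have [L HL EL] := nabla_sum oi.
have eh := elementary_nabla p o ef; have sh := elementary_smooth eh.
have sh2 := elementary_smooth (elementary_nabla p o eh).
have C1 := L2_cvg_Rintegral (fun k => smooth_L2 (sg k)) Lw gw
  (smooth_measurable sh) (smooth_bounded sh).
have C2 := L2_cvg_Rintegral (fun k => smooth_L2 (spsi k)) Lu uw
  (smooth_measurable sh2) (smooth_bounded sh2).
have {}C2 : (fun k => (-1) ^+ p * I (fun x => psi k x * nabla p o (nabla p o f) x)) @ \oo -->
    (-1) ^+ p * I (fun x => u x * nabla p o (nabla p o f) x) by apply: cvgMr.
rewrite -(cvg_lim _ C1)// -(cvg_lim _ C2)//; apply: (congr1 (fun F : nat -> R => lim (F @ \oo))).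
apply/funext => k; rewrite (EL _ (spsi k)) (EL _ sh).
exact: sum_partials_by_parts.
Qed.

Lemma cvg_sum_seq (T : Type) (r : seq T) (Q : pred T) (F : T -> nat -> R) (l : T -> R) :
  (forall a, Q a -> F a @ \oo --> l a) ->
  (fun n => \sum_(a <- r | Q a) F a n) @ \oo --> \sum_(a <- r | Q a) l a.
Proof.
move=> H; elim: r => [|a r IH].
  by under eq_fun do rewrite big_nil; rewrite big_nil; exact: cvg_cst.
under eq_fun do rewrite big_cons; rewrite big_cons.
by case: ifP => // Qa; apply: cvgD => //; exact: H.
Qed.

Lemma sum_partials_cutoff_bounded m L P : (forall s, s \in L -> (size s <= m)%N) ->
  polynomial_fun P ->
  exists C : R, forall n x, B x -> `|sum_partials L (cutoff_fun m n P) x| <= C.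
Proof.
move=> HL HP; elim: L HL => [|s L IH] HL.
  by exists 0 => n x _; rewrite /sum_partials big_nil normr0.
have [|C HC] := IH; first by move=> r rL; apply: HL; rewrite in_cons rL orbT.
have [D HD] := partials_cutoff_bounded (HL s (mem_head _ _)) HP.
exists (D + C) => n x Bx; rewrite sum_partials_cons.
by apply: le_trans (ler_normD _ _) _; apply: lerD; [exact: HD|exact: HC].
Qed.

Lemma sum_partials_cutoff_cvg m L P x : (forall s, s \in L -> (size s <= m)%N) ->
  polynomial_fun P -> B x ->
  (fun n => sum_partials L (cutoff_fun m n P) x) @ \oo -->
  sum_partials L (fun x => (1 - sqnorm x) ^+ m * P x) x.
Proof.
move=> HL HP Bx; rewrite /sum_partials big_seq.
under eq_fun do rewrite big_seq.
by apply: cvg_sum_seq => s sL; apply: partials_cutoff_cvg => //; exact: HL.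
Qed.

(** On a cut-off the weak components of nabla^p are the classical ones almost everywhere. As p <= m,
    these converge boundedly to those of (1 - |x|^2)^m P, so dominated convergence applies against
    the components of u, and [nabla_by_parts] then moves all derivatives to the polynomial. *)
Lemma energy_cutoff m u p P : sobolev0 m u -> (p <= m)%N -> polynomial_fun P ->
  (fun n => I (fun x => nabla_dot p u (cutoff_fun m n P) x)) @ \oo -->
  (-1) ^+ p *
    I (fun x => u x * iter p (@laplacian R d) (fun x => (1 - sqnorm x) ^+ m * P x) x).
Proof.
move=> Su pm HP; set Phi := fun x => _ * P x.
have ePhi : elementary Phi.
  apply/polynomial_elementary/polynomialM => //; apply: polynomialX.
  rewrite (_ : (fun x => _) = (fun x => 1 + (-1) * sqnorm x)).
    apply: polynomialD; first exact: polynomial_cst.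
    by apply: polynomialM; [exact: polynomial_cst|exact: polynomial_sqnorm].
  by apply/funext => x; rewrite mulN1r.
have eP := polynomial_elementary HP.
have [psi Ha] := sobolev0_approximated Su.
have Lu o : o \in nabla_index p -> L2_ball (weak_nabla p o u).
  by move=> oi; have [] := strong_limit_nabla Ha pm oi.
(* Extended by 0 outside the list of components, so that integrability holds for every index, as
   [Rintegral_sum] requires. *)
pose W o := if o \in nabla_index p then weak_nabla p o u else fun=> 0.
have LW o : L2_ball (W o).
  by rewrite /W; case: ifP => [/Lu//|_]; exact/smooth_L2/smooth_cst.
pose phi n := cutoff_fun m n P.
have ephi n : elementary (phi n) by exact: elementary_cutoff.
have tphi n : test_function (phi n) by exact: test_function_cutoff.
have sn n o := elementary_smooth (elementary_nabla p o (ephi n)).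
have E1 n : I (fun x => nabla_dot p u (phi n) x) =
    \sum_(o <- nabla_index p) I (fun x => W o x * nabla p o (phi n) x).
  rewrite -Rintegral_sum; last by move=> o; apply: L2_ballM => //; exact: smooth_L2 (sn n o).
  have Sphi := sobolev0_elementary m (tphi n) (ephi n).
  have [psin Hn] := sobolev0_approximated Sphi.
  have Lphi o : o \in nabla_index p -> L2_ball (weak_nabla p o (phi n)).
    by move=> oi; have [] := strong_limit_nabla Hn pm oi.
  pose W' o := if o \in nabla_index p then weak_nabla p o (phi n) else fun=> 0.
  have LW' o : L2_ball (W' o).
    by rewrite /W'; case: ifP => [/Lphi//|_]; exact/smooth_L2/smooth_cst.
  transitivity (I (fun x => \sum_(o <- nabla_index p) W o x * W' o x)).
    apply: eq_Rintegral => x _; rewrite nabla_dotE big_seq [RHS]big_seq.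
    by apply: eq_bigr => o oi; rewrite /W /W' oi.
  apply: aeB_Rintegral.
  - apply: measurable_sum => o; apply: measurable_funM; [by case: (LW o)|by case: (LW' o)].
  - apply: measurable_sum => o; apply: measurable_funM; first by case: (LW o).
    exact: smooth_measurable (sn n o).
  - have : {ae mu, forall x, forall o, B x -> o \in nabla_index p ->
        W' o x = nabla p o (phi n) x}.
      apply: filter_forall => o; have [oi|oi] := boolP (o \in nabla_index p).
        have := weak_nabla_elementary (tphi n) (ephi n) pm oi.
        by rewrite /W' oi; apply: filterS => x H Bx _; exact: H.
      by apply: aeW => x _.
    apply: filterS => x Hx Bx; rewrite big_seq [RHS]big_seq; apply: eq_bigr => o oi.
    by rewrite (Hx o Bx oi).
have E2 : (-1) ^+ p * I (fun x => u x * iter p (@laplacian R d) Phi x) =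
    \sum_(o <- nabla_index p) I (fun x => W o x * nabla p o Phi x).
  have -> : \sum_(o <- nabla_index p) I (fun x => W o x * nabla p o Phi x) =
     \sum_(o <- nabla_index p) (-1) ^+ p * I (fun x => u x * nabla p o (nabla p o Phi) x).
    rewrite big_seq [in RHS]big_seq; apply: eq_bigr => o oi.
    by rewrite -(nabla_by_parts Su pm oi ePhi) /W oi.
  rewrite -mulr_sumr -Rintegral_sum; last first.
    move=> o; have eo := elementary_smooth (elementary_nabla p o (elementary_nabla p o ePhi)).
    apply: L2_ballM; last exact: smooth_L2 eo.
    by case: Su => [[]].
  congr (_ * _); apply: eq_Rintegral => x _.
  by rewrite -mulr_sumr nabla_nabla.
rewrite E2; under eq_fun do rewrite E1.
rewrite (_ : (fun n => _) = (fun n => \sum_(o <- nabla_index p | o \in nabla_index p)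
    I (fun x => W o x * nabla p o (phi n) x))); last first.
  by apply/funext => n; rewrite big_seq.
rewrite big_seq; apply: cvg_sum_seq => o oi.
have [L HL EL] := nabla_sum oi.
have HLm s : s \in L -> (size s <= m)%N by move=> /HL ->.
have sPhi := elementary_smooth ePhi.
have [C HC] := sum_partials_cutoff_bounded HLm HP.
suff [_] : intB (fun x => W o x * nabla p o Phi x) /\
  (fun n => I (fun x => W o x * nabla p o (phi n) x)) @ \oo -->
    I (fun x => W o x * nabla p o Phi x) by [].
apply: (@Rintegral_dominated _ _ _ _ (fun x => `|W o x| * C)).
- by move=> n; apply: measurable_funM; [case: (LW o)|exact: smooth_measurable (sn n o)].
- move=> x Bx; apply: cvgMr; rewrite (EL _ sPhi).
  under eq_fun do rewrite (EL _ (elementary_smooth (ephi _))).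
  by apply: sum_partials_cutoff_cvg.
- apply: (@integrable_boundedM R d (fun x => `|W o x|) (fun=> C)).
  + by apply: integrable_norm; exact: L2_ball_integrable (LW o).
  + exact: measurable_cst.
  + by exists `|C|.
- move=> n x Bx; rewrite normrM ler_wpM2l//.
  by rewrite (EL _ (elementary_smooth (ephi n))); exact: HC.
Qed.

(** A sum of squares with nonpositive integral has all its terms zero almost everywhere. The
    conclusion covers every elementary f, with no condition on the sphere, since [nabla_by_parts]
    imposes none. *)
Lemma energy_eq0 m u f : sobolev0 m u -> I (fun x => nabla_dot m u u x) <= 0 ->
  elementary f -> I (fun x => u x * iter m (@laplacian R d) f x) = 0.
Proof.
move=> Su H ef; have [psi Ha] := sobolev0_approximated Su.
have Lu o : o \in nabla_index m -> L2_ball (weak_nabla m o u).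
  by move=> oi; have [] := strong_limit_nabla Ha (leqnn m) oi.
pose W o := if o \in nabla_index m then weak_nabla m o u else fun=> 0.
have LW o : L2_ball (W o).
  by rewrite /W; case: ifP => [/Lu//|_]; exact/smooth_L2/smooth_cst.
have W0 o : o \in nabla_index m -> I (fun x => W o x ^+ 2) = 0.
  move=> oi; apply/eqP; rewrite eq_le; apply/andP; split; last first.
    by apply: Rintegral_ge0 => x _; exact: sqr_ge0.
  apply: le_trans H; rewrite [leRHS](_ : _ = I (fun x => \sum_(o <- nabla_index m) W o x ^+ 2)).
    rewrite Rintegral_sum; last by move=> a; have [] := LW a.
    rewrite (big_rem _ oi) /= lerDl sumr_ge0// => a _.
    by apply: Rintegral_ge0 => x _; exact: sqr_ge0.
  apply: eq_Rintegral => x _; rewrite nabla_dotE big_seq [RHS]big_seq.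
  by apply: eq_bigr => a ai; rewrite /W ai expr2.
have Lu0 : L2_ball u by case: Su => [[]].
have ej o := elementary_smooth (elementary_nabla m o (elementary_nabla m o ef)).
have -> : I (fun x => u x * iter m (@laplacian R d) f x) =
    \sum_(o <- nabla_index m) I (fun x => u x * nabla m o (nabla m o f) x).
  rewrite -Rintegral_sum; last by move=> o; apply: L2_ballM => //; exact: smooth_L2 (ej o).
  by apply: eq_Rintegral => x _; rewrite -mulr_sumr nabla_nabla.
rewrite big_seq big1// => o oi.
have en := elementary_smooth (elementary_nabla m o ef).
have : (-1) ^+ m * I (fun x => u x * nabla m o (nabla m o f) x) = 0.
  rewrite -(nabla_by_parts Su (leqnn m) oi ef).
  rewrite (@aeB_Rintegral _ _ _ (fun=> 0)).
  - by rewrite Rintegral_cst// mul0r.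
  - by apply: measurable_funM; [case: (Lu o oi)|exact: smooth_measurable en].
  - exact: measurable_cst.
  - have := L2_eq0 (LW o) (W0 o oi); rewrite /W oi.
    by apply: filterS => x Hx Bx; rewrite (Hx Bx) mul0r.
move=> /eqP; rewrite mulf_eq0 => /orP[|/eqP//].
by rewrite expf_eq0 oppr_eq0 oner_eq0 andbF.
Qed.

End energy.

(** * Bessel series *)

Section gamma_recursion.
Variable R : realType.
Local Notation leb := (@lebesgue_measure R).

Definition gamma_integrand (s x : R) : R := x `^ (s - 1) * expR (- x).

Lemma gamma_integrand_continuous s (x : R) : 0 < x -> {for x, continuous (gamma_integrand s)}.
Proof.
move=> x0; apply: (@continuousM _ _ (fun x => x `^ (s - 1)) (fun x => expR (- x))).
  apply: differentiable_continuous; apply/derivable1_diffP.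
  by have [] := is_derive1_powR (s - 1) x0.
apply: continuous_comp; first exact: opp_continuous.
exact: continuous_expR.
Qed.

Lemma gamma_integrand_ge0 s (x : R) : 0 <= gamma_integrand s x.
Proof. by rewrite mulr_ge0 ?powR_ge0 ?expR_ge0. Qed.

(** Compact intervals exhausting ]0, +oo[, away from a possible singularity at 0; starting at 2
    keeps them nondegenerate for n = 0. *)
Let J (n : nat) : set R := `[n.+2%:R^-1, n.+2%:R].

Let n2_gt1 n : 1 < n.+2%:R :> R.
Proof. by rewrite ltr1n. Qed.

Let Jlt n : n.+2%:R^-1 < n.+2%:R :> R.
Proof. by apply: (@lt_trans _ _ 1); rewrite ?invf_lt1 ?n2_gt1. Qed.

Let Jpos n (x : R) : J n x -> 0 < x.
Proof.
by rewrite /J /= in_itv /= => /andP[+ _]; apply: lt_le_trans; rewrite invr_gt0.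
Qed.

Lemma gamma_integrand_truncated s n : 0 < s ->
  (\int[leb]_(x in J n) (gamma_integrand (s + 1) x)%:E =
   (n.+2%:R^-1 `^ s * expR (- n.+2%:R^-1) - n.+2%:R `^ s * expR (- n.+2%:R))%:E +
   s%:E * \int[leb]_(x in J n) (gamma_integrand s x)%:E)%E.
Proof.
move=> s0.
have d1 (x : R) : 0 < x -> is_derive x 1 (fun x => x `^ s) (s * x `^ (s - 1)).
  by move=> x0; exact: is_derive1_powR.
have d2 (x : R) : is_derive x 1 (fun x => - expR (- x)) (expR (- x)).
  have H : is_derive x 1 (fun x : R => - x) (- 1) by exact: is_deriveNid.
  have := is_deriveN (@is_derive1_comp _ expR (fun x : R => - x) x _ _ (is_derive_expR (- x)) H).
  by apply: is_derive_ext => //; rewrite mulrN1 opprK.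
have cts (f : R -> R) : (forall x, J n x -> {for x, continuous f}) ->
    {within `[n.+2%:R^-1, n.+2%:R], continuous f}.
  by move=> H; apply: continuous_in_subspaceT => x; rewrite inE => /H.
have dLR (F : R -> R) : (forall x : R, 0 < x -> derivable F x 1) ->
    derivable_oo_LRcontinuous F (n.+2%:R^-1) (n.+2%:R).
  move=> dF; split.
  - move=> x; rewrite in_itv /= => /andP[ax _]; apply: dF.
    by apply: lt_trans ax; rewrite invr_gt0.
  - apply: cvg_at_right_filter; apply: differentiable_continuous.
    by apply/derivable1_diffP/dF; rewrite invr_gt0.
  - apply: cvg_at_left_filter; apply: differentiable_continuous.
    by apply/derivable1_diffP/dF.
have := @integration_by_parts R (fun x => x `^ s) (fun x => - expR (- x))
  (fun x => s * x `^ (s - 1)) (fun x => expR (- x)) n.+2%:R^-1 n.+2%:R (Jlt n).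
have -> : (\int[leb]_(x in `[(n.+2%:R^-1)%R, n.+2%:R]) (x `^ s * expR (- x))%:E =
    \int[leb]_(x in J n) (gamma_integrand (s + 1) x)%:E)%E.
  by apply: eq_integral => x _; rewrite /gamma_integrand addrK.
have -> : (\int[leb]_(x in `[(n.+2%:R^-1)%R, n.+2%:R]) (s * x `^ (s - 1) * - expR (- x))%:E =
    (- s)%:E * \int[leb]_(x in J n) (gamma_integrand s x)%:E)%E.
  rewrite -integralZl//.
  - by apply: eq_integral => x _; rewrite -EFinM /gamma_integrand; congr EFin; ring.
  - exact: measurable_itv.
  - apply: continuous_compact_integrable; first exact: segment_compact.
    by apply: cts => x /Jpos x0; exact: gamma_integrand_continuous.
move=> -> //.
- by rewrite EFinN mulNe oppeK; congr ((_)%:E + _)%E; ring.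
- apply: cts => x /Jpos x0; apply: continuousM; first exact: cst_continuous.
  apply: differentiable_continuous; apply/derivable1_diffP.
  by have [] := is_derive1_powR (s - 1) x0.
- by apply: dLR => x /d1[].
- move=> x; rewrite in_itv /= => /andP[ax _].
  have x0 : 0 < x by apply: lt_trans ax; rewrite invr_gt0.
  by rewrite derive1E; have [_ ->] := d1 x x0.
- apply: cts => x _; apply: continuous_comp; first exact: opp_continuous.
  exact: continuous_expR.
- by apply: dLR => x _; have [] := d2 x.
- by move=> x _; rewrite derive1E; have [_ ->] := d2 x.
Qed.

Lemma gamma_integral_cvg s :
  (fun n => \int[leb]_(x in J n) (gamma_integrand s x)%:E)%E @ \oo -->
  (\int[leb]_(x in `]0%R, +oo[) (gamma_integrand s x)%:E)%E.
Proof.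
have UJ : `]0%R, +oo[%classic = \bigcup_n J n.
  apply/seteqP; split => [x /=|x [n _] /Jpos x0 /=]; last by rewrite in_itv /= x0.
  rewrite in_itv /= andbT => x0.
  exists (maxn (Num.truncn x) (Num.truncn x^-1)) => //; rewrite /J /= in_itv /=.
  apply/andP; split.
    rewrite -[leRHS]invrK lef_pV2 ?posrE ?invr_gt0//.
    apply/ltW; apply: lt_le_trans (truncnS_gt _) _; rewrite ler_nat ltnW// !ltnS.
    exact: leq_maxr.
  apply/ltW; apply: lt_le_trans (truncnS_gt _) _; rewrite ler_nat ltnW// !ltnS.
  exact: leq_maxl.
have mf : measurable_fun (`]0%R, +oo[%classic : set R) (gamma_integrand s).
  apply: open_continuous_measurable_fun; first exact: interval_open.
  by move=> x; rewrite inE /= in_itv /= andbT; exact: gamma_integrand_continuous.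
rewrite UJ; apply: ge0_nondecreasing_set_cvg_integral.
- move=> m n mn; apply/subsetPset => x; rewrite /J /= !in_itv /= => /andP[mx xm].
  apply/andP; split.
    by apply: le_trans mx; rewrite lef_pV2 ?posrE// ler_nat !ltnS.
  by apply: le_trans xm _; rewrite ler_nat !ltnS.
- by move=> n; exact: measurable_itv.
- move=> i; apply/measurable_EFinP; apply: measurable_funS mf => //.
  by move=> x /Jpos x0; rewrite /= in_itv /= x0.
- by move=> n x _; rewrite lee_fin gamma_integrand_ge0.
Qed.

Lemma gamma_boundary_cvg (s : R) : 0 < s ->
  (fun n => n.+2%:R^-1 `^ s * expR (- n.+2%:R^-1) - n.+2%:R `^ s * expR (- n.+2%:R))
    @ \oo --> (0 : R).
Proof.
move=> s0.
have c2 : (fun n => n.+2%:R^-1 : R) @ \oo --> (0 : R).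
  by have := @cvg_harmonic R; rewrite -cvg_shiftS; apply.
rewrite -[X in _ --> X](subr0 (0 : R)); apply: cvgB.
  rewrite -[X in _ --> X](mul0r (expR (- 0))); apply: cvgM.
    have := powR_cvg0 s0 => /cvg_at_rightP; apply; split => //.
  by apply: continuous_cvg; [exact: continuous_expR|exact: cvgN].
(* An integer above s: for x >= 1, x^s exp(-x) <= x^k exp(-x) <= (k+1)!/x. *)
pose k := (Num.truncn s).+1.
apply: (@squeeze_cvgr _ _ _ _ (fun=> 0) (fun n => k.+1`!%:R * n.+2%:R^-1)).
- near=> n; apply/andP; split; first by rewrite mulr_ge0 ?powR_ge0 ?expR_ge0.
  apply: (@le_trans _ _ (n.+2%:R ^+ k * expR (- n.+2%:R))).
    rewrite ler_wpM2r ?expR_ge0// -powR_mulrn// ler_powR ?ler1n//.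
    exact/ltW/truncnS_gt.
  rewrite ler_pdivlMr//.
  by rewrite mulrAC -exprSr; exact: exprn_expRN_le.
- exact: cvg_cst.
- by rewrite -[X in _ --> X](mulr0 (k.+1`!%:R)); apply: cvgMr.
Unshelve. all: by end_near. Qed.

Lemma GammaS (s : R) : 0 < s -> Gamma (s + 1) = s * Gamma s.
Proof.
move=> s0; rewrite /Gamma /Rintegral.
suff -> : (\int[leb]_(x in `]0%R, +oo[) (x `^ (s + 1 - 1) * expR (- x))%:E =
    s%:E * \int[leb]_(x in `]0%R, +oo[) (x `^ (s - 1) * expR (- x))%:E)%E.
  (* [Gamma] is the [fine] part of an extended integral. If that integral is infinite, both sides of
     the equation evaluate to 0. *)
  have := @integral_ge0 _ _ _ leb `]0%R, +oo[%classic (fun x => (x `^ (s - 1) * expR (- x))%:E).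
  move=> /(_ _)/=; case: (integral _ _ _) => [r| |]//= _.
    rewrite mulr_infty.
    by rewrite gtr0_sg// mul1e /= mulr0.
  by rewrite mulr_infty gtr0_sg// mul1e /= mulr0.
have H := @gamma_integral_cvg (s + 1); have H2 := @gamma_integral_cvg s.
transitivity (\int[leb]_(x in `]0%R, +oo[) (gamma_integrand (s + 1) x)%:E)%E => //.
rewrite -(cvg_lim _ H)//; apply: cvg_lim => //.
rewrite (_ : (fun n => _) = (fun n =>
   (n.+2%:R^-1 `^ s * expR (- n.+2%:R^-1) - n.+2%:R `^ s * expR (- n.+2%:R))%:E +
   s%:E * \int[leb]_(x in J n) (gamma_integrand s x)%:E)%E); last first.
  by apply/funext => n; exact: gamma_integrand_truncated.
rewrite -[X in _ --> X]add0e; apply: cvgeD.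
- by rewrite fin_num_adde_defr.
- apply: cvg_EFin; last exact: gamma_boundary_cvg.
  by near=> n.
- exact: cvgeZl.
Unshelve. all: by end_near. Qed.

End gamma_recursion.

(** * Convergence of complex series *)

Section complex_series.
Variable R : realType.
Local Open Scope complex_scope.

Lemma cvg_complex (u : nat -> R[i]) (a b : R) :
  (fun n => complex.Re (u n)) @ \oo --> a -> (fun n => complex.Im (u n)) @ \oo --> b ->
  (u : nat -> R[i]^o) @ \oo --> (a +i* b : R[i]^o).
Proof.
move=> ca cb; apply/cvgrPdist_lt => e e0.
have [er er0 ->] : exists2 r : R, 0 < r & e = r%:C.
  by case: e e0 => x y; rewrite ltcE /= => /andP[/eqP E x0]; exists x => //; congr (_ +i* _).
have er2 : 0 < er / 2 by rewrite divr_gt0.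
near=> n.
have h1 : `|a - complex.Re (u n)| < er / 2 by near: n; move/cvgrPdist_lt : ca; apply.
have h2 : `|b - complex.Im (u n)| < er / 2 by near: n; move/cvgrPdist_lt : cb; apply.
case: (u n) h1 h2 => x y /= h1 h2.
rewrite normc_def ltcR /=.
set p := a - x in h1 *; set q := b - y in h2 *.
rewrite -(@ltr_pXn2r _ 2) ?nnegrE ?sqrtr_ge0 ?ltW// sqr_sqrtr ?addr_ge0 ?sqr_ge0//.
rewrite -[p ^+ 2]real_normK ?num_real// -[q ^+ 2]real_normK ?num_real//.
have := normr_ge0 p; have := normr_ge0 q; nra.
Unshelve. all: by end_near. Qed.

(** The real and imaginary parts converge absolutely, by comparison with K exp(r), and are then
    recombined. *)
Lemma complex_series_cvg (u : nat -> R[i]) (K r : R) : 0 <= r ->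
  (forall n, Normc.normc (u n) <= K * (r ^+ n / n`!%:R)) ->
  exists l : R[i], (series (u : nat -> R[i]^o)) @ \oo --> (l : R[i]^o).
Proof.
move=> r0 H.
have cK : cvgn (series (fun n => K * (r ^+ n / n`!%:R))).
  rewrite (_ : (fun n => _) = K *: exp_coeff r); last by apply/funext => n.
  exact/is_cvg_seriesZ/is_cvg_series_exp_coeff.
have ReIm (f : R[i] -> R) : (forall z, `|f z| <= Normc.normc z) ->
    cvgn (series (fun n => f (u n))).
  move=> fn; apply: normed_cvg.
  apply: series_le_cvg cK => n.
  - by rewrite normr_ge0.
  - by apply: le_trans (H n); case: (u n) => x y /=; rewrite sqrtr_ge0.
  - exact: le_trans (fn _) (H n).
have hRe : forall z : R[i], `|complex.Re z| <= Normc.normc z.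
  by case=> x y /=; rewrite -sqrtr_sqr ler_wsqrtr// lerDl sqr_ge0.
have hIm : forall z : R[i], `|complex.Im z| <= Normc.normc z.
  by case=> x y /=; rewrite -sqrtr_sqr ler_wsqrtr// lerDr sqr_ge0.
have /cvg_ex[/= a ca] := ReIm _ hRe; have /cvg_ex[/= b cb] := ReIm _ hIm.
exists (a +i* b); apply: cvg_complex.
- rewrite (_ : (fun n => _) = series (fun n => complex.Re (u n)))//.
  by apply/funext => n; rewrite /series /= raddf_sum.
- rewrite (_ : (fun n => _) = series (fun n => complex.Im (u n)))//.
  by apply/funext => n; rewrite /series /= raddf_sum.
Qed.

Lemma csum_cvg (u : nat -> R[i]) (K r : R) : 0 <= r ->
  (forall n, Normc.normc (u n) <= K * (r ^+ n / n`!%:R)) ->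
  (series (u : nat -> R[i]^o)) @ \oo --> (csum u : R[i]^o).
Proof.
move=> r0 H; have [l Hl] := complex_series_cvg r0 H.
by rewrite /csum (cvg_lim _ Hl).
Qed.

End complex_series.

(** * Bessel series in the variable (z/2)^2 *)

Section bessel_series.
Variable R : realType.
Local Open Scope complex_scope.
Local Notation C := (R[i]^o).
Implicit Types (nu : R) (w : R[i]).

(** With w = (z/2)^2 these are the terms of (z/2)^(1 - nu) J_(nu - 1)(z). In the variable w the
    series has no fractional power. *)
Definition bessel_term nu w (j : nat) : R[i] :=
  ((-1) ^+ j / (j`!%:R * Gamma (j%:R + nu)))%:C * w ^+ j.

Definition bessel_sum nu w : R[i] := csum (bessel_term nu w).

Lemma invGammaS nu : 0 < nu -> (Gamma nu)^-1 = nu / Gamma (nu + 1).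
Proof. by move=> n0; rewrite GammaS// invfM mulrA mulfV ?mul1r// gt_eqF. Qed.

(** From k = 1 on, the argument k + nu is at least 1, so by the functional equation |1/Gamma| does
    not increase. The first step, from nu to nu + 1, can go either way, hence the two summands in
    the bound. *)
Lemma invGamma_bounded nu : 0 < nu ->
  exists2 K : R, 0 <= K & forall k : nat, `|(Gamma (k%:R + nu))^-1| <= K.
Proof.
move=> n0; pose g (k : nat) := `|(Gamma (k%:R + nu))^-1|.
have g0 k : 0 <= g k by exact: normr_ge0.
exists (g 0%N + g 1%N); first exact: addr_ge0.
elim=> [|[|k] IH].
- by rewrite -/(g 0%N) lerDl.
- by rewrite -/(g 1%N) lerDr.
- apply: le_trans IH; rewrite (@invGammaS (k.+1%:R + nu)); last by rewrite ltr_wpDl.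
  rewrite (_ : k.+1%:R + nu + 1 = k.+2%:R + nu); last by rewrite addrAC natr1.
  rewrite normrM ler_peMl// ger0_norm; last by rewrite addr_ge0// ltW.
  by rewrite -natr1 -addrA addrCA lerDl addr_ge0// ltW.
Qed.

Lemma normc_real (x : R) : Normc.normc x%:C = `|x|.
Proof. by rewrite /= expr0n /= addr0 sqrtr_sqr. Qed.

Lemma normcX w n : Normc.normc (w ^+ n) = Normc.normc w ^+ n.
Proof.
elim: n => [|n IH]; first by rewrite !expr0 Normc.normc1.
by rewrite !exprS Normc.normcM IH.
Qed.

Lemma normc_ge0 w : 0 <= Normc.normc w.
Proof. by case: w => x y /=; exact: sqrtr_ge0. Qed.

Lemma bessel_term_bound nu w : 0 < nu -> exists2 K : R, 0 <= K &
  forall n, Normc.normc (bessel_term nu w n) <= K * (Normc.normc w ^+ n / n`!%:R).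
Proof.
move=> n0; have [K K0 HK] := invGamma_bounded n0; exists K => // n.
rewrite /bessel_term Normc.normcM normc_real normcX invfM !normrM normrX normrN1 expr1n mul1r.
rewrite [`|n`!%:R^-1|]ger0_norm; last by rewrite invr_ge0.
rewrite [leRHS]mulrCA mulrC ler_wpM2l ?exprn_ge0 ?normc_ge0//.
by rewrite mulrC ler_wpM2r ?invr_ge0// HK.
Qed.

Lemma bessel_term_cvg nu w : 0 < nu ->
  (series (bessel_term nu w : nat -> C)) @ \oo --> (bessel_sum nu w : C).
Proof.
move=> n0; have [K K0 HK] := bessel_term_bound w n0.
exact: csum_cvg (normc_ge0 w) HK.
Qed.

Lemma bessel_termS nu w k : 0 < nu ->
  bessel_term nu w k.+1 * (k.+1%:R * (k%:R + nu))%:C = - w * bessel_term nu w k.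
Proof.
move=> n0; rewrite /bessel_term [w ^+ k.+1]exprS mulrAC -rmorphM /=.
have -> : (-1) ^+ k.+1 / (k.+1`!%:R * Gamma (k.+1%:R + nu)) * (k.+1%:R * (k%:R + nu)) =
    - ((-1) ^+ k / (k`!%:R * Gamma (k%:R + nu))) :> R.
  have kn : 0 < k%:R + nu by rewrite ltr_wpDl.
  have := invGammaS kn; rewrite addrAC natr1 => E.
  rewrite [(k`!%:R * _)^-1]invfM E invfM factS natrM invfM exprS mulN1r.
  have k0 : k.+1%:R != 0 :> R by rewrite pnatr_eq0.
  move: k0 (_ ^+ k) (_ `!%:R^-1) (Gamma _)^-1 => k0 a b c.
  by field.
by rewrite rmorphN /=; ring.
Qed.

Lemma bessel_term_binomial nu w q j : 'C(j + q, q)%:R * bessel_term nu w (j + q) =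
  ((q`!%:R)^-1)%:C * (- w) ^+ q * bessel_term (q%:R + nu) w j.
Proof.
rewrite /bessel_term [(- w) ^+ q]exprNn [w ^+ (j + q)]exprD.
have E : ('C(j + q, q)%:R : R) / (j + q)`!%:R = (q`!%:R * j`!%:R)^-1.
  have := bin_fact (leq_addl j q); rewrite addnK => /(congr1 (fun n => n%:R : R)).
  rewrite !natrM => <-.
  have f n : (n`!%:R : R) != 0 by rewrite pnatr_eq0 -lt0n fact_gt0.
  by field; rewrite !f pnatr_eq0 -lt0n bin_gt0 leq_addl.
have -> : ('C(j + q, q)%:R : R[i]) = ('C(j + q, q)%:R : R)%:C by rewrite rmorph_nat.
have -> : (-1) ^+ q = ((-1) ^+ q : R)%:C by rewrite rmorphXn rmorphN rmorph1.
rewrite mulrA -rmorphM /=.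
have -> : 'C(j + q, q)%:R * ((-1) ^+ (j + q) / ((j + q)`!%:R * Gamma ((j + q)%:R + nu))) =
   q`!%:R^-1 * (-1) ^+ q * ((-1) ^+ j / (j`!%:R * Gamma (j%:R + (q%:R + nu)))) :> R.
  rewrite natrD -addrA !invfM exprD.
  rewrite [LHS](_ : _ = ('C(j + q, q)%:R / (j + q)`!%:R) *
    ((-1) ^+ j * (-1) ^+ q * (Gamma (j%:R + (q%:R + nu)))^-1)); last by ring.
  by rewrite E invfM; ring.
by rewrite !rmorphM /=; ring.
Qed.

Lemma complex_cvg_unique (f : nat -> C) (a b : C) :
  f @ \oo --> a -> f @ \oo --> b -> a = b.
Proof. by apply: cvg_unique; exact: norm_hausdorff. Qed.

Lemma cvg_big (T : Type) (r : seq T) (F : T -> nat -> C) (l : T -> C) :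
  (forall a, F a @ \oo --> l a) ->
  (fun n => \sum_(a <- r) F a n : C) @ \oo --> (\sum_(a <- r) l a : C).
Proof.
move=> H; elim: r => [|a r IH].
  by under eq_fun do rewrite big_nil; rewrite big_nil; exact: cvg_cst.
under eq_fun do rewrite big_cons; rewrite big_cons.
exact: (cvgD (H a) IH).
Qed.

Lemma sum_split_shift (q n : nat) (F : nat -> R[i]) : (forall k, (k < q)%N -> F k = 0) ->
  \sum_(0 <= k < n + q) F k = \sum_(0 <= k < n) F (k + q)%N.
Proof.
move=> H; rewrite (big_cat_nat (n := q)) ?leq_addl//= big_nat big1 ?add0r.
  by rewrite -{1}[q]add0n big_addn addnK.
by move=> k /andP[_ kq]; exact: H.
Qed.

(** The limit is the q-th Taylor coefficient at X = 1 of sum a_k X^k, where a_k is the Bessel term.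
    Each differentiation multiplies the series by -w and raises nu by one. *)
Lemma bessel_binomial_cvg nu w q : 0 < nu ->
  (fun n => \sum_(0 <= k < n) 'C(k, q)%:R * bessel_term nu w k : C) @ \oo -->
  (((q`!%:R)^-1)%:C * (- w) ^+ q * bessel_sum (q%:R + nu) w : C).
Proof.
move=> n0; have nq : 0 < q%:R + nu by rewrite ltr_wpDl.
rewrite -(cvg_shiftn q).
rewrite (_ : (fun n => _) = (fun n => (((q`!%:R)^-1)%:C * (- w) ^+ q) *
   series (bessel_term (q%:R + nu) w : nat -> C) n)).
  apply: (@cvgMr _ _ _ _ (series (bessel_term (q%:R + nu) w : nat -> C))).
  exact: bessel_term_cvg.
apply/funext => n; rewrite sum_split_shift; last first.
  by move=> k kq; rewrite bin_small// mul0r.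
by rewrite /series /= mulr_sumr; apply: eq_bigr => k _; rewrite bessel_term_binomial.
Qed.

End bessel_series.

(** * The laplacian on radial multiples of a harmonic polynomial *)

Section radial_operator.
Variables (R : realType) (d l : nat).
Hypothesis d0 : (0 < d)%N.
Implicit Types (p q : {poly R}).
Local Notation nu := (l%:R + d%:R / 2 : R).

(* Delta (p(|x|^2) h) = (radial_laplacian p)(|x|^2) h for h harmonic and
   homogeneous of degree l. *)
Definition radial_laplacian p : {poly R} :=
  4%:P * 'X * p^`()^`() + (2 * (d + l.*2)%:R) *: p^`().

Local Notation D := radial_laplacian.

Lemma nu_gt0 : 0 < nu.
Proof. by rewrite ltr_wpDl// divr_gt0// ltr0n. Qed.

Lemma radial_laplacian_linear (a : R) p q : D (a *: p + q) = a *: D p + D q.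
Proof. by rewrite /D !derivD !derivZ !scalerDr -!mul_polyC; ring. Qed.

Lemma iter_radial_linear j (a : R) p q : iter j D (a *: p + q) = a *: iter j D p + iter j D q.
Proof. by elim: j => //= j ->; rewrite radial_laplacian_linear. Qed.

Lemma radial_laplacian0 : D 0 = 0.
Proof. by rewrite /D !deriv0 mulr0 scaler0 addr0. Qed.

Lemma iter_radial0 j : iter j D 0 = 0.
Proof. by elim: j => //= j ->; exact: radial_laplacian0. Qed.

Lemma radial_laplacianXn k :
  D ('X^(k.+1)) = (4 * (k.+1%:R * (k%:R + nu))) *: 'X^k :> {poly R}.
Proof.
rewrite /D derivXn derivMn derivXn /=.
have -> : 4%:P * 'X * ('X^(k.-1) *+ k *+ k.+1) = (4 * k.+1%:R * k%:R) *: 'X^k :> {poly R}.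
  case: k => [|k]; first by rewrite mulr0n mul0rn !mulr0 scale0r.
  rewrite /= exprS -[_ *+ k.+2]mulr_natl -[_ *+ k.+1]mulr_natl -!mul_polyC.
  by rewrite !polyCM !polyC_natr; ring.
rewrite -['X^k *+ _]scaler_nat scalerA -scalerDl; congr (_ *: _).
by rewrite natrD -muln2 natrM; field.
Qed.

Lemma size_radial_laplacian p : (size (D p) <= (size p).-1)%N.
Proof.
apply: leq_trans (size_polyD _ _) _; rewrite geq_max; apply/andP; split.
  rewrite -mulrA mul_polyC; apply: leq_trans (size_scale_leq _ _) _.
  have [->|p2] := eqVneq (p^`()^`()) 0; first by rewrite mulr0 size_poly0.
  rewrite mulrC size_mulX//.
  have p1 : p^`() != 0 by apply: contra_neq p2 => ->; rewrite deriv0.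
  have p0 : p != 0 by apply: contra_neq p1 => ->; rewrite deriv0.
  apply: leq_trans (lt_size_deriv p1) _.
  by rewrite -ltnS prednK ?size_poly_gt0//; exact: lt_size_deriv.
apply: leq_trans (size_scale_leq _ _) _.
have [->|p0] := eqVneq p 0; first by rewrite deriv0 size_poly0.
by rewrite -ltnS prednK ?size_poly_gt0//; exact: lt_size_deriv.
Qed.

Lemma iter_radial_small j p : (size p <= j)%N -> iter j D p = 0.
Proof.
elim: j p => [|j IH] p; first by rewrite leqn0 size_poly_eq0 => /eqP ->.
move=> pj; rewrite iterSr IH//; apply: leq_trans (size_radial_laplacian _) _.
by rewrite -ltnS; case: (size p) pj.
Qed.

Definition radial_coef j k : R := \prod_(i < j) (4 * ((k + i).+1%:R * ((k + i)%:R + nu))).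

(** Being nonzero, these coefficients can be divided out, to return from the form composed with
    powers of D to the moments themselves. *)
Lemma radial_coef_gt0 j k : 0 < radial_coef j k.
Proof.
apply: prodr_gt0 => i _; rewrite !mulr_gt0//.
by rewrite ltr_wpDl// nu_gt0.
Qed.

Lemma iter_radialXn j k : iter j D ('X^(k + j)) = radial_coef j k *: 'X^k :> {poly R}.
Proof.
elim: j => [|j IH]; first by rewrite /radial_coef big_ord0 scale1r addn0.
rewrite iterSr addnS radial_laplacianXn.
have := iter_radial_linear j (4 * ((k + j).+1%:R * ((k + j)%:R + nu))) 'X^(k + j) 0.
rewrite iter_radial0 !addr0 => ->.
by rewrite IH scalerA /radial_coef big_ord_recr /= mulrC.
Qed.

(** The formal series f = sum a_k X^k satisfies D f = -4 w f; this is the identity D^j f = (-4 w)^j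
    f read coefficient by coefficient. *)
Lemma bessel_term_radial (w : R[i]) j k :
  bessel_term nu w (k + j) * (radial_coef j k)%:C%C =
  (- (4 * w)) ^+ j * bessel_term nu w k.
Proof.
elim: j => [|j IH]; first by rewrite /radial_coef big_ord0 addn0 expr0 mulr1 mul1r.
rewrite /radial_coef big_ord_recr /= -/(radial_coef j k) addnS.
have := bessel_termS w (k + j) nu_gt0.
rewrite [4 * _]mulrC; set z := (k + j).+1%:R * _ => E.
clearbody z.
have -> : (radial_coef j k * (z * 4))%:C%C = (radial_coef j k)%:C%C * (z%:C%C * 4).
  by rewrite !rmorphM rmorph_nat.
rewrite exprS -mulrA -IH.
rewrite [LHS](_ : _ = 4 * (bessel_term nu w (k + j).+1 * z%:C%C) *
  (radial_coef j k)%:C%C); last by ring.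
by rewrite E; ring.
Qed.

Section functional.
Variable F : {poly R} -> R.
Hypothesis F_linear : forall (a : R) p q, F (a *: p + q) = a * F p + F q.

Let F0 : F 0 = 0.
Proof. by have := F_linear (-1) 0 0; rewrite scaler0 addr0 mulN1r addNr. Qed.

Let FZ a p : F (a *: p) = a * F p.
Proof. by have := F_linear a p 0; rewrite addr0 F0 addr0. Qed.

Lemma linear_form_sum n (G : 'I_n -> {poly R}) :
  F (\sum_(i < n) G i) = \sum_(i < n) F (G i).
Proof.
elim: n G => [|n IH] G; first by rewrite !big_ord0 F0.
by rewrite !big_ord_recl -[G ord0]scale1r F_linear mul1r IH scale1r.
Qed.

(* Expand 'X^k = (1 + ('X - 1))^k. *)
Lemma linear_form_binomial m : (forall q, F ((1 - 'X) ^+ m * q) = 0) ->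
  forall k, F 'X^k = \sum_(i < m) 'C(k, i)%:R * F (('X - 1) ^+ i).
Proof.
move=> Hm k.
have Hi i : (m <= i)%N -> F (('X - 1) ^+ i) = 0.
  move=> mi; rewrite -(subnKC mi) exprD.
  have -> : ('X - 1 : {poly R}) ^+ m = (1 - 'X) ^+ m * ((-1) ^+ m).
    by rewrite -exprMn; congr (_ ^+ m); ring.
  by rewrite -mulrA Hm.
have -> : F 'X^k = \sum_(i < k.+1) 'C(k, i)%:R * F (('X - 1) ^+ i).
  have -> : 'X^k = (1 + ('X - 1)) ^+ k :> {poly R} by rewrite addrC subrK.
  rewrite exprDn linear_form_sum; apply: eq_bigr => i _.
  by rewrite expr1n mul1r -mulr_natl -polyC_natr mul_polyC FZ.
pose G i := 'C(k, i)%:R * F (('X - 1) ^+ i).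
rewrite -(big_mkord predT G) -[RHS](big_mkord predT G).
(* Since k may lie on either side of m, both sums are compared with the one up to k + m: the
   binomials vanish beyond k, the form F beyond m. *)
have H1 : \sum_(0 <= i < k.+1) G i = \sum_(0 <= i < k.+1 + m) G i.
  rewrite [RHS](big_cat_nat (n := k.+1)) ?leq_addr//=.
  rewrite [X in _ + X]big_nat [X in _ + X]big1 ?addr0//.
  by move=> i /andP[ki _]; rewrite /G bin_small// mul0r.
rewrite H1 [LHS](big_cat_nat (n := m)) ?leq_addl//=.
rewrite [X in _ + X]big_nat [X in _ + X]big1 ?addr0//.
by move=> i /andP[mi _]; rewrite /G Hi// mulr0.
Qed.

End functional.

Variable F : {poly R} -> R.
Hypothesis F_linear : forall (a : R) p q, F (a *: p + q) = a * F p + F q.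

Let F0 : F 0 = 0.
Proof. by have := F_linear (-1) 0 0; rewrite scaler0 addr0 mulN1r addNr. Qed.

Let FZ a p : F (a *: p) = a * F p.
Proof. by have := F_linear a p 0; rewrite addr0 F0 addr0. Qed.

(** The form p -> F(D^m p) is determined by its values at (X - 1)^i for i < m, and these vanish
    because D^m kills degrees below m. As D^m X^(k + m) is a nonzero multiple of X^k, F vanishes
    too. *)
Lemma linear_form_eq0_polyharmonic m : (forall q, F (iter m D ((1 - 'X) ^+ m * q)) = 0) ->
  forall k, F 'X^k = 0.
Proof.
move=> H k.
have lT (a : R) p q : F (iter m D (a *: p + q)) = a * F (iter m D p) + F (iter m D q).
  by rewrite iter_radial_linear F_linear.
have := @linear_form_binomial (fun p => F (iter m D p)) lT m H (k + m).
rewrite iter_radialXn FZ big1 => [/eqP|i _].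
  by rewrite mulf_eq0 gt_eqF ?radial_coef_gt0//= => /eqP.
rewrite iter_radial_small ?F0 ?mulr0//.
by rewrite -[1]/(1%:P) size_exp_XsubC ltn_ord.
Qed.

(** * The linear relations at the roots of lambda and the determinant *)

Section bessel_determinant.
Variables (m t : nat) (lambda : R).
Hypotheses (t1 : (1 <= t <= m)%N) (lambda0 : 0 < lambda).
Hypothesis F_bounded : exists K, forall k, `|F 'X^k| <= K.
Local Notation s := (m - t)%N.

Definition dirichlet_operator p : {poly R} :=
  (-1) ^+ m *: iter m D p - (lambda * (-1) ^+ s) *: iter s D p.

Hypothesis F_dirichlet : forall q, F (dirichlet_operator ((1 - 'X) ^+ m * q)) = 0.

Let T p := F (dirichlet_operator p).

Let T_linear (a : R) p q : T (a *: p + q) = a * T p + T q.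
Proof.
rewrite /T -F_linear; congr F; rewrite /dirichlet_operator !iter_radial_linear.
by rewrite !scalerDr !scalerA -!mul_polyC !polyCM; ring.
Qed.

Let T_E p : T p = (-1) ^+ m * F (iter m D p) - lambda * (-1) ^+ s * F (iter s D p).
Proof.
by rewrite /T /dirichlet_operator F_linear -scaleNr FZ mulNr.
Qed.

Let T_binomial k : T 'X^k = \sum_(i < m) 'C(k, i)%:R * T (('X - 1) ^+ i).
Proof. exact: linear_form_binomial. Qed.

(** Both terms of the operator apply D at least m - t times, and each application lowers the
    degree. *)
Let T_small i : (i < s)%N -> T (('X - 1) ^+ i) = 0.
Proof.
move=> ti; have sz : size (('X - 1 : {poly R}) ^+ i) = i.+1.
  by rewrite -[1]/(1%:P) size_exp_XsubC.
rewrite T_E !iter_radial_small ?sz ?F0 ?mulr0 ?subrr//.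
by apply: leq_trans ti _; exact: leq_subr.
Qed.

Section one_root.
(** It stands for (gamma_j / 2)^2, so that 4 w = gamma_j^2 is a t-th root of lambda. *)
Variable w : R[i].
Hypothesis wt : (4 * w) ^+ t = (lambda%:C)%C.
Local Open Scope complex_scope.
Local Notation C := (R[i]^o).
Local Notation a := (bessel_term nu w).

Let sum_iter j n : \sum_(0 <= k < n + j) a k * (F (iter j D 'X^k))%:C =
  (- (4 * w)) ^+ j * \sum_(0 <= k < n) a k * (F 'X^k)%:C.
Proof.
rewrite sum_split_shift => [|k kj]; last first.
  by rewrite iter_radial_small ?size_polyXn// F0 mulr0.
rewrite mulr_sumr; apply: eq_bigr => k _.
rewrite iter_radialXn FZ rmorphM /= mulrA.
by rewrite [RHS]mulrA -(bessel_term_radial w j k).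
Qed.

(* The series sum_k a_k T('X^k), with a_k = (-w)^k / (k! Gamma(k + nu)), telescopes
   to 0 since (4w)^t = lambda, while the binomial expansion of T('X^k) rewrites it
   with the shifted Bessel series. *)
Lemma bessel_relation :
  \sum_(i < m) (T (('X - 1) ^+ i))%:C *
    (((i`!%:R)^-1)%:C * (- w) ^+ i * bessel_sum (i%:R + nu) w) = 0.
Proof.
have [t_gt0 tm] := andP t1.
pose Bn n : C := \sum_(0 <= k < n) a k * (F 'X^k)%:C.
have [K HK] := F_bounded.
have K0 : 0 <= K by apply: le_trans (HK 0%N).
have [K' K'0 HK'] := bessel_term_bound w nu_gt0.
have cB : exists b : R[i], Bn @ \oo --> (b : C).
  apply: (@complex_series_cvg R (fun k => a k * (F 'X^k)%:C) (K' * K) (Normc.normc w)).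
    exact: normc_ge0.
  move=> n; rewrite Normc.normcM normc_real mulrAC.
  by apply: ler_pM => //; exact: normc_ge0.
have [b cb] := cB.
(* With the sum cut at n + m, shifting by m leaves the partial sum [Bn n] and shifting by m - t
   leaves [Bn (n + t)]; both tend to b, so their difference tends to 0. *)
pose A n : C := \sum_(0 <= k < n + m) a k * (T 'X^k)%:C.
have A1 n : A n = (lambda%:C * (4 * w) ^+ s) * (Bn n - Bn (n + t)%N).
  have E : (n + m = (n + t) + s)%N by rewrite -addnA subnKC.
  have -> : A n = (-1) ^+ m * (\sum_(0 <= k < n + m) a k * (F (iter m D 'X^k))%:C) -
     lambda%:C * (-1) ^+ s * (\sum_(0 <= k < n + m) a k * (F (iter s D 'X^k))%:C).
    rewrite /A !mulr_sumr -sumrB; apply: eq_bigr => k _.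
    rewrite T_E rmorphB !rmorphM /= !rmorphXn rmorphN rmorph1; ring.
  rewrite sum_iter [in X in _ - X]E sum_iter -/(Bn n) -/(Bn (n + t)%N).
  have -> : (-1) ^+ m * ((- (4 * w)) ^+ m * Bn n) = (4 * w) ^+ m * Bn n.
    by rewrite mulrA -exprMn mulN1r opprK.
  have -> : lambda%:C * (-1) ^+ s * ((- (4 * w)) ^+ s * Bn (n + t)%N) =
      lambda%:C * (4 * w) ^+ s * Bn (n + t)%N.
    by rewrite mulrA -[_ * _ * _ ^+ s]mulrA -exprMn mulN1r opprK.
  have -> : (4 * w) ^+ m = lambda%:C * (4 * w) ^+ s.
    by rewrite -wt -exprD subnKC.
  by rewrite -mulrBr.
have cA : A @ \oo --> (0 : C).
  rewrite (_ : A = fun n => (lambda%:C * (4 * w) ^+ s) * (Bn n - Bn (n + t)%N)); last exact/funext.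
  rewrite -[X in _ --> X](mulr0 (lambda%:C * (4 * w) ^+ s)).
  apply: (@cvgMr _ _ _ _ (fun n => Bn n - Bn (n + t)%N : C)).
  rewrite -[X in _ --> X](subrr (b : C)); apply: cvgB => //.
  by rewrite (cvg_shiftn t).
have A2 n : A n = \sum_(i < m) (T (('X - 1) ^+ i))%:C *
    \sum_(0 <= k < n + m) 'C(k, i)%:R * a k.
  rewrite /A.
  transitivity (\sum_(0 <= k < n + m) \sum_(i < m) (T (('X - 1) ^+ i))%:C * ('C(k, i)%:R * a k)).
    apply: eq_bigr => k _; rewrite T_binomial rmorph_sum mulr_sumr; apply: eq_bigr => i _.
    by rewrite rmorphM /= rmorph_nat; ring.
  by rewrite exchange_big; apply: eq_bigr => i _; rewrite mulr_sumr.
apply/esym; apply: (complex_cvg_unique cA).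
rewrite (_ : A = fun n => \sum_(i < m) (T (('X - 1) ^+ i))%:C *
    \sum_(0 <= k < n + m) 'C(k, i)%:R * a k); last exact/funext.
apply: (cvg_big (F := fun (i : 'I_m) n => (T (('X - 1) ^+ i))%:C *
    \sum_(0 <= k < n + m) 'C(k, i)%:R * a k)) => i.
apply: (@cvgMr _ _ _ _ (fun n => \sum_(0 <= k < n + m) 'C(k, i)%:R * a k : C)).
rewrite (cvg_shiftn m (fun n => \sum_(0 <= k < n) 'C(k, i)%:R * a k : C)).
by apply: bessel_binomial_cvg; exact: nu_gt0.
Qed.

End one_root.

(** Gives access at gamma_j to the power series form of [Jtilde], which is stated away from 0. *)
Lemma gam_neq0 (j : 'I_t) : gam lambda j != 0.
Proof.
rewrite /gam mulf_neq0//.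
  by rewrite eq_complex /= negb_and gt_eqF// powR_gt0.
apply/eqP => E; have := @cexpD R (0 +i* (j%:R * pi / t%:R))%C (- (0 +i* (j%:R * pi / t%:R)))%C.
rewrite E mul0r subrr /cexp /= expR0 cos0 sin0 !mulr0 mulr1 => /eqP.
by rewrite eq_complex /= oner_eq0.
Qed.

Lemma gam_root (j : 'I_t) : (4 * (gam lambda j / 2) ^+ 2) ^+ t = (lambda%:C)%C.
Proof.
have [t_gt0 tm] := andP t1.
have -> : 4 * (gam lambda j / 2) ^+ 2 = gam lambda j ^+ 2.
  by rewrite expr_div_n; field.
rewrite -exprM /gam exprMn -cexpMn -rmorphXn /= -powR_mulrn ?powR_ge0// -powRrM.
have t2 : (2 * t)%:R != 0 :> R by rewrite pnatr_eq0 muln_eq0 -lt0n.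
rewrite mulVf// powRr1; last exact: ltW.
rewrite (_ : _ * _ = j%:R * (0 +i* (2 * pi))%C).
  rewrite cexpMn (_ : cexp _ = 1) ?expr1n ?mulr1//.
  by rewrite /cexp /= expR0 !mul1r mulrC mulr_natr cos2pi sin2pi.
have -> : ((2 * t)%:R : R[i]) = ((2 * t)%:R : R)%:C%C by rewrite rmorph_nat.
have -> : (j%:R : R[i]) = (j%:R : R)%:C%C by rewrite rmorph_nat.
have tn0 : t%:R != 0 :> R by rewrite pnatr_eq0 -lt0n.
apply/eqP; rewrite eq_complex /= natrM; apply/andP; split; apply/eqP; first by ring.
by field.
Qed.

(* The numbers T(('X - 1)^(s + i)), suitably scaled, form a row vector in the
   kernel of L(t, l + m - t). *)
Lemma linear_form_eq0_bessel : \det (Lmatrix d t (l + s) lambda) != 0 ->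
  forall k, F 'X^k = 0.
Proof.
have [t_gt0 tm] := andP t1.
move=> det0.
(* The relation carries (-w)^i = (-gamma)^i gamma^i / 4^i, while row i of L carries (-gamma)^i
   gamma^i / 2^i, the power of 2 coming from the prefactor of [Jtilde]. The remaining 2^(-i) is put
   into y, together with the factorial. *)
pose y : 'rV[R[i]]_t := \row_i (T (('X - 1) ^+ (s + i)) / (((s + i)`!)%:R * 2 ^+ i))%:C%C.
have yL : y *m Lmatrix d t (l + s) lambda = 0.
  apply/rowP => j; rewrite !mxE; have g0 := gam_neq0 j.
  set g := gam lambda j in g0 *.
  pose w := (g / 2) ^+ 2.
  have := bessel_relation (gam_root j); rewrite -/g -/w.
  rewrite -(big_mkord predT (fun i => (T (('X - 1) ^+ i))%:C%C *
    ((((i`!)%:R)^-1)%:C%C * (- w) ^+ i * bessel_sum (i%:R + nu) w))).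
  rewrite -{1}(subnKC tm) sum_split_shift; last first.
    by move=> k ks; rewrite T_small// mul0r.
  rewrite big_mkord => Hrel.
  (* The factor c / (-w)^(m - t) depends on the column j but not on i: entry j of the product is
     this multiple of the relation at gamma_j. *)
  pose c := (2 `^ (1 - (l + s)%:R - d%:R / 2))%:C%C * g ^+ (l + s).
  have wn0 : (- w) ^+ s != 0.
    by rewrite expf_neq0// oppr_eq0 expf_neq0// mulf_neq0// invr_eq0 pnatr_eq0.
  rewrite (eq_bigr (fun i : 'I_t => c / (- w) ^+ s * ((T (('X - 1) ^+ (i + s)))%:C%C *
      (((((i + s)`!)%:R)^-1)%:C%C * (- w) ^+ (i + s) * bessel_sum ((i + s)%:R + nu) w)))).
    by rewrite -mulr_sumr Hrel mulr0.
  move=> i _; rewrite !mxE -/g JtildeE//.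
  have -> : csum (fun k => ((-1) ^+ k / (k`!%:R *
      Gamma (k%:R + (l + s + i)%:R + d%:R / 2)))%:C%C * (g / 2) ^+ k.*2) =
      bessel_sum ((i + s)%:R + nu) w.
    rewrite /bessel_sum; congr csum; apply/funext => k.
    rewrite /bessel_term /w -exprM mul2n.
    rewrite (_ : k%:R + (l + s + i)%:R + d%:R / 2 = k%:R + ((i + s)%:R + nu))//.
    by rewrite !natrD; ring.
  have -> : (2 `^ (1 - (l + s + i)%:R - d%:R / 2) : R) = 2 `^ (1 - (l + s)%:R - d%:R / 2) / 2 ^+ i.
    rewrite -powR_mulrn// -powRB; last by rewrite pnatr_eq0 implybT.
    by congr (_ `^ _); rewrite !natrD; ring.
  move: (bessel_sum _ _) => S.
  rewrite [(s + i)%N]addnC /c [g ^+ (_ + i)]exprD [(- w) ^+ (i + s)]exprD.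
  move: (T _) => T0.
  rewrite !rmorphM /= !invfM !rmorphM /=.
  have -> : (- w) ^+ i = (- g) ^+ i * g ^+ i * ((2 ^+ i)^-1)%:C%C * ((2 ^+ i)^-1)%:C%C.
    rewrite rmorphV ?unitfE ?expf_neq0//= rmorphXn rmorph_nat -exprMn -exprVn -!exprMn.
    by congr (_ ^+ i); rewrite /w; ring.
  have cancel (x b a e p h g' S' W : R[i]) : W != 0 ->
      x * (b * a) * (e * (p * a * (h * g') * S')) =
      p * h / W * (x * (b * (e * g' * a * a * W) * S')).
    by move=> W0; field.
  exact: cancel.
have y0 : y = 0.
  apply/eqP/negPn/negP => yn0; move/negP : det0; apply.
  by apply/det0P; exists y.
have Tb i : (i < m)%N -> T (('X - 1) ^+ i) = 0.
  move=> im; case: (ltnP i s) => [/T_small//|si].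
  have ist : (i - s < t)%N by rewrite ltn_subLR// subnK.
  have := congr1 (fun M : 'rV_t => M ord0 (Ordinal ist)) y0.
  rewrite !mxE /= subnKC// => /eqP.
  rewrite eq_complex /= eqxx andbT mulf_eq0 invr_eq0 mulf_eq0 pnatr_eq0.
  by rewrite -[_`! == _]negbK -lt0n fact_gt0 /= expf_eq0 pnatr_eq0 andbF orbF => /eqP.
have T0 k : T 'X^k = 0.
  by rewrite T_binomial big1// => i _; rewrite Tb// mulr0.
(* T(X^(k + m)) is a combination of F(X^k) and F(X^(k + t)) in which the latter has a nonzero
   coefficient, as lambda is nonzero. This is a recursion of step t; its t initial values come from
   T(X^(k + m - t)) with k < t, where D^m vanishes for reasons of degree. *)
have step k : F 'X^k = 0 -> F 'X^(k + t) = 0.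
  move=> Fk; have := T0 (k + m)%N; rewrite T_E iter_radialXn FZ Fk !mulr0 sub0r => /eqP.
  have -> : (k + m = (k + t) + s)%N by rewrite -addnA subnKC.
  rewrite iter_radialXn FZ oppr_eq0 !mulf_eq0 gt_eqF//= signr_eq0 /=.
  by rewrite gt_eqF ?radial_coef_gt0//= => /eqP.
have small k : (k < t)%N -> F 'X^k = 0.
  move=> kt; have := T0 (k + s)%N; rewrite T_E iter_radial_small; last first.
    by rewrite size_polyXn; lia.
  rewrite F0 mulr0 sub0r iter_radialXn FZ => /eqP.
  rewrite oppr_eq0 !mulf_eq0 gt_eqF//= signr_eq0 /=.
  by rewrite gt_eqF ?radial_coef_gt0//= => /eqP.
elim/ltn_ind => k IH; case: (ltnP k t) => [/small//|tk].
by rewrite -(subnK tk); apply/step/IH; rewrite ltn_subrL t_gt0 (leq_trans t_gt0 tk).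
Qed.

End bessel_determinant.
End radial_operator.

(** * Moments of an eigenfunction *)

Section moments.
Variables (R : realType) (d : nat).
Hypothesis d0 : (0 < d)%N.
Local Notation V := 'rV[R]_d.
Local Notation mu := (lebesgue_rV R d).
Local Notation B := (@unit_ball R d).
Local Notation intB f := (mu.-integrable B (EFin \o f)).
Local Notation I f := (\int[mu]_(x in B) f x).
Implicit Types (f g h u P : V -> R).

Let mB : measurable B := @measurable_unit_ball R d.

Lemma L2_polynomial_integrable u P : L2_ball u -> polynomial_fun P ->
  intB (fun x => u x * P x).
Proof.
move=> Lu HP; apply: integrable_boundedM; first exact: L2_ball_integrable.
  exact: polynomial_measurable.
exact: polynomial_bounded.
Qed.

Lemma moment_linear u c P Q : L2_ball u -> polynomial_fun P -> polynomial_fun Q ->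
  I (fun x => u x * (c * P x + Q x)) = c * I (fun x => u x * P x) + I (fun x => u x * Q x).
Proof.
move=> Lu HP HQ; have iP := L2_polynomial_integrable Lu HP.
have iQ := L2_polynomial_integrable Lu HQ.
rewrite -RintegralZl// -RintegralD//; last exact: (integrableZl mB c iP).
by apply: eq_Rintegral => x _; ring.
Qed.

(** Replaces a decomposition into homogeneous components. The induction generalizes Phi: for a
    product f g it freezes g and applies the hypothesis for f, then freezes a homogeneous factor and
    applies the hypothesis for g. *)
Lemma polynomial_fun_additive_eq0 (Phi : (V -> R) -> R) :
  (forall f g, polynomial_fun f -> polynomial_fun g ->
    Phi (fun x => f x + g x) = Phi f + Phi g) ->
  (forall n f, homogeneous n f -> Phi f = 0) ->
  forall P, polynomial_fun P -> Phi P = 0.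
Proof.
move=> HD H0 P HP; elim: HP Phi HD H0 => [c|i|f g Hf IHf Hg IHg|f g Hf IHf Hg IHg] Phi HD H0.
- exact/H0/homogeneous_cst.
- apply: (H0 1%N); rewrite (_ : (fun x => _) = (fun x : V => x ord0 i * 1)).
    exact/homogeneous_mulX/homogeneous_cst.
  by apply/funext => x; rewrite mulr1.
- by rewrite HD// IHf// IHg// addr0.
- apply: (IHf (fun f => Phi (fun x => f x * g x))) => [f1 f2 Hf1 Hf2|n f1 Hf1].
    rewrite -HD; [|exact: polynomialM|exact: polynomialM].
    by congr Phi; apply/funext => x; rewrite mulrDl.
  apply: (IHg (fun g => Phi (fun x => f1 x * g x))) => [g1 g2 Hg1 Hg2|k g1 Hg1].
    have Pf1 := homogeneous_polynomial Hf1.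
    rewrite -HD; [|exact: polynomialM|exact: polynomialM].
    by congr Phi; apply/funext => x; rewrite mulrDr.
  exact: H0 (homogeneousM Hf1 Hg1).
Qed.

Lemma iter_laplacian_radial j l h (p : {poly R}) : homogeneous l h ->
  laplacian h = (fun=> 0) ->
  iter j (@laplacian R d) (fun x => p.[sqnorm x] * h x) =
  (fun x => (iter j (radial_laplacian d l) p).[sqnorm x] * h x).
Proof.
by move=> Hh h0; elim: j => //= j ->; rewrite (laplacian_poly_harmonic _ Hh h0).
Qed.

Lemma iter_laplacian_linear j c f g : elementary f -> elementary g ->
  iter j (@laplacian R d) (fun x => c * f x + g x) =
  (fun x => c * iter j (@laplacian R d) f x + iter j (@laplacian R d) g x).
Proof.
move=> ef eg; elim: j => //= j ->.
have efj := elementary_iter_laplacian j ef; have egj := elementary_iter_laplacian j eg.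
rewrite laplacianD ?laplacianZ//.
by apply: elementaryM => //; exact: elementary_cst.
Qed.

Lemma homogeneous_iter_laplacian j n f : homogeneous n f ->
  homogeneous (n - j.*2) (iter j (@laplacian R d) f) /\
  ((n < j.*2)%N -> iter j (@laplacian R d) f = (fun=> 0)).
Proof.
move=> Hf; elim: j => [|j [IH IH0]]; first by rewrite subn0.
have [H1 H2] := homogeneous_laplacian IH; split.
  by rewrite iterS doubleS -addn2 subnDA subn2.
rewrite iterS => nj; apply: H2; lia.
Qed.

(* Almansi: subtracting a multiple of |x|^(2k) times the harmonic polynomial
   Delta^k f lowers the polyharmonic order of f. *)
Lemma moment_eq0 u : L2_ball u ->
  (forall l h, homogeneous l h -> laplacian h = (fun=> 0) ->
    forall k, I (fun x => u x * (sqnorm x ^+ k * h x)) = 0) ->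
  forall P, polynomial_fun P -> I (fun x => u x * P x) = 0.
Proof.
move=> Lu Hu; apply: polynomial_fun_additive_eq0 => [f g Hf Hg|n f Hf].
  have := moment_linear 1 Lu Hf Hg; rewrite mul1r => <-.
  by apply: eq_Rintegral => x _; rewrite mul1r.
(* Induction on the polyharmonic order; it may start from n + 1, because the degree n is below 2(n +
   1). *)
suff H k g : homogeneous n g -> iter k (@laplacian R d) g = (fun=> 0) ->
    I (fun x => u x * g x) = 0.
  by apply: (H n.+1) => //; apply: (homogeneous_iter_laplacian n.+1 Hf).2; lia.
elim: k g => [|k IH] {Hf}f Hf /= Hk.
  rewrite Hk (_ : (fun x => _) = (fun=> 0)); first by rewrite Rintegral_cst// mul0r.
  by apply/funext => x; rewrite mulr0.
have [Hh h0] := homogeneous_iter_laplacian k Hf.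
case: (ltnP n k.*2) => [/h0|kn]; first exact: IH.
set h := iter k _ f in Hh Hk.
pose c := radial_coef R d (n - k.*2) k 0.
(* Since h is harmonic, Delta^k (|x|^(2k) h) = c h, so subtracting |x|^(2k) h / c from f cancels
   Delta^k f = h. *)
have c0 : c != 0 by rewrite gt_eqF// radial_coef_gt0.
pose g x := sqnorm x ^+ k * h x.
have Hg : homogeneous n g.
  by rewrite -(subnKC kn); apply: homogeneousM => //; exact: homogeneous_sqnormX.
have Eg : iter k (@laplacian R d) g = (fun x => c * h x).
  have -> : g = fun x => ('X^(0 + k) : {poly R}).[sqnorm x] * h x.
    by apply/funext => x; rewrite hornerXn.
  rewrite (iter_laplacian_radial _ _ Hh Hk) iter_radialXn.
  by apply/funext => x; rewrite hornerZ hornerXn expr0 mulr1.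
have Pf := homogeneous_polynomial Hf; have Pg := homogeneous_polynomial Hg.
have := IH (fun x => - c^-1 * g x + f x).
rewrite moment_linear// (Hu _ _ Hh Hk) mulr0 add0r; apply.
  by apply: homogeneousD => //; exact: homogeneousZ.
have eg := homogeneous_elementary Hg; have ef := homogeneous_elementary Hf.
rewrite iter_laplacian_linear//.
by apply/funext => x; rewrite Eg -/h mulrA mulNr mulVf// mulN1r addNr.
Qed.

End moments.

(** * Eigenfunctions: positivity of lambda and vanishing of a determinant *)

Lemma horner_onem_powerM (R : comNzRingType) m (q : {poly R}) (x : R) :
  ((1 - 'X) ^+ m * q).[x] = (1 - x) ^+ m * q.[x].
Proof. by rewrite hornerM horner_exp hornerD hornerN hornerX (hornerC 1). Qed.

Section eigenfunctions.
Variables (R : realType) (d m t : nat) (lambda : R) (u : 'rV[R]_d -> R).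
Hypothesis d0 : (0 < d)%N.
Local Notation V := 'rV[R]_d.
Local Notation mu := (lebesgue_rV R d).
Local Notation B := (@unit_ball R d).
Local Notation intB f := (mu.-integrable B (EFin \o f)).
Local Notation I f := (\int[mu]_(x in B) f x).
Local Notation lap := (@laplacian R d).
Hypothesis Su : sobolev0 m u.
Implicit Types (h P : V -> R) (p q : {poly R}).

Let mB : measurable B := @measurable_unit_ball R d.

Let Lu : L2_ball u. Proof. by case: Su => [[]]. Qed.

Section radial_moments.
Variables (l : nat) (h : V -> R).
Hypothesis Hh : homogeneous l h.
Hypothesis h0 : laplacian h = (fun=> 0).

Definition radial_moment p : R := I (fun x => u x * (p.[sqnorm x] * h x)).

Let radial_polynomial p : polynomial_fun (fun x => p.[sqnorm x] * h x).
Proof.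
apply: polynomialM; last exact: homogeneous_polynomial Hh.
by apply: polynomial_horner; exact: polynomial_sqnorm.
Qed.

Lemma radial_moment_linear (a : R) p q :
  radial_moment (a *: p + q) = a * radial_moment p + radial_moment q.
Proof.
rewrite /radial_moment -moment_linear//; apply: eq_Rintegral => x _.
by rewrite hornerD hornerZ; ring.
Qed.

(** On the ball |x|^(2k) <= 1. Uniformity in k lets the moments be summed against the Bessel
    coefficients. *)
Lemma radial_moment_bounded : exists K, forall k, `|radial_moment 'X^k| <= K.
Proof.
have Ph := homogeneous_polynomial Hh.
have iuh := L2_polynomial_integrable Lu Ph.
exists (I (fun x => `|u x * h x|)) => k.
have ik := L2_polynomial_integrable Lu (radial_polynomial 'X^k).
apply: le_trans (le_normr_Rintegral mB ik) _.
apply: le_Rintegral => //; [exact: integrable_norm ik|exact: integrable_norm iuh|].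
move=> x Bx; rewrite hornerXn mulrCA normrM ler_piMl//.
rewrite normrX ger0_norm ?sqnorm_ge0// exprn_ile1 ?sqnorm_ge0//.
by move: Bx; rewrite unit_ballE => /ltW.
Qed.

Lemma radial_moment_iter j q :
  I (fun x => u x * iter j lap (fun x => (1 - sqnorm x) ^+ m * (q.[sqnorm x] * h x)) x) =
  radial_moment (iter j (radial_laplacian d l) ((1 - 'X) ^+ m * q)).
Proof.
rewrite /radial_moment.
rewrite (_ : (fun x => (1 - sqnorm x) ^+ m * _) =
  (fun x => ((1 - 'X) ^+ m * q).[sqnorm x] * h x)).
  by rewrite (iter_laplacian_radial _ _ Hh h0).
by apply/funext => x; rewrite horner_onem_powerM mulrA.
Qed.

End radial_moments.

(** The weak equation is tested with the cut-offs of (1 - |x|^2)^m P, and both sides pass to the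
    limit by [energy_cutoff]. *)
Lemma eigen_elementary P : polynomial_fun P ->
  (forall phi, sobolev0 m phi ->
    I (nabla_dot m u phi) = lambda * I (nabla_dot (m - t) u phi)) ->
  (-1) ^+ m * I (fun x => u x * iter m lap (fun x => (1 - sqnorm x) ^+ m * P x) x) =
  lambda * ((-1) ^+ (m - t) *
    I (fun x => u x * iter (m - t) lap (fun x => (1 - sqnorm x) ^+ m * P x) x)).
Proof.
move=> HP H; have eP := polynomial_elementary HP.
have c1 := energy_cutoff Su (leqnn m) HP.
have c2 := energy_cutoff Su (leq_subr t m) HP.
apply: (cvg_unique (@Rhausdorff R) c1).
rewrite /= (_ : (fun n => _) = (fun n => lambda * I (nabla_dot (m - t) u (cutoff_fun m n P)))).
  exact: cvgMr.
apply/funext => n; apply: H; apply: sobolev0_elementary.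
  exact: test_function_cutoff.
exact: elementary_cutoff.
Qed.

Hypothesis u_eigen : forall phi, sobolev0 m phi ->
  I (nabla_dot m u phi) = lambda * I (nabla_dot (m - t) u phi).

Lemma radial_moment_dirichlet l h q : homogeneous l h -> laplacian h = (fun=> 0) ->
  radial_moment h (dirichlet_operator d l m t lambda ((1 - 'X) ^+ m * q)) = 0.
Proof.
move=> Hh h0; have Ph := homogeneous_polynomial Hh.
have lin := radial_moment_linear Hh.
have F0 : radial_moment h 0 = 0.
  by have := lin (-1) 0 0; rewrite scaler0 addr0 mulN1r addNr.
have FZ a p : radial_moment h (a *: p) = a * radial_moment h p.
  by have := lin a p 0; rewrite F0 !addr0.
rewrite /dirichlet_operator lin -scaleNr FZ.
rewrite -!(radial_moment_iter Hh h0) eigen_elementary//; first by ring.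
apply: polynomialM => //; apply: polynomial_horner; exact: polynomial_sqnorm.
Qed.

Lemma eigenfunction_eq0 :
  (forall l h, homogeneous l h -> laplacian h = (fun=> 0) ->
    forall k, radial_moment h 'X^k = 0) ->
  {ae mu, forall x, B x -> u x = 0}.
Proof.
move=> H; apply: ae_eq0_of_polynomials; first exact: L2_ball_integrable.
apply: moment_eq0 => // l h Hh h0 k; rewrite -[RHS](H l h Hh h0 k).
by apply: eq_Rintegral => x _; rewrite hornerXn.
Qed.

Lemma eigenvalue_gt0 : ~ {ae mu, forall x, B x -> u x = 0} -> 0 < lambda.
Proof.
move=> un0; rewrite ltNge; apply/negP => l0; apply: un0.
apply: eigenfunction_eq0 => l h Hh h0.
apply: (linear_form_eq0_polyharmonic (l := l) d0 (radial_moment_linear Hh) (m := m)) => q.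
rewrite -(radial_moment_iter Hh h0); apply: energy_eq0 => //.
- rewrite u_eigen//; apply: mulr_le0_ge0 => //; apply: Rintegral_ge0 => x _.
  by rewrite nabla_dotE sumr_ge0// => o _; rewrite -expr2 sqr_ge0.
- apply: polynomial_elementary.
  rewrite (_ : (fun x => _) = (fun x => ((1 - 'X) ^+ m * q).[sqnorm x] * h x)).
    apply: polynomialM; last exact: homogeneous_polynomial Hh.
    by apply: polynomial_horner; exact: polynomial_sqnorm.
  by apply/funext => x; rewrite horner_onem_powerM mulrA.
Qed.

Hypothesis t1 : (1 <= t <= m)%N.

Lemma eigenvalue_det : ~ {ae mu, forall x, B x -> u x = 0} ->
  exists l : nat, \det (Lmatrix d t (l + (m - t))%N lambda) = 0.
Proof.
move=> un0; apply: contrapT => Hdet; apply: (un0).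
apply: eigenfunction_eq0 => l h Hh h0.
apply: (linear_form_eq0_bessel (l := l) d0 (radial_moment_linear Hh) t1 (eigenvalue_gt0 un0)).
- exact: radial_moment_bounded Hh.
- by move=> q; exact: radial_moment_dirichlet.
- by apply/eqP => E; apply: Hdet; exists l.
Qed.

End eigenfunctions.

Theorem corollaryA3 (R : realType) (d m t : nat) (d_gt0 : (0 < d)%N)
    (t_range : (1 <= t <= m)%N) (lambda : R)
    (eigen_lambda : @is_eigenvalue R d m t lambda) :
  0 < lambda /\
  exists l : nat, \det (Lmatrix d t (l + (m - t))%N lambda) = 0.
Proof.
have [u [Su un0 u_eigen]] := eigen_lambda.
split; first exact: (eigenvalue_gt0 d_gt0 Su u_eigen un0).
exact: (eigenvalue_det d_gt0 Su u_eigen t_range un0).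
Qed.
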